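(* Let $k\in\{0,\dots,m\}$ and $R>0$, and let $x\colon \Sigma^{m}\rightarrow\mathbb{R}^{m+1}$ be a complete self-shrinker (based at the origin). Assume that $\left\vert \mathbf{H}\right\vert \leq\sqrt{k}$ on $\Sigma$ and that $x(\Sigma)$ is confined inside the (closed) domain bounded by $\mathcal{C}^{k,m-k}_{R}=\mathbb{S}^k_R\times\mathbb{R}^{m-k}$. If $x(\Sigma)\cap \mathcal{C}^{k,m-k}_{R} \neq\emptyset$ then: (a) $R=\sqrt{k}$ (when $k=0$ this is a pure normalization and carries no information, see the conventions), (b) $x:\Sigma \rightarrow\mathcal{C}^{k,m-k}_{\sqrt{k}}$ is a Riemannian covering map. In particular, if $k\geq2$, then $\Sigma=\mathcal{C}^{k,m-k}_{\sqrt{k}}$ in the Riemannian sense (i.e. $x$ is an isometry onto $\mathcal{C}^{k,m-k}_{\sqrt{k}}$).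
   Context: A self-shrinker (based at $0$) is a connected, isometrically immersed hypersurface $x:\Sigma^m\to\mathbb{R}^{m+1}$ whose mean curvature vector field $\mathbf{H}$ satisfies $x^{\perp}=-\mathbf{H}$, where $(\cdot)^\perp$ is the projection on the normal bundle of $\Sigma$; $\mathbf{H}=\mathrm{tr}_\Sigma\mathbf{A}$ with $\mathbf{A}=Ddx$ the second fundamental form. Complete means complete in the induced metric. $\mathbb{S}^k_R\subset\mathbb{R}^{k+1}$ is the round $k$-sphere of radius $R$ centered at the origin, and $\mathcal{C}^{k,m-k}_{R}=\mathbb{S}^k_R\times\mathbb{R}^{m-k}\subset\mathbb{R}^{k+1}\times\mathbb{R}^{m-k}=\mathbb{R}^{m+1}$. For $k\ge1$ the closed domain bounded by $\mathcal{C}^{k,m-k}_{R}$ is the solid cylinder $\{(y',y'')\in\mathbb{R}^{k+1}\times\mathbb{R}^{m-k}:|y'|\le R\}$. Convention for $k=0$: $\mathcal{C}^{0,m}$ denotes the hyperplane $\{0\}\times\mathbb{R}^m$ through the origin (independently of $R$, a hyperplane through the origin being invariant under dilations), and the domain bounded by it is one of the two corresponding closed half-spaces. *)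

(* Defs.v *)
From mathcomp Require Export all_boot all_order all_algebra.
From mathcomp Require Export all_classical all_reals all_analysis.
Export Order.TTheory GRing.Theory Num.Theory.
Export numFieldNormedType.Exports.

Set Implicit Arguments.
Unset Strict Implicit.
Unset Printing Implicit Defensive.

Local Open Scope classical_set_scope.
Local Open Scope ring_scope.

Section Calculus.
Context {R : realType}.

(* The norm carried by 'rV[R]_n in the library is the sup norm, so the
   Euclidean structure is introduced separately. *)
Definition dot n (v w : 'rV[R]_n) : R := (v *m w^T) 0 0.

Definition enorm n (v : 'rV[R]_n) : R := Num.sqrt (dot v v).

(* Class C^r on an open set U, through iterated directional derivatives; for
   finite-dimensional E (the only case used) this is the usual C^r. *)
Fixpoint Cr (E V : normedModType R) (r : nat) (U : set E) (f : E -> V) : Prop :=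
  (forall u, U u -> {for u, continuous f}) /\
  (if r is r'.+1 then
     forall v : E, (forall u, U u -> derivable f u v) /\ Cr r' U (fun u => 'D_v f u)
   else True).

Definition smooth_on (E V : normedModType R) (U : set E) (f : E -> V) : Prop :=
  forall r, Cr r U f.

Definition pd n (V : normedModType R) (i : 'I_n) (f : 'rV[R]_n -> V)
  (u : 'rV[R]_n) : V := 'D_(delta_mx 0 i) f u.

(* Row vectors: row i is the i-th partial derivative, so a tangent vector v is
   mapped to v *m jac f u. *)
Definition jac n p (f : 'rV[R]_n -> 'rV[R]_p) (u : 'rV[R]_n) : 'M[R]_(n, p) :=
  \matrix_(i < n) pd i f u.

(* Component of w orthogonal to the row space of J (J of full row rank). *)
Definition normal_part n p (J : 'M[R]_(n, p)) (w : 'rV[R]_p) : 'rV[R]_p :=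
  w - w *m J^T *m invmx (J *m J^T) *m J.

End Calculus.

(* chart_inv is only meaningful on chart_cod, chart_map only on chart_dom. *)
Record chart (R : realType) (m : nat) (T : topologicalType) := Chart {
  chart_dom : set T;
  chart_map :> T -> 'rV[R]_m;
  chart_inv : 'rV[R]_m -> T }.

Definition chart_cod (R : realType) m T (c : chart R m T) : set 'rV[R]_m :=
  c @` chart_dom c.

Definition is_chart (R : realType) m T (c : chart R m T) : Prop :=
  [/\ open (chart_dom c), open (chart_cod c),
      forall p, chart_dom c p -> chart_inv c (c p) = p,
      forall p, chart_dom c p -> {for p, continuous (chart_map c)} &
      forall u, chart_cod c u -> {for u, continuous (chart_inv c)}].

Record manifold (R : realType) (m : nat) := Manifold {
  carrier :> topologicalType;
  atlas : set (chart R m carrier);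
  chart_at : carrier -> chart R m carrier;
  manifold_hausdorff : hausdorff_space carrier;
  manifold_second_countable : @second_countable carrier;
  atlas_chart : forall c, atlas c -> is_chart c;
  chart_at_atlas : forall p, atlas (chart_at p);
  chart_at_dom : forall p, chart_dom (chart_at p) p;
  atlas_compat : forall c d, atlas c -> atlas d ->
    smooth_on (c @` (chart_dom c `&` chart_dom d)) (d \o chart_inv c) }.

(* gram c u is the matrix of the metric at the point of coordinates u in c. *)
Record riemannian_metric (R : realType) (m : nat) (M : manifold R m) :=
  RiemannianMetric {
    gram :> chart R m M -> 'rV[R]_m -> 'M[R]_m;
    gram_smooth : forall c, atlas c -> smooth_on (chart_cod c) (gram c);
    gram_sym : forall c u, atlas c -> chart_cod c u -> (gram c u)^T = gram c u;
    gram_pos : forall c u (v : 'rV[R]_m), atlas c -> chart_cod c u -> v != 0 ->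
      0 < (v *m gram c u *m v^T) 0 0;
    gram_change : forall c d p, atlas c -> atlas d ->
      chart_dom c p -> chart_dom d p ->
      let J := jac (d \o chart_inv c) (c p) in
      gram c (c p) = J *m gram d (d p) *m J^T }.

Section Distance.
Context {R : realType} {m : nat} {M : manifold R m} (g : riemannian_metric M).

(* A C^1 curve on the closed interval [0, 1] is one that is C^1 on a
   neighbourhood of it. *)
Definition C1_curve (gamma : R -> M) : Prop :=
  exists I : set R, [/\ open I, `[0, 1] `<=` I,
    (forall t, I t -> {for t, continuous gamma}) &
    forall c, atlas c ->
      Cr 1 (I `&` gamma @^-1` chart_dom c) (chart_map c \o gamma)].

(* Evaluated in the chart chosen at gamma t; by gram_change the value does not
   depend on this choice. *)
Definition speed (gamma : R -> M) (t : R) : R :=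
  let c := chart_at (gamma t) in
  let v := 'D_1 (chart_map c \o gamma) t in
  Num.sqrt ((v *m g c (c (gamma t)) *m v^T) 0 0).

Definition curve_length (gamma : R -> M) : \bar R :=
  (\int[lebesgue_measure]_(t in `[0%R, 1%R]) (speed gamma t)%:E)%E.

(* pw_C1_length p q l: some piecewise C^1 curve from p to q has length l. *)
Inductive pw_C1_length : M -> M -> \bar R -> Prop :=
| pw_nil p : pw_C1_length p p 0%E
| pw_cons gamma q l : C1_curve gamma -> pw_C1_length (gamma 1) q l ->
    pw_C1_length (gamma 0) q (curve_length gamma + l)%E.

Definition riemannian_dist (p q : M) : \bar R :=
  ereal_inf [set l | pw_C1_length p q l].

(* The limit is taken in the topology of M, which is that of the distance. *)
Definition complete_metric : Prop :=
  forall s : nat -> M,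
    (forall e : R, 0 < e -> exists N, forall i j, (N <= i)%N -> (N <= j)%N ->
       (riemannian_dist (s i) (s j) < e%:E)%E) ->
    exists p : M, s @ \oo --> p.

End Distance.

Section Immersions.
Context {R : realType} {m n : nat} {M : manifold R m}.

Definition in_chart (x : M -> 'rV[R]_n) (c : chart R m M) :
  'rV[R]_m -> 'rV[R]_n := x \o chart_inv c.

Definition smooth_map (x : M -> 'rV[R]_n) : Prop :=
  forall c, atlas c -> smooth_on (chart_cod c) (in_chart x c).

Definition immersion (x : M -> 'rV[R]_n) : Prop :=
  smooth_map x /\
  forall c u, atlas c -> chart_cod c u -> row_free (jac (in_chart x c) u).

(* The pull-back by x of the Euclidean inner product is g. *)
Definition metric_preserving (g : riemannian_metric M) (x : M -> 'rV[R]_n) :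
  Prop :=
  forall c u, atlas c -> chart_cod c u ->
    g c u = \matrix_(i, j) dot (pd i (in_chart x c) u) (pd j (in_chart x c) u).

Definition isometric_immersion (g : riemannian_metric M)
  (x : M -> 'rV[R]_n) : Prop := immersion x /\ metric_preserving g x.

(* Christoffel symbol Gamma^k_ij. *)
Definition christoffel (g : riemannian_metric M) (c : chart R m M)
  (k i j : 'I_m) (u : 'rV[R]_m) : R :=
  2^-1 * \sum_(l < m) invmx (g c u) k l *
    (pd i (fun w => g c w j l) u + pd j (fun w => g c w i l) u
     - pd l (fun w => g c w i j) u).

(* A = D dx, with D induced by the Levi-Civita connection of g. *)
Definition second_ff (g : riemannian_metric M) (x : M -> 'rV[R]_n)
  (c : chart R m M) (i j : 'I_m) (u : 'rV[R]_m) : 'rV[R]_n :=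
  pd i (pd j (in_chart x c)) u
  - \sum_(k < m) christoffel g c k i j u *: pd k (in_chart x c) u.

Definition mean_curvature (g : riemannian_metric M) (x : M -> 'rV[R]_n)
  (c : chart R m M) (u : 'rV[R]_m) : 'rV[R]_n :=
  \sum_(i < m) \sum_(j < m) invmx (g c u) i j *: second_ff g x c i j u.

(* Smoothness on an open set O of a map from R^n to M. *)
Definition smooth_into (O : set 'rV[R]_n) (G : 'rV[R]_n -> M) : Prop :=
  (forall y, O y -> {for y, continuous G}) /\
  forall c, atlas c ->
    smooth_on (O `&` G @^-1` chart_dom c) (chart_map c \o G).

(* Smoothness on a possibly non-open V: local existence of smooth extensions. *)
Definition smooth_into_subset (V : set 'rV[R]_n) (F : 'rV[R]_n -> M) : Prop :=
  forall q, V q -> exists O G, [/\ open O, O q, smooth_into O G &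
    forall y, O y -> V y -> F y = G y].

(* The (smooth) map x restricts to a diffeomorphism of the open set W onto the
   subset V of R^n. *)
Definition diffeo_onto (x : M -> 'rV[R]_n) (W : set M) (V : set 'rV[R]_n) :
  Prop :=
  x @` W = V /\
  exists2 F, smooth_into_subset V F & forall p, W p -> F (x p) = p.

(* C is a submanifold of R^n with the induced metric, so that preserving the
   metric of C is metric_preserving; V = C `&` O is the evenly covered
   neighbourhood of q, the W i are the sheets over it. *)
Definition riemannian_covering (g : riemannian_metric M) (x : M -> 'rV[R]_n)
  (C : set 'rV[R]_n) : Prop :=
  [/\ range x = C, smooth_map x, metric_preserving g x &
      forall q, C q -> exists O : set 'rV[R]_n, [/\ open O, O q &
        exists (I : Type) (W : I -> set M),
          [/\ forall i, open (W i), trivIset setT W,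
              x @^-1` O = \bigcup_i W i &
              forall i, diffeo_onto x (W i) (C `&` O)]]].

Definition riemannian_isometry (g : riemannian_metric M) (x : M -> 'rV[R]_n)
  (C : set 'rV[R]_n) : Prop :=
  [/\ smooth_map x, diffeo_onto x setT C & metric_preserving g x].

End Immersions.

(* x^perp = - H; both sides are tensorial, hence may be compared in every
   chart. *)
Definition self_shrinker (R : realType) (m : nat) (M : manifold R m)
  (g : riemannian_metric M) (x : M -> 'rV[R]_m.+1) : Prop :=
  [/\ connected [set: M], isometric_immersion g x &
      forall c u, atlas c -> chart_cod c u ->
        normal_part (jac (in_chart x c) u) (in_chart x c u)
        = - mean_curvature g x c u].

Section Cylinders.
Context {R : realType} {m : nat}.

(* |y'| for y = (y', y'') in R^{k+1} x R^{m-k}. *)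
Definition head_norm (k : nat) (y : 'rV[R]_m.+1) : R :=
  Num.sqrt (\sum_(i < m.+1 | (i <= k)%N) y 0 i ^+ 2).

(* For k = 0 the cylinder is, by convention, the hyperplane {0} x R^m whatever
   r is, and it bounds two domains. *)
Definition cylinder (k : nat) (r : R) : set 'rV[R]_m.+1 :=
  if k is 0 then [set y | y 0 0 = 0] else [set y | head_norm k y = r].

Definition cylinder_domain (k : nat) (r : R) (D : set 'rV[R]_m.+1) : Prop :=
  if k is 0 then D = [set y | 0 <= y 0 0] \/ D = [set y | y 0 0 <= 0]
  else D = [set y | head_norm k y <= r].

End Cylinders.

(* Main.v *)
(** On a self-shrinker the drift Laplacian L = Delta - <x, grad> satisfies
    L x = - x, so L |y'|^2 = 2 (tr (P on R^(k+1)) - |y'|^2), where P is the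
    projection on the tangent space; the trace is at least k.  At a touching
    point the maximum principle gives k <= R^2, while y' is normal there, so
    R^2 = <x, y'> = - <H, y'> <= sqrt k R.  Hence R = sqrt k, and then |y'|^2 - k
    is a nonpositive L-subsolution vanishing at a point: by the strong maximum
    principle x maps Sigma into the cylinder.  (For k = 0 the height function
    plays the same role.)

    A local isometry from a complete manifold lifts C^1 paths.  Lifting the
    paths of a family that joins a base point q to all points near q, with
    continuous dependence on the endpoint, yields disjoint continuous local
    sections of x, whence the covering.  On the cylinder such a family reaches
    everything outside the fibre antipodal to q; for k >= 2 the sections over the
    complements of two antipodal fibres can be made to agree, and their union is
    a global inverse of x. *)
Require Import Defs.
From HB Require Import structures.
From mathcomp Require Import measurable_realfun ring lra zify.

Set Implicit Arguments.
Unset Strict Implicit.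
Unset Printing Implicit Defensive.

Local Open Scope classical_set_scope.
Local Open Scope ring_scope.

(** The cylinder is never made into a manifold. The behaviour of [x] near a point is packed in a
    section [G], defined on an open set of the ambient space and inverse to [x] on the image.
    Smoothness of lifts and of the inverses of [x] is inherited from [G], so only their continuity
    has to be proved. The maximum principle is proved in charts for operators written as second
    derivatives along the rows of a matrix B plus a drift. With J the Jacobian of the immersion, B =
    J^T (J J^T)^-1 satisfies B^T B = g^-1, so no square root of the inverse metric is needed. The
    trace of A gives Delta x = H = - x^perp; subtracting the tangential part of x yields L x = - x.
    A lift has the speed of the curve below it, hence is Lipschitz on bounded intervals, and
    completeness forbids it to stop. No homotopy is lifted: continuity in the endpoint comes from
    connectedness of the time axis. For k >= 2 the simple connectedness of the sphere is replaced by
    a dimension count: some point of the cylinder has its head part off any given plane, and paths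
    can be steered through it. *)

Section DirectionalDerivatives.
Context {R : realType}.

Lemma cvg_sumr (V : normedModType R) (T : Type) (F : set_system T) (I : Type) (r : seq I) (P : pred I)
    (f : I -> T -> V) (l : I -> V) : Filter F ->
  (forall i, P i -> f i x @[x --> F] --> l i) ->
  (\sum_(i <- r | P i) f i x) @[x --> F] --> \sum_(i <- r | P i) l i.
Proof.
move=> FF H; elim: r => [|i r IH].
  by under eq_fun do rewrite big_nil; rewrite big_nil; exact: cvg_cst.
under eq_fun do rewrite big_cons; rewrite big_cons; case: ifP => // Pi.
by apply: cvgD => //; exact: H.
Qed.

Lemma derivable_line (E V : normedModType R) (f : E -> V) (u e : E) (t : R) :
  derivable f (u + t *: e) e -> derivable (fun s : R => f (u + s *: e)) t 1 /\
  'D_1 (fun s : R => f (u + s *: e)) t = 'D_e f (u + t *: e).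
Proof.
have eqg : (fun h : R => h^-1 *: ((f \o shift (u + t *: e)) (h *: e) - f (u + t *: e)))
  = (fun h : R => h^-1 *: (((fun s : R => f (u + s *: e)) \o shift t) (h *: 1)
       - (fun s : R => f (u + s *: e)) t)).
  apply/funext => h /=; congr (_ *: (f _ - _)).
  by rewrite [_ *: 1]mulr1 scalerDl addrCA.
by move=> df; rewrite /derivable /derive -eqg.
Qed.

(** Writing the intermediate point as [s * c] with [s] in [0, 1] gives one statement for both signs
    of [c] and for [c = 0]. *)
Lemma MVT_line (E : normedModType R) (f : E -> R) (u e : E) (c : R) :
  (forall s : R, 0 <= s <= 1 -> derivable f (u + (s * c) *: e) e) ->
  exists2 s : R, 0 <= s <= 1 & f (u + c *: e) - f u = c * 'D_e f (u + (s * c) *: e).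
Proof.
move=> df; pose phi (s : R) := f (u + s *: e).
have dphi (t : R) : (exists2 s : R, 0 <= s <= 1 & t = s * c) ->
    is_derive (t : R) 1 phi ('D_e f (u + t *: e)).
  by move=> [s /df + ->] => /derivable_line [d1 d2]; apply: DeriveDef.
have cphi (a b : R) : {in `[a, b], forall t, exists2 s : R, 0 <= s <= 1 & t = s * c} ->
    {within `[a, b], continuous phi}.
  move=> ab; apply: derivable_within_continuous => t /ab tc.
  by have := dphi t tc => -[].
have phi0 : f u = phi 0 by rewrite /phi scale0r addr0.
have [c0|c0|c0] := ltgtP 0 c.
- have ab : {in `[0, c], forall t, exists2 s : R, 0 <= s <= 1 & t = s * c}.
    move=> t; rewrite in_itv/= => /andP[t0 tc]; exists (t / c); last by rewrite divfK ?gt_eqF.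
    by rewrite divr_ge0 ?(ltW c0) //= ler_pdivrMr ?mul1r.
  have [|t /ab [s s01 ->]] := MVT_segment (df := fun t => 'D_e f (u + t *: e)) (ltW c0) _ (cphi _ _ ab).
  + by move=> t tc; apply: dphi; apply: ab; exact: subset_itv_oo_cc tc.
  + by rewrite subr0 -phi0 => ->; exists s => //; rewrite mulrC.
- have ab : {in `[c, 0], forall t, exists2 s : R, 0 <= s <= 1 & t = s * c}.
    move=> t; rewrite in_itv/= => /andP[t0 tc]; exists (t / c); last by rewrite divfK ?lt_eqF.
    by rewrite mulr_le0 ?invr_le0 ?(ltW c0) //= ler_ndivrMr ?mul1r.
  have [|t /ab [s s01 ->]] := MVT_segment (df := fun t => 'D_e f (u + t *: e)) (ltW c0) _ (cphi _ _ ab).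
  + by move=> t tc; apply: dphi; apply: ab; exact: subset_itv_oo_cc tc.
  + rewrite sub0r -phi0 => H; exists s => //.
    by rewrite -[LHS]opprB H mulrN opprK mulrC.
- exists 0; first by rewrite lexx ler01.
  by rewrite -c0 scale0r addr0 mul0r subrr.
Qed.

Lemma mx_norm_le (m n : nat) (A : 'M[R]_(m, n)) (e : R) : 0 <= e ->
  (forall i j, `|A i j| <= e) -> `|A| <= e.
Proof.
move=> e0 H; rewrite /Num.Def.normr/= mx_normrE (bigmax_le _ e0)//= => -[i j] _.
Qed.

Lemma mx_norm_ge (m n : nat) (A : 'M[R]_(m, n)) i j : `|A i j| <= `|A|.
Proof.
rewrite [leRHS]/Num.Def.normr/= mx_normrE.
exact: (le_bigmax _ (fun ij : 'I_m * 'I_n => `|A ij.1 ij.2|) (i, j)).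
Qed.

(* A C^1 function is strictly differentiable; the intermediate points come
   from changing one coordinate at a time, which stays in a sup-norm ball. *)
Lemma strict_diff n (U : set 'rV[R]_n) (f : 'rV[R]_n -> R) (u0 : 'rV[R]_n) (e : R) :
  open U -> Cr 1 U f -> U u0 -> 0 < e ->
  exists2 d : R, 0 < d & (forall u, ball u0 d u -> U u /\ forall j, `|pd j f u - pd j f u0| <= e) /\
   forall u v, ball u0 d u -> ball u0 d v ->
    exists2 q : 'rV[R]_n, (forall j, `|q 0 j - pd j f u0| <= e) &
      f u - f v = \sum_j (u 0 j - v 0 j) * q 0 j.
Proof.
move=> oU [_ C1] U0 e0.
have nU : nbhs u0 U by exact: open_nbhs_nbhs.
have near_pd : \forall w \near u0, U w /\ forall j, `|pd j f w - pd j f u0| <= e.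
  apply: filterI => //.
  have : forall j, \forall w \near u0, `|pd j f w - pd j f u0| <= e; last first.
    by move=> H; apply: (@filter_forall _ _ (fun j w => `|pd j f w - pd j f u0| <= e) (nbhs u0) (nbhs_filter u0)).
  move=> j.
  have [_ [cj _]] := C1 (delta_mx 0 j).
  have /cvgrPdist_le/(_ e e0) := cj u0 U0.
  by apply: filterS => w; rewrite distrC.
have /nbhs_ballP[d /= d0 Hd] := near_pd.
exists d => //; split=> [w /Hd//|u v Hu Hv].
(* The first k coordinates come from [u] and the others from [v], so the differences of [f] along
   these points telescope from [v] to [u]. *)
pose w k : 'rV[R]_n := \row_j (if (j < k)%N then u 0 j else v 0 j).
have wball k : ball u0 d (w k).
  split=> // i j; rewrite mxE; case: ifP => _; first by case: Hu => _ /(_ i j); rewrite ord1.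
  by case: Hv => _ /(_ i j); rewrite ord1.
have step (k : 'I_n) : exists2 q : R, `|q - pd k f u0| <= e &
   f (w k.+1) - f (w k) = (u 0 k - v 0 k) * q.
  pose c := u 0 k - v 0 k.
  have wE : w k.+1 = w k + c *: delta_mx 0 k.
    apply/rowP => j; rewrite !mxE eqxx ltnS leq_eqVlt /= /c.
    case: ifPn => [/orP[/eqP jk|jk]|].
    - have -> : j = k by exact/val_inj.
      by rewrite ltnn eqxx mulr1 addrCA subrr addr0.
    - rewrite jk (_ : (j == k) = false) ?mulr0 ?addr0 //.
      by apply/eqP => jk'; move: jk; rewrite jk' ltnn.
    - rewrite negb_or => /andP[jk /negbTE->].
      by rewrite (_ : (j == k) = false) ?mulr0 ?addr0 //; exact/negbTE.
  have segin (s : R) : 0 <= s <= 1 -> ball u0 d (w k + (s * c) *: delta_mx 0 k).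
    move=> /andP[s0 s1]; split=> // i j; rewrite ord1 !mxE eqxx /=.
    have [->|jk] := eqVneq j k; last first.
      by rewrite mulr0 addr0; have [_ /(_ 0 j)] := wball k; rewrite !mxE.
    have [_ /(_ 0 k)] := Hu; have [_ /(_ 0 k)] := Hv; rewrite /c ltnn mulr1 -!ball_normE/=.
    rewrite !ltr_norml => /andP[v1 v2] /andP[u1 u2]; rewrite opprD.
    by have [ab|/ltW ab] := leP (u 0 k) (v 0 k); have ab' := ab; rewrite -subr_ge0 in ab';
      have := mulr_ge0 s0 ab'; have := mulr_ge0 (_ : 0 <= 1 - s) ab'; rewrite subr_ge0 s1;
      move=> /(_ isT); lra.
  have [s s01 ->] : exists2 s : R, 0 <= s <= 1 & f (w k.+1) - f (w k) =
      c * 'D_(delta_mx 0 k) f (w k + (s * c) *: delta_mx 0 k).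
    rewrite wE; apply: MVT_line => s /segin /Hd [Uw _].
    by have [+ _] := C1 (delta_mx 0 k); apply.
  by eexists; last reflexivity; have [_ ] := Hd _ (segin _ s01); apply.
exists (\row_j sval (cid2 (step j))) => [j|].
  by rewrite mxE; case: cid2.
have -> : f u = f (w n) by congr f; apply/rowP => j; rewrite mxE ltn_ord.
have -> : f v = f (w 0%N) by congr f; apply/rowP => j; rewrite mxE.
rewrite -(telescope_sumr (fun k => f (w k)) (leq0n n)) big_mkord; apply: eq_bigr => j _.
by rewrite mxE; case: cid2.
Qed.

(** With [u0] as second point, strict differentiability bounds the error by a small multiple of |h|,
    so the linear form made of the partial derivatives is the differential. *)
Lemma C1_differentiable n (U : set 'rV[R]_n) (f : 'rV[R]_n -> R) (u0 : 'rV[R]_n) :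
  open U -> Cr 1 U f -> U u0 ->
  differentiable f u0 /\ forall v, 'D_v f u0 = \sum_j v 0 j * pd j f u0.
Proof.
move=> oU C1 U0.
pose d (h : 'rV[R]_n) : R := \sum_j h 0 j * pd j f u0.
have lin_d : linear d.
  move=> a h h'; rewrite /d scaler_sumr -big_split; apply: eq_bigr => j _ /=.
  by rewrite !mxE mulrDl -mulrA.
pose dM := GRing.isLinear.Build _ _ _ _ _ lin_d.
pose dL : {linear _ -> _} := HB.pack d dM.
have cd : continuous dL.
  rewrite -[X in continuous X]/d => h; rewrite /d.
  apply: (cvg_sumr (F := nbhs h)) => j _.
  by apply: cvgMr_tmp; exact: coord_continuous.
have eqd : (f : 'rV[R]_n -> R^o) \o shift u0 = cst (f u0 : R^o) + (dL : 'rV[R]_n -> R^o) +o_ (0 : 'rV[R]_n) id.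
  apply/eqaddoP => e e0.
  (* Each of the n coordinates contributes at most e |h| / (n + 1); the successor keeps the quotient
     meaningful for n = 0. *)
  have e1 : 0 < e / n.+1%:R by rewrite divr_gt0.
  have [r r0 [_ H]] := strict_diff oU C1 U0 e1.
  have : \forall h \near (0 : 'rV[R]_n), ball (0:'rV[R]_n) r h by exact: nbhsx_ballx.
  apply: filterS => h hr.
  have [||q Hq] := H (h + u0) u0.
  - by rewrite -ball_normE /= opprD addrCA subrr addr0 normrN; move: hr; rewrite -ball_normE/= sub0r normrN.
  - exact: ballxx.
  move=> E; rewrite /= !fctE /= opprD addrA E -[X in _ - X]/(d h) /d -sumrB.
  apply: le_trans (ler_norm_sum _ _ _) _.
  apply: (@le_trans _ _ (\sum_(j < n) (e / n.+1%:R * `|h|))).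
    apply: ler_sum => j _; rewrite mxE addrK -mulrBr normrM mulrC.
    by apply: ler_pM => //; exact: mx_norm_ge.
  rewrite sumr_const card_ord -mulrnAl -[X in X * _ <= _]mulr_natr.
  rewrite ler_wpM2r // -mulrA ler_piMr ?(ltW e0) // mulrC ler_pdivrMr // mul1r.
  by rewrite ler_nat.
have df : 'd f u0 = d :> ('rV[R]_n -> R) by rewrite (diff_unique cd eqd).
have dif : differentiable f u0.
  by apply/diff_locallyP; rewrite df.
by split=> // v; rewrite deriveE // df.
Qed.

(* The outer function is differentiable, the inner one only has a derivative
   in the direction considered. *)
Lemma derive_comp_C1 n (E : normedModType R) (W : set 'rV[R]_n) (g : 'rV[R]_n -> R)
   (s : E -> 'rV[R]_n) (u v : E) :
  open W -> Cr 1 W g -> W (s u) -> derivable s u v ->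
  derivable (g \o s) u v /\
  'D_v (g \o s) u = \sum_j ('D_v s u) 0 j * pd j g (s u).
Proof.
move=> oW C1 Wsu ds.
have [dg Dg] := C1_differentiable oW C1 Wsu.
(* Restricted to the line through [u], [s] is a function of one real variable, for which
   derivability is differentiability; the chain rule for differentials then applies. *)
pose phi (t : R) := s (t *: v + u).
have dphi : derivable phi 0 1 := (derivable1P s u v).1 ds.
have phi0 : phi 0 = s u by rewrite /phi scale0r add0r.
have dphi' : differentiable phi 0 by exact/derivable1_diffP.
have dg' : differentiable g (phi 0) by rewrite phi0.
have dcomp : differentiable (g \o phi) 0 by exact: differentiable_comp.
have dE (V : normedModType R) (k : E -> V) : 'D_v k u = 'D_1 (fun t : R => k (t *: v + u)) 0.
  rewrite /derive; set g1 := fun h => _; set g2 := fun h : R => h^-1 *: (_ - _ (0 *: v + u)).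
  suff -> : g1 = g2 by []; apply/funext => h; rewrite /g1 /g2 /=.
  by rewrite addr0 scale0r add0r [_ *: 1]mulr1.
have d1 : derivable (g \o phi : R -> R^o) 0 1 := (derivable1_diffP _ _).2 dcomp.
split; first exact: (derivable1P (g \o s : E -> R^o) u v).2 d1.
rewrite dE (_ : (fun t : R => _) = g \o phi) // deriveE // diff_comp //=.
by rewrite -!deriveE // phi0 Dg -dE.
Qed.

End DirectionalDerivatives.

(** * Calculus of C^r maps *)

Section CrClosure.
Context {R : realType}.
Implicit Types (E V : normedModType R).

Lemma Cr_cont E V r (U : set E) (f : E -> V) u : Cr r U f -> U u -> {for u, continuous f}.
Proof. by case: r => [|r] [+ _]; apply. Qed.

Lemma Cr_derivable E V r (U : set E) (f : E -> V) u v : Cr r.+1 U f -> U u -> derivable f u v.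
Proof. by move=> [_ /(_ v) [+ _]]; apply. Qed.

Arguments Cr_derivable {E V r U f u v}.
Lemma Cr_derive E V r (U : set E) (f : E -> V) v : Cr r.+1 U f -> Cr r U ('D_v f).
Proof. by move=> [_ /(_ v) []]. Qed.

Arguments Cr_derive {E V r U f} v.

Lemma CrS E V r (U : set E) (f : E -> V) : (forall u, U u -> {for u, continuous f}) ->
  (forall v, (forall u, U u -> derivable f u v) /\ Cr r U ('D_v f)) -> Cr r.+1 U f.
Proof. by []. Qed.

Lemma Cr0 E V (U : set E) (f : E -> V) : (forall u, U u -> {for u, continuous f}) -> Cr 0 U f.
Proof. by []. Qed.

Lemma Cr_subset E V r (U U' : set E) (f : E -> V) : U' `<=` U -> Cr r U f -> Cr r U' f.
Proof.
move=> UU'; elim: r f => [|r IH] f [c H]; split=> //; [by move=> u /UU' /c|by move=> u /UU' /c|].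
by move=> v; have [d D] := H v; split=> [u /UU' /d//|]; exact: IH.
Qed.

Lemma Cr_pred E V r (U : set E) (f : E -> V) : Cr r.+1 U f -> Cr r U f.
Proof.
elim: r f => [|r IH] f [c H]; split=> //.
by move=> v; have [d D] := H v; split=> //; exact: IH.
Qed.

Lemma Cr_le E V r r' (U : set E) (f : E -> V) : (r' <= r)%N -> Cr r U f -> Cr r' U f.
Proof.
move=> /subnK <-; elim: (r - r')%N => //= k IH H; apply: IH; exact: Cr_pred.
Qed.

(** The derivatives in [Cr] are those of the ambient space, so [Cr] is a condition at each point of
    the set and the sets U' need not be open. *)
Lemma Cr_local E V r (U : set E) (f : E -> V) :
  (forall u, U u -> exists2 U', U' u & Cr r U' f) -> Cr r U f.
Proof.
elim: r f => [|r IH] f H; split=> //; try by move=> u /H [U' U'u /Cr_cont]; apply.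
move=> v; split; first by move=> u /H [U' U'u /Cr_derivable]; apply.
by apply: IH => u /H [U' U'u /(Cr_derive v) D]; exists U'.
Qed.

(** Ambient derivatives at a point see the values around it; openness of [U] turns equality on [U]
    into equality near each of its points. *)
Lemma Cr_ext E V r (U : set E) (f g : E -> V) : open U ->
  (forall u, U u -> f u = g u) -> Cr r U f -> Cr r U g.
Proof.
move=> oU; elim: r f g => [|r IH] f g fg H.
  have nfg u : U u -> \forall w \near u, f w = g w.
    by move=> Uu; near=> w; apply: fg; near: w; exact: open_nbhs_nbhs.
  split=> // u Uu; have E0 := fg u Uu; rewrite /prop_for /continuous_at -E0.
  by apply: (cvg_trans _ (Cr_cont H Uu)); exact: near_eq_cvg (nfg u Uu).
have nfg u : U u -> \forall w \near u, f w = g w.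
  by move=> Uu; near=> w; apply: fg; near: w; exact: open_nbhs_nbhs.
split.
  move=> u Uu; have E0 := fg u Uu; rewrite /prop_for /continuous_at -E0.
  by apply: (cvg_trans _ (Cr_cont H Uu)); exact: near_eq_cvg (nfg u Uu).
move=> v; split.
  by move=> u Uu; apply: near_eq_derivable (Cr_derivable H Uu); exact: nfg.
apply: IH (Cr_derive v H) => u Uu; exact: near_eq_derive (nfg u Uu).
Unshelve. all: by end_near. Qed.

Lemma Cr_cst E V r (U : set E) (a : V) : Cr r U (fun=> a).
Proof.
elim: r a => [|r IH] a; split=> //; try by move=> u _; exact: cvg_cst.
move=> v; split; first by move=> u _; exact: derivable_cst.
have -> : (fun u : E => 'D_v (fun=> a) u) = (fun=> 0); last exact: IH.
by apply/funext => u; exact: derive_cst.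
Qed.

Lemma CrD E V r (U : set E) (f g : E -> V) : open U ->
  Cr r U f -> Cr r U g -> Cr r U (fun u => f u + g u).
Proof.
move=> oU; elim: r f g => [|r IH] f g Hf Hg; split=> //;
  try by move=> u Uu; apply: cvgD; [exact: Cr_cont Hf Uu|exact: Cr_cont Hg Uu].
move=> v; split.
  by move=> u Uu; exact: (@derivableD _ _ _ f g u v (Cr_derivable Hf Uu) (Cr_derivable Hg Uu)).
apply: (Cr_ext oU _ (IH _ _ (Cr_derive v Hf) (Cr_derive v Hg))) => u Uu.
exact: esym (deriveD (Cr_derivable (v := v) Hf Uu) (Cr_derivable Hg Uu)).
Qed.

Lemma Cr_sum E V r (U : set E) (I : Type) (s : seq I) (P : pred I) (f : I -> E -> V) : open U ->
  (forall i, P i -> Cr r U (f i)) -> Cr r U (fun u => \sum_(i <- s | P i) f i u).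
Proof.
move=> oU H; elim: s => [|i s IH].
  by under eq_fun do rewrite big_nil; exact: Cr_cst.
case Pi: (P i); last by under eq_fun do rewrite big_cons Pi.
under eq_fun do rewrite big_cons Pi.
by apply: CrD => //; exact: H.
Qed.

Lemma CrM E r (U : set E) (f g : E -> R) : open U ->
  Cr r U f -> Cr r U g -> Cr r U (fun u => f u * g u).
Proof.
move=> oU; elim: r f g => [|r IH] f g Hf Hg; split=> //;
  try by move=> u Uu; apply: cvgM; [exact: Cr_cont Hf Uu|exact: Cr_cont Hg Uu].
move=> v; split.
  by move=> u Uu; exact: (@derivableM _ _ f g u v (Cr_derivable Hf Uu) (Cr_derivable Hg Uu)).
apply: (Cr_ext oU _ (CrD oU (IH _ _ (Cr_pred Hf) (Cr_derive v Hg))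
   (IH _ _ (Cr_pred Hg) (Cr_derive v Hf)))) => u Uu.
exact: esym (deriveM (Cr_derivable (v := v) Hf Uu) (Cr_derivable Hg Uu)).
Qed.

Lemma Cr_prod E r (U : set E) (I : Type) (s : seq I) (P : pred I) (f : I -> E -> R) : open U ->
  (forall i, P i -> Cr r U (f i)) -> Cr r U (fun u => \prod_(i <- s | P i) f i u).
Proof.
move=> oU H; elim: s => [|i s IH].
  by under eq_fun do rewrite big_nil; exact: Cr_cst.
case Pi: (P i); last by under eq_fun do rewrite big_cons Pi.
under eq_fun do rewrite big_cons Pi.
by apply: CrM => //; exact: H.
Qed.

Lemma CrN E V r (U : set E) (f : E -> V) : open U -> Cr r U f -> Cr r U (fun u => - f u).
Proof.
move=> oU; elim: r f => [|r IH] f Hf; split=> //; try by move=> u Uu; exact: (cvgN (Cr_cont Hf Uu)).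
move=> v; split=> [u Uu|]; first exact: (@derivableN _ _ _ f u v (Cr_derivable Hf Uu)).
apply: (Cr_ext oU _ (IH _ (Cr_derive v Hf))) => u Uu.
exact: esym (deriveN (Cr_derivable (v := v) Hf Uu)).
Qed.

Lemma CrB E V r (U : set E) (f g : E -> V) : open U ->
  Cr r U f -> Cr r U g -> Cr r U (fun u => f u - g u).
Proof. by move=> oU Hf Hg; apply: CrD => //; exact: CrN. Qed.

Lemma Cr_id E r (U : set E) : Cr r U (id : E -> E).
Proof.
case: r => [|r]; split=> //; try by move=> u _; exact: cvg_id.
move=> v; split=> [u _|]; first exact: derivable_id.
have -> : (fun u : E => 'D_v (id : E -> E) u) = (fun=> v); last exact: Cr_cst.
by apply/funext => u; exact: derive_id.
Qed.

Lemma CrV E r (U : set E) (f : E -> R) : open U -> (forall u, U u -> f u != 0) ->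
  Cr r U f -> Cr r U (fun u => (f u)^-1).
Proof.
move=> oU f0; elim: r => [|r IH] Hf; split=> //;
  try by move=> u Uu; apply: cvgV; [exact: f0|exact: Cr_cont Hf Uu].
move=> v; split.
  by move=> u Uu; exact: (@derivableV _ _ f u v (f0 u Uu) (Cr_derivable Hf Uu)).
have HI := IH (Cr_pred Hf).
apply: (Cr_ext oU _ (CrM oU (CrN oU (CrM oU HI HI)) (Cr_derive v Hf))) => u Uu.
rewrite -[RHS](esym (deriveV (f0 u Uu) (Cr_derivable (v := v) Hf Uu))).
by rewrite -exprVn expr2.
Qed.

Lemma mx_continuousP (T : topologicalType) m n (f : T -> 'M[R]_(m, n)) t :
  {for t, continuous f} <-> forall i j, {for t, continuous (fun x => f x i j)}.
Proof.
split=> [c i j|c].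
  exact: (continuous_comp c (@coord_continuous _ _ _ i j _)).
apply/cvgrPdist_le => e e0.
have : \forall x \near t, forall ij : 'I_m * 'I_n, `|f t ij.1 ij.2 - f x ij.1 ij.2| <= e.
  apply: (@filter_forall _ _ (fun (ij : 'I_m * 'I_n) x => `|f t ij.1 ij.2 - f x ij.1 ij.2| <= e) (nbhs t) (nbhs_filter t)) => -[i j].
  by have /cvgrPdist_le := c i j; apply.
apply: filterS => x H; apply: mx_norm_le; first exact: ltW.
by move=> i j; rewrite !mxE; exact: (H (i, j)).
Qed.

Lemma Cr_mxP E r (U : set E) m n (f : E -> 'M[R]_(m, n)) : open U ->
  Cr r U f <-> forall i j, Cr r U (fun u => f u i j).
Proof.
move=> oU; elim: r f => [|r IH] f.
  split=> [H i j|H]; split=> // u Uu.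
    by have /mx_continuousP := Cr_cont H Uu; apply.
  by apply/mx_continuousP => i j; exact: Cr_cont (H i j) Uu.
split=> [H i j|H]; split.
- by move=> u Uu; have /mx_continuousP := Cr_cont H Uu; apply.
- move=> v; split=> [u Uu|].
    exact: (derivable_mxP f u v).1 (Cr_derivable H Uu) i j.
  apply: (Cr_ext oU _ ((IH _).1 (Cr_derive v H) i j)) => u Uu.
  by rewrite derive_mx ?mxE //; exact: Cr_derivable H Uu.
- by move=> u Uu; apply/mx_continuousP => i j; exact: Cr_cont (H i j) Uu.
- have dv v u : U u -> derivable f u v.
    by move=> Uu; apply: (derivable_mxP f u v).2 => i j; exact: Cr_derivable (H i j) Uu.
  move=> v; split=> [u Uu|]; first exact: dv.
  apply/IH => i j; apply: (Cr_ext oU _ (Cr_derive v (H i j))) => u Uu.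
  by rewrite derive_mx ?mxE //; exact: dv.
Qed.

(** By the chain rule the derivative of [g \o s] is a sum of products of derivatives of [s] with
    [pd j g \o s], to which the induction hypothesis applies. *)
Lemma Cr_comp_real E n r (U : set E) (W : set 'rV[R]_n) (g : 'rV[R]_n -> R) (s : E -> 'rV[R]_n) :
  open U -> open W -> (forall u, U u -> W (s u)) -> Cr r W g -> Cr r U s -> Cr r U (g \o s).
Proof.
move=> oU oW UW; elim: r g => [|r IH] g Hg Hs.
  by split=> // u Uu; exact: (continuous_comp (Cr_cont Hs Uu) (Cr_cont Hg (UW _ Uu))).
split=> [u Uu|v].
  exact: (continuous_comp (Cr_cont Hs Uu) (Cr_cont Hg (UW _ Uu))).
have C1 : Cr 1 W g by exact: Cr_le Hg.
split=> [u Uu|].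
  exact: (derive_comp_C1 oW C1 (UW _ Uu) (Cr_derivable Hs Uu)).1.
have Hc : Cr r U (fun u => \sum_j ('D_v s u) 0 j * (pd j g \o s) u).
  apply: Cr_sum => // j _; apply: CrM => //.
    by have /(Cr_mxP _ _ oU) := Cr_derive v Hs; apply.
  by apply: IH (Cr_pred Hs); exact: Cr_derive Hg.
apply: (Cr_ext oU _ Hc) => u Uu.
exact: esym (derive_comp_C1 oW C1 (UW _ Uu) (Cr_derivable Hs Uu)).2.
Qed.

Lemma Cr_comp E n p q r (U : set E) (W : set 'rV[R]_n) (g : 'rV[R]_n -> 'M[R]_(p, q)) (s : E -> 'rV[R]_n) :
  open U -> open W -> (forall u, U u -> W (s u)) -> Cr r W g -> Cr r U s -> Cr r U (g \o s).
Proof.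
move=> oU oW UW Hg Hs; apply: (Cr_mxP _ _ oU).2 => i j.
exact: (Cr_comp_real (g := fun y => g y i j) oU oW UW ((Cr_mxP _ _ oW).1 Hg i j) Hs).
Qed.

Lemma Cr_mulmx E m n p r (U : set E) (f : E -> 'M[R]_(m, n)) (g : E -> 'M[R]_(n, p)) : open U ->
  Cr r U f -> Cr r U g -> Cr r U (fun u => f u *m g u).
Proof.
move=> oU /(Cr_mxP _ _ oU) Hf /(Cr_mxP _ _ oU) Hg; apply: (Cr_mxP _ _ oU).2 => i j.
under eq_fun do rewrite mxE; apply: Cr_sum => // k _; exact: CrM.
Qed.

Lemma Cr_trmx E m n r (U : set E) (f : E -> 'M[R]_(m, n)) : open U ->
  Cr r U f -> Cr r U (fun u => (f u)^T).
Proof.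
move=> oU /(Cr_mxP _ _ oU) Hf; apply: (Cr_mxP _ _ oU).2 => i j.
by under eq_fun do rewrite mxE.
Qed.

Lemma Cr_det E n r (U : set E) (f : E -> 'M[R]_n) : open U ->
  Cr r U f -> Cr r U (fun u => \det (f u)).
Proof.
move=> oU /(Cr_mxP _ _ oU) Hf; rewrite /determinant.
apply: Cr_sum => // s _; apply: CrM => //; first exact: Cr_cst.
exact: Cr_prod.
Qed.

Lemma Cr_invmx E n r (U : set E) (f : E -> 'M[R]_n) : open U ->
  (forall u, U u -> f u \in unitmx) -> Cr r U f -> Cr r U (fun u => invmx (f u)).
Proof.
move=> oU fU Hf.
(* Cramer's formula: polynomials in the entries and one reciprocal. *)
have H : Cr r U (fun u => (\det (f u))^-1 *: \adj (f u)).
  apply: (Cr_mxP _ _ oU).2 => i j; under eq_fun do rewrite !mxE.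
  apply: CrM => //; first apply: CrV => //; [|exact: Cr_det|].
    by move=> u /fU; rewrite unitmxE unitfE.
  apply: CrM => //; first exact: Cr_cst.
  apply: Cr_det => //; apply: (Cr_mxP _ _ oU).2 => k l; under eq_fun do rewrite !mxE.
  by have /(Cr_mxP _ _ oU) := Hf; apply.
by apply: (Cr_ext oU _ H) => u /fU Hu; rewrite /invmx Hu.
Qed.

Lemma Cr_jac n p r (U : set 'rV[R]_n) (f : 'rV[R]_n -> 'rV[R]_p) : open U ->
  Cr r.+1 U f -> Cr r U (jac f).
Proof.
move=> oU Hf; apply: (Cr_mxP _ _ oU).2 => i j.
rewrite /jac; under eq_fun do rewrite mxE.
by have /(Cr_mxP _ _ oU) := Cr_derive (delta_mx 0 i) Hf; apply.
Qed.

Lemma Cr_affine m n r (U : set R) (A B : 'M[R]_(m, n)) : open U ->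
  Cr r U (fun t : R => A + t *: B).
Proof.
move=> oU; apply: (Cr_mxP _ _ oU).2 => i j.
under eq_fun do rewrite !mxE; apply: CrD => //; first exact: Cr_cst.
by apply: CrM => //; [exact: Cr_id|exact: Cr_cst].
Qed.

End CrClosure.

Opaque Cr.

(** * The inverse function theorem *)

Section InverseFunction.
Context {R : realType}.

(* filterS and its relatives restated for nbhs: applied to row vectors, the
   generic lemmas make unification unfold nbhs. *)
Lemma nbhsS (T : topologicalType) (t : T) (P Q : set T) :
  P `<=` Q -> nbhs t P -> nbhs t Q.
Proof. exact: filterS. Qed.

Lemma nbhsS2 (T : topologicalType) (t : T) (P Q S : set T) :
  (forall z, P z -> Q z -> S z) -> nbhs t P -> nbhs t Q -> nbhs t S.
Proof. exact: filterS2. Qed.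

Lemma nbhsI (T : topologicalType) (t : T) (P Q : set T) :
  nbhs t P -> nbhs t Q -> nbhs t (P `&` Q).
Proof. exact: filterI. Qed.

Lemma compact_norm_ball n (u0 : 'rV[R]_n) (r : R) : 0 < r ->
  compact [set u | `|u0 - u| <= r].
Proof.
move=> r0; apply: bounded_closed_compact.
  exists (`|u0| + r); split; first exact: num_real.
  move=> t tlt u Du; apply: (le_trans _ (ltW tlt)).
  by rewrite -[u](subKr u0); apply: le_trans (ler_normB _ _) _; rewrite lerD2l.
have -> : [set u | `|u0 - u| <= r] = closed_ball u0 r by rewrite closed_ballE.
exact: closed_ball_closed.
Qed.

Lemma mulmx_norm m n p (A : 'M[R]_(m, n)) (B : 'M[R]_(n, p)) :
  `|A *m B| <= n%:R * `|A| * `|B|.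
Proof.
apply: mx_norm_le => [|i j]; first by rewrite !mulr_ge0.
rewrite mxE; apply: le_trans (ler_norm_sum _ _ _) _.
apply: (@le_trans _ _ (\sum_(k < n) `|A| * `|B|)).
  by apply: ler_sum => k _; rewrite normrM ler_pM ?mx_norm_ge.
by rewrite sumr_const card_ord -[leLHS]mulr_natl mulrA.
Qed.

Lemma continuous_dist (T : topologicalType) (V : normedModType R) (f : T -> V) t :
  {for t, continuous f} <->
  forall e, 0 < e -> nbhs t [set z | `|f t - f z| < e].
Proof. exact: cvgrPdist_lt. Qed.

Lemma continuous_norm (T : topologicalType) (V : normedModType R) (k : T -> V) t :
  {for t, continuous k} -> {for t, continuous (fun z => `|k z|)}.
Proof. by move=> kt; exact: (cvg_norm kt). Qed.

(** Properties holding for all small positive d can be intersected finitely often; arguing near 0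
    covers an empty [I] as well. *)
Lemma common_radius (I : finType) (P : I -> R -> Prop) :
  (forall i, exists2 d, 0 < d & forall d', 0 < d' -> d' <= d -> P i d') ->
  exists2 d, 0 < d & forall i, P i d.
Proof.
move=> H.
have : \forall d \near 0^'+, 0 < d /\ forall i, P i d.
  apply: filterI; first exact: nbhs_right_gt.
  apply: (@filter_forall _ _ (fun i d => P i d) 0^'+ _) => i; have [d d0 Hd] := H i.
  near=> d'; apply: Hd; near: d'; [exact: nbhs_right_gt|exact: nbhs_right_le].
by move=> /filter_ex [d [d0 Hd]]; exists d.
Unshelve. all: by end_near. Qed.

Lemma jacE n p (f : 'rV[R]_n -> 'rV[R]_p) u i j : derivable f u (delta_mx 0 i) ->
  jac f u i j = pd i (fun w => f w 0 j) u.
Proof. by move=> df; rewrite mxE /pd derive_mx // mxE. Qed.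

Lemma jac_mxE n p (f : 'rV[R]_n -> 'rV[R]_p) u i j : jac f u i j = pd i f u 0 j.
Proof. by rewrite mxE. Qed.

(** The mean value theorem has no single intermediate point for vector-valued maps. The matrix [Q]
    is assembled column by column from different points; only its closeness to the Jacobian at [u0]
    matters. *)
Lemma strict_diff_rV n p (U : set 'rV[R]_n) (f : 'rV[R]_n -> 'rV[R]_p) (u0 : 'rV[R]_n) (e : R) :
  open U -> Cr 1 U f -> U u0 -> 0 < e ->
  exists2 d : R, 0 < d & (forall u, ball u0 d u -> U u /\ `|jac f u - jac f u0| <= e) /\
   forall u v, ball u0 d u -> ball u0 d v ->
    exists2 Q : 'M[R]_(n, p), `|Q - jac f u0| <= e & f u - f v = (u - v) *m Q.
Proof.
move=> oU C1 U0 e0.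
pose C1j j := (Cr_mxP _ _ oU).1 C1 0 j.
have [j|d d0 Hd] := common_radius (P := fun j : 'I_p => fun d : R =>
  (forall u, ball u0 d u -> U u /\ forall i, `|jac f u i j - jac f u0 i j| <= e) /\
   forall u v, ball u0 d u -> ball u0 d v ->
    exists2 q : 'rV[R]_n, (forall i, `|q 0 i - jac f u0 i j| <= e) &
       f u 0 j - f v 0 j = \sum_i (u 0 i - v 0 i) * q 0 i).
  have [d d0 [H1 H2]] := strict_diff oU (C1j j) U0 e0.
  exists d => // d' d'0 d'd; split=> [u /(le_ball d'd) /H1 [Uu H]|u v /(le_ball d'd) Hu /(le_ball d'd) Hv].
    by split=> // i; rewrite !jacE ?H //; exact: (Cr_derivable C1).
  have [q Hq E] := H2 u v Hu Hv; exists q => // i.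
  by rewrite jacE //; exact: (Cr_derivable C1).
have [d1 /= d10 HU] := (nbhs_ballP _ _).1 (open_nbhs_nbhs (conj oU U0)).
have dd : Num.min d d1 <= d by rewrite ge_min lexx.
have dd1 : Num.min d d1 <= d1 by rewrite ge_min lexx orbT.
exists (Num.min d d1); first by rewrite lt_min d0.
split=> [u Hu|u v /(le_ball dd) Hu /(le_ball dd) Hv].
  split; first by apply: HU; exact: le_ball Hu.
  apply: mx_norm_le => [|i j]; first exact: ltW.
  by rewrite !mxE -!jac_mxE; have [_ ] := (Hd j).1 _ (le_ball dd Hu); apply.
exists (\matrix_(i, j) sval (cid2 ((Hd j).2 u v Hu Hv)) 0 i).
  apply: mx_norm_le => [|i j]; first exact: ltW.
  by rewrite !mxE -jac_mxE; case: cid2.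
apply/rowP => j; rewrite !mxE.
under eq_bigr do rewrite !mxE.
by case: cid2.
Qed.

(** On a small ball, [f] followed by the inverse Jacobian differs from the identity by a map of
    Lipschitz constant 1/2. Injectivity, a Lipschitz bound for the inverse and the differentiability
    of the inverse all follow from this. *)
Lemma inverse_function n (U : set 'rV[R]_n) (f : 'rV[R]_n -> 'rV[R]_n) (u0 : 'rV[R]_n) :
  open U -> smooth_on U f -> U u0 -> jac f u0 \in unitmx ->
  exists N O (h : 'rV[R]_n -> 'rV[R]_n),
    [/\ open N, N u0, N `<=` U & open O] /\
    [/\ smooth_on O h, (forall y, O y -> N (h y) /\ f (h y) = y) &
      (forall u, N u -> O (f u) /\ h (f u) = u)].
Proof.
move=> oU Sf U0 unit0; have C1 := Sf 1%N.
pose J0 := jac f u0; pose A := invmx J0.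
have J0A : J0 *m A = 1%:M by rewrite mulmxV.
(* Two products of matrices cost a factor n each in the sup norm, so n n |w| e |A| <= |w| / 2; the
   summand 1 keeps the denominator positive. *)
pose e := (2 * (n%:R * n%:R * `|A| + 1))^-1.
have e_gt0 : 0 < e by rewrite invr_gt0 mulr_gt0 // ltr_wpDl // !mulr_ge0.
have small (w : 'rV[R]_n) (Q : 'M[R]_n) : `|Q - J0| <= e -> `|w *m Q *m A - w| <= `|w| / 2.
  move=> HQ; have -> : w *m Q *m A - w = w *m (Q - J0) *m A.
    by rewrite mulmxBr mulmxBl -[w *m J0 *m A]mulmxA J0A mulmx1.
  apply: le_trans (mulmx_norm _ _) _.
  apply: (@le_trans _ _ (n%:R * (n%:R * `|w| * e) * `|A|)).
    rewrite ler_wpM2r // ler_wpM2l //; apply: le_trans (mulmx_norm _ _) _.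
    by rewrite ler_wpM2l // mulr_ge0.
  rewrite (_ : _ * _ = `|w| * (n%:R * n%:R * `|A| * e)); last by ring.
  rewrite ler_wpM2l // /e invfM mulrCA mulrC -[leRHS]mul1r ler_wpM2r //.
  by rewrite ler_pdivrMr ?mul1r ?lerDl // ltr_wpDl // !mulr_ge0.
have [d d0 [HB HQ]] := strict_diff_rV oU C1 U0 e_gt0.
have near_id u v : ball u0 d u -> ball u0 d v ->
    `|(f u - f v) *m A - (u - v)| <= `|u - v| / 2.
  by move=> Hu Hv; have [Q HQe ->] := HQ _ _ Hu Hv; exact: small.
have expand u v : ball u0 d u -> ball u0 d v -> `|u - v| <= 2 * `|(f u - f v) *m A|.
  move=> Hu Hv; have := near_id _ _ Hu Hv; rewrite distrC => H.
  have := ler_normD ((u - v) - (f u - f v) *m A) ((f u - f v) *m A); rewrite subrK.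
  by lra.
have inj u v : ball u0 d u -> ball u0 d v -> f u = f v -> u = v.
  move=> Hu Hv E; have := expand _ _ Hu Hv; rewrite E subrr mul0mx normr0 mulr0.
  by rewrite normr_le0 subr_eq0 => /eqP.
have unitJ u : ball u0 d u -> jac f u \in unitmx.
  move=> Hu; rewrite -row_free_unit -kermx_eq0; apply/rowV0P => w /sub_kermxP wJ.
  have := small w (jac f u) (HB _ Hu).2; rewrite wJ mul0mx sub0r normrN => H.
  by apply/eqP; rewrite -normr_le0; lra.
have ballE w (r : R) : ball u0 r w <-> `|u0 - w| < r by rewrite -ball_normE.
pose c (y : 'rV[R]_n) := `|(y - f u0) *m A|.
have c_cont y : {for y, continuous c}.
  have H : Cr 0 setT (fun z : 'rV[R]_n => (z - f u0) *m A).
    apply: Cr_mulmx; [exact: openT| |exact: Cr_cst].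
    by apply: CrD; [exact: openT|exact: Cr_id|exact: Cr_cst].
  exact: (continuous_norm (Cr_cont H I)).
(* With this bound the minimizer [u] found below is within 4 d / 16 = d / 4 of [u0], and adding a
   correction of size at most d / 16 stays in the ball of radius d / 2. *)
pose O := [set y | c y < d / 16].
have oO : open O by apply: (@open_comp _ _ c [set t | t < d / 16]); [move=> *; exact: c_cont|exact: open_lt].
pose N := [set u | ball u0 d u /\ O (f u)].
(* The preimage of y is found by minimizing |(y - f u) *m A| on a closed ball. *)
have surj y : O y -> exists2 u, ball u0 d u & f u = y.
  move=> Oy; pose D := [set u : 'rV[R]_n | `|u0 - u| <= d / 2].
  have DB u : D u -> ball u0 d u by move=> Du; apply/ballE; apply: le_lt_trans Du _; lra.
  have cD : compact D by apply: compact_norm_ball; rewrite divr_gt0.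
  pose phi u := `|(y - f u) *m A|.
  have cphi : {within D, continuous phi}.
    apply: continuous_in_subspaceT => u /set_mem Du.
    have Uu : U u := (HB _ (DB _ Du)).1.
    have H : Cr 0 U (fun z : 'rV[R]_n => (y - f z) *m A).
      apply: Cr_mulmx; [exact: oU| |exact: Cr_cst].
      by apply: CrB; [exact: oU|exact: Cr_cst|exact: (Sf 0%N)].
    exact: (continuous_norm (Cr_cont H Uu)).
  have D0 : D u0 by rewrite /D /= subrr normr0 divr_ge0 ?ltW.
  have [u /set_mem Du Hmin] := EVT_min_rV (ex_intro _ _ D0) cD cphi.
  exists u; first exact: DB.
  apply/eqP; rewrite eq_sym -subr_eq0; apply/negPn/negP => yu.
  pose w := (y - f u) *m A.
  have w0 : 0 < `|w|.
    rewrite normr_gt0; apply: contra yu => /eqP/(congr1 (mulmxr J0)).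
    by rewrite /= /w -mulmxA mulVmx // mulmx1 mul0mx => ->.
  have H0 : `|w| <= c y by have := Hmin u0 (mem_set D0).
  have uu0 : `|u0 - u| <= d / 4.
    rewrite distrC; apply: le_trans (expand _ _ (DB _ Du) (DB _ D0)) _.
    have -> : (f u - f u0) *m A = (y - f u0) *m A - w.
      by rewrite /w -mulmxBl opprB addrCA addrAC subrr add0r addrC.
    have := ler_normB ((y - f u0) *m A) w; rewrite -/(c y).
    by move: Oy; rewrite /O /=; lra.
  (* [u + w] is a Newton step with frozen Jacobian: it reduces the residual |w| to at most |w| / 2,
     against minimality. *)
  have Duw : D (u + w).
    rewrite /D /= opprD addrA; apply: le_trans (ler_normB _ _) _.
    by move: Oy; rewrite /O /=; lra.
  have := Hmin (u + w) (mem_set Duw); rewrite /phi -/w.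
  have -> : (y - f (u + w)) *m A = - ((f (u + w) - f u) *m A - (u + w - u)).
    rewrite opprB [u + w]addrC addrK /w -mulmxBl; congr (_ *m _).
    by rewrite opprB addrA subrK.
  rewrite normrN; have := near_id _ _ (DB _ Duw) (DB _ Du).
  rewrite [X in _ <= `|X| / 2 -> _](_ : _ = w); last by rewrite addrC addKr.
  by lra.
pose h y := xget u0 [set u | ball u0 d u /\ f u = y].
have hP y : O y -> ball u0 d (h y) /\ f (h y) = y.
  by move=> /surj [u Bu fu]; rewrite /h; case: xgetP => [u' -> //|/(_ u)]; case.
have lip y y' : O y -> O y' -> `|h y - h y'| <= 2 * `|(y - y') *m A|.
  move=> /hP [By fy] /hP [By' fy']; have := expand _ _ By By'.
  by rewrite fy fy'.
have lip' y y' : O y -> O y' -> `|h y - h y'| <= 2 * (n%:R * `|A| + 1) * `|y - y'|.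
  move=> Oy Oy'; apply: le_trans (lip _ _ Oy Oy') _; rewrite -mulrA ler_wpM2l //.
  apply: le_trans (mulmx_norm _ _) _.
  by rewrite mulrDl mul1r mulrAC lerDl.
pose C := 2 * (n%:R * `|A| + 1).
have C0 : 0 < C by rewrite mulr_gt0 // ltr_wpDl // mulr_ge0.
have nO y : O y -> \forall z \near y, O z by move=> Oy; exact: open_nbhs_nbhs.
have contH y : O y -> {for y, continuous h}.
  move=> Oy; apply: (continuous_dist h y).2 => eps eps0.
  apply: (@nbhsS2 _ y _ _ _ _ (nO y Oy) (nbhsx_ballx y (eps / C) (divr_gt0 eps0 C0))) => z Oz yz.
  apply: le_lt_trans (lip' _ _ Oy Oz) _; rewrite -/C mulrC -ltr_pdivlMr //.
  by move: yz; rewrite -ball_normE.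
(* The inverse map is spelled out with [xget] because the increment bound in the limit is also
   called [h]. The quotient D satisfies D Q = v with Q close to the Jacobian at [h y], and is
   bounded by the Lipschitz estimate. *)
have derH y v : O y -> (h^-1 *: (xget u0 [set u | ball u0 d u /\ f u = (h *: v + y)] - xget u0 [set u | ball u0 d u /\ f u = y])) @[h --> 0^'] --> v *m invmx (jac f (h y)).
  move=> Oy; have [Bhy fhy] := hP _ Oy.
  have Uhy := (HB _ Bhy).1.
  pose J := jac f (h y); pose K := invmx J.
  have JK : J *m K = 1%:M := mulmxV (unitJ _ Bhy).
  apply/cvgrPdist_le => eps eps0.
  pose B0 := n%:R * n%:R * (C * `|v|) * `|K| + 1.
  have B0_gt0 : 0 < B0 by rewrite ltr_wpDl // !mulr_ge0 // ltW.
  have e'0 : 0 < eps / B0 by rewrite divr_gt0.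
  have [d' d'0 [_ HQ']] := strict_diff_rV oU C1 Uhy e'0.
  have curve : (t *: v + y) @[t --> (0 : R)] --> y.
    have := Cr_cont (u := 0 : R) (@Cr_affine R 1 n 0 setT y v openT) I.
    rewrite /prop_for /continuous_at scale0r addr0; apply: cvg_trans.
    by apply: near_eq_cvg; near=> t; rewrite addrC.
  have near1 : \forall t \near (0 : R)^', O (t *: v + y) /\ ball (h y) d' (h (t *: v + y)).
    apply: cvg_within; apply: (curve [set z | O z /\ ball (h y) d' (h z)]).
    by apply: nbhsI; [exact: nO|apply: contH => //; exact: nbhsx_ballx].
  have near2 : \forall t \near (0 : R)^', t != 0 by exact: nbhs_dnbhs_neq.
  apply: filterS2 near1 near2 => t [Ot Bt] t0.
  rewrite -/(h (t *: v + y)) -/(h y) -/J -/K.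
  have [Q HQ1] := HQ' _ _ Bt (ballxx _ d'0).
  rewrite (hP _ Ot).2 fhy addrK => tv.
  pose D := t^-1 *: (h (t *: v + y) - h y).
  have vE : v = D *m Q by rewrite /D -scalemxAl -tv scalerA mulVf // scale1r.
  have DC : `|D| <= C * `|v|.
    rewrite /D normrZ normfV ler_pdivrMl ?normr_gt0 //.
    apply: le_trans (lip' _ _ Ot Oy) _; rewrite addrK normrZ -/C.
    by rewrite mulrCA.
  have -> : v *m K - D = D *m (Q - J) *m K.
    by rewrite mulmxBr mulmxBl -vE -[D *m J *m K]mulmxA JK mulmx1.
  apply: le_trans (mulmx_norm _ _) _.
  apply: (@le_trans _ _ (n%:R * (n%:R * (C * `|v|) * (eps / B0)) * `|K|)).
    rewrite ler_wpM2r // ler_wpM2l //; apply: le_trans (mulmx_norm _ _) _.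
    by apply: ler_pM => //; rewrite ler_wpM2l.
  rewrite [leLHS](_ : _ = eps * ((n%:R * n%:R * (C * `|v|) * `|K|) / B0)); last by ring.
  apply: ler_piMr; first exact: ltW.
  rewrite (ler_pdivrMr _ _ B0_gt0) mul1r /B0 lerDl; exact: ler01.
(* Bootstrapping: the derivative of [h] is v times the inverse of [jac f \o h], so it is C^r as soon
   as [h] is. *)
have smoothH r : Cr r O h.
  elim: r => [|r IH]; [exact: Cr0|apply: CrS => // v].
  split=> [y Oy|]; first by apply/cvg_ex; exists (v *m invmx (jac f (h y))); exact: derH.
  have H : Cr r O (fun y => v *m invmx ((jac f \o h) y)).
    apply: Cr_mulmx; [exact: oO|exact: Cr_cst|].
    apply: Cr_invmx; [exact: oO|by move=> y /hP [/unitJ]|].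
    apply: (Cr_comp oO oU _ (Cr_jac oU (Sf r.+1)) IH) => y /hP [By _].
    exact: (HB _ By).1.
  apply: (Cr_ext oO _ H) => y Oy.
  by apply/esym/cvg_lim => //; exact: derH.
exists N, O, h; split; split=> //.
- rewrite openE => u [Bu Ou]; apply: filterI.
    by apply: open_nbhs_nbhs; split=> //; exact: ball_open.
  have cf : {for u, continuous f} := Cr_cont C1 (HB _ Bu).1.
  by apply: cf; exact: open_nbhs_nbhs.
- by split; [exact: ballxx|rewrite /O /= /c subrr mul0mx normr0 divr_gt0].
- by move=> u [/HB []].
- by move=> y Oy; have [Bh fh] := hP y Oy; split=> //; split=> //; rewrite fh.
- by move=> u [Bu Ou]; split=> //; have [Bh fh] := hP _ Ou; exact: inj.
Unshelve. all: by end_near. Qed.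

End InverseFunction.

(** * The Euclidean inner product and norm *)

Section EuclideanGeometry.
Context {R : realType}.

Lemma dotE n (v w : 'rV[R]_n) : dot v w = \sum_i v 0 i * w 0 i.
Proof. by rewrite /dot mxE; apply: eq_bigr => i _; rewrite mxE. Qed.

Lemma dotC n (v w : 'rV[R]_n) : dot v w = dot w v.
Proof. by rewrite !dotE; apply: eq_bigr => i _; rewrite mulrC. Qed.

Lemma dotDl n (u v w : 'rV[R]_n) : dot (u + v) w = dot u w + dot v w.
Proof. by rewrite /dot mulmxDl mxE. Qed.

Lemma dotZl n a (v w : 'rV[R]_n) : dot (a *: v) w = a * dot v w.
Proof. by rewrite /dot -scalemxAl mxE. Qed.

Lemma dotNl n (v w : 'rV[R]_n) : dot (- v) w = - dot v w.
Proof. by rewrite /dot mulNmx mxE. Qed.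

Lemma dotDr n (u v w : 'rV[R]_n) : dot w (u + v) = dot w u + dot w v.
Proof. by rewrite !(dotC w) dotDl. Qed.

Lemma dotZr n a (v w : 'rV[R]_n) : dot w (a *: v) = a * dot w v.
Proof. by rewrite !(dotC w) dotZl. Qed.

Lemma dotNr n (v w : 'rV[R]_n) : dot w (- v) = - dot w v.
Proof. by rewrite !(dotC w) dotNl. Qed.

Lemma dot_ge0 n (v : 'rV[R]_n) : 0 <= dot v v.
Proof. by rewrite dotE; apply: sumr_ge0 => i _; rewrite -expr2 sqr_ge0. Qed.

Lemma norm_sqr_le_dot n (v : 'rV[R]_n) : `|v| ^+ 2 <= dot v v.
Proof.
rewrite -(sqr_sqrtr (dot_ge0 v)) ler_pXn2r // ?nnegrE ?sqrtr_ge0 //.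
apply: mx_norm_le => [|i j]; first exact: sqrtr_ge0.
rewrite ord1 -sqrtr_sqr ler_wsqrtr // dotE (bigD1 j) //= -expr2 lerDl.
by apply: sumr_ge0 => k _; rewrite -expr2 sqr_ge0.
Qed.

Lemma dot_eq0 n (v : 'rV[R]_n) : dot v v = 0 -> v = 0.
Proof.
move=> E; have := norm_sqr_le_dot v; rewrite E => H.
by apply/eqP; rewrite -normr_eq0 -sqrf_eq0 eq_le H sqr_ge0.
Qed.

Lemma dot_gt0 n (v : 'rV[R]_n) : v != 0 -> 0 < dot v v.
Proof. by move=> v0; rewrite lt_neqAle dot_ge0 andbT eq_sym; apply: contra v0 => /eqP/dot_eq0 ->. Qed.

Lemma Cauchy_Schwarz n (v w : 'rV[R]_n) : dot v w <= enorm v * enorm w.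
Proof.
rewrite /enorm -sqrtrM ?dot_ge0 //; apply: le_trans (ler_norm _) _.
rewrite -sqrtr_sqr ler_wsqrtr //.
have [->|w0] := eqVneq w 0.
  by rewrite -[0](scale0r (0 : 'rV[R]_n)) !dotZr !mul0r mulr0 expr0n.
(* The vector |w|^2 v - <v, w> w has squared norm a (a c - b^2). *)
have := dot_ge0 (dot w w *: v + (- dot v w) *: w).
rewrite !(dotDl, dotDr, dotZl, dotZr) (dotC w v).
have := dot_gt0 w0; set a := dot w w; set b := dot v w; set c := dot v v => a0 H.
have : 0 <= a * (c * a - b ^+ 2) by apply: le_trans H _; rewrite le_eqVlt; apply/orP; left; apply/eqP; ring.
by rewrite pmulr_rge0 // subr_ge0.
Qed.

Lemma enorm_ge0 n (v : 'rV[R]_n) : 0 <= enorm v.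
Proof. exact: sqrtr_ge0. Qed.

Lemma enorm_sqr n (v : 'rV[R]_n) : enorm v ^+ 2 = dot v v.
Proof. by rewrite sqr_sqrtr ?dot_ge0. Qed.

Lemma enormD n (v w : 'rV[R]_n) : enorm (v + w) <= enorm v + enorm w.
Proof.
rewrite -(@ler_pXn2r _ 2) // ?nnegrE ?addr_ge0 ?enorm_ge0 //.
rewrite enorm_sqr sqrrD !enorm_sqr !(dotDl, dotDr) (dotC w v) mulr2n.
by have := Cauchy_Schwarz v w; lra.
Qed.

Lemma enormN n (v : 'rV[R]_n) : enorm (- v) = enorm v.
Proof. by rewrite /enorm dotNl dotNr opprK. Qed.

Lemma enormZ n a (v : 'rV[R]_n) : enorm (a *: v) = `|a| * enorm v.
Proof. by rewrite /enorm dotZl dotZr mulrA -expr2 sqrtrM ?sqr_ge0 // sqrtr_sqr. Qed.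

Lemma norm_le_enorm n (v : 'rV[R]_n) : `|v| <= enorm v.
Proof. by rewrite -(@ler_pXn2r _ 2) ?nnegrE ?enorm_ge0 // enorm_sqr norm_sqr_le_dot. Qed.

Lemma Cr_dot (E : normedModType R) n r (U : set E) (f g : E -> 'rV[R]_n) : open U ->
  Cr r U f -> Cr r U g -> Cr r U (fun u => dot (f u) (g u)).
Proof.
move=> oU Hf Hg; under eq_fun do rewrite dotE; apply: Cr_sum => // i _.
by apply: CrM => //; [exact: ((Cr_mxP _ _ oU).1 Hf)|exact: ((Cr_mxP _ _ oU).1 Hg)].
Qed.

End EuclideanGeometry.

(** * The strong maximum principle *)

Section MaximumPrinciple.
Context {R : realType}.

(** If [k] were positive, [g1] would be positive just to the right of 0, and the mean value theorem
    would make [g] exceed its maximum. *)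
Lemma second_derivative_at_max (g g1 : R -> R) (r k : R) : 0 < r ->
  (forall t : R, t \in `](- r), r[ -> is_derive t 1 g (g1 t)) ->
  (forall t : R, t \in `](- r), r[ -> g t <= g 0) -> is_derive (0 : R) 1 g1 k ->
  g1 0 = 0 /\ k <= 0.
Proof.
move=> r0 dg gmax [dk Dk].
have zin : 0 \in `](- r), r[ by rewrite in_itv /= oppr_lt0 r0.
have D0 : g1 0 = 0.
  have leab : - r <= r by lra.
  have := @derive1_at_max _ g (- r) r 0 leab (fun t ti => @ex_derive _ _ _ _ _ _ _ (dg t ti)) zin gmax.
  by move=> [_ E0]; have [_ <-] := dg 0 zin.
split=> //; rewrite leNgt; apply/negP => k0.
have : \forall h \near (0 : R)^', 0 < h^-1 * g1 h.
  have /cvgrPdist_lt/(_ k k0) : (h^-1 *: ((g1 \o shift 0) (h *: 1) - g1 0)) @[h --> (0 : R)^'] --> k.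
    by rewrite -Dk; exact: dk.
  apply: filterS => h; rewrite /= D0 subr0 addr0 [h *: 1]mulr1.
  by move=> /(le_lt_trans (ler_norm _)); rewrite -[h^-1 *: _]/(h^-1 * _); lra.
rewrite /dnbhs /within /= => /nbhs_ballP [r' /= r'0 Hr'].
pose t := Num.min r r' / 2.
have m0 : 0 < Num.min r r' by rewrite lt_min r0.
have m1 : Num.min r r' <= r by rewrite ge_min lexx.
have m2 : Num.min r r' <= r' by rewrite ge_min lexx orbT.
have [t0 [tr tr']] : 0 < t /\ t < r /\ t < r' by rewrite /t; lra.
clearbody t.
have sub (x : R) : x \in `]0, t[ -> x \in `](- r), r[.
  by rewrite !in_itv /= => /andP[x0 xt]; apply/andP; split; lra.
have hd : forall x : R, x \in `]0, t[ -> is_derive x 1 g (g1 x).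
  by move=> x xt; exact: (dg _ (sub _ xt)).
have hc : {within `[0, t], continuous g}.
  apply: derivable_within_continuous => x; rewrite in_itv /= => /andP[x0 xt].
  have xr : x \in `](- r), r[ by rewrite in_itv /=; apply/andP; split; lra.
  by have [] := dg x xr.
have [c ct] := MVT t0 hd hc.
rewrite subr0 => E.
  have : g t <= g 0 by apply: gmax; rewrite in_itv /=; apply/andP; split; lra.
  move: ct; rewrite in_itv /= => /andP[c0 ct].
  have : 0 < c^-1 * g1 c.
    apply: Hr'; last by rewrite gt_eqF.
    by rewrite -ball_normE /= sub0r normrN gtr0_norm //; lra.
  rewrite pmulr_rgt0 ?invr_gt0 // => Dc.
  by have := mulr_gt0 Dc t0; rewrite -E; lra.
Qed.

Lemma max_derivatives (E : normedModType R) (U : set E) (phi : E -> R) z v :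
  open U -> Cr 2 U phi -> U z -> {for 0, continuous (fun s : R => z + s *: v)} ->
  nbhs z [set y | phi y <= phi z] ->
  'D_v phi z = 0 /\ 'D_v ('D_v phi) z <= 0.
Proof.
move=> oU C2 Uz cl nz.
have z0 : z + (0 : R) *: v = z by rewrite scale0r addr0.
have : nbhs (0 : R) [set t | U (z + t *: v) /\ phi (z + t *: v) <= phi z].
  apply: (cl [set y | U y /\ phi y <= phi z]); rewrite z0.
  by apply: nbhsI => //; exact: open_nbhs_nbhs.
move=> /nbhs_ballP [r /= r0 Hr].
have inr (t : R) : t \in `](- r), r[ -> U (z + t *: v) /\ phi (z + t *: v) <= phi z.
  by rewrite in_itv /= -ltr_norml => tr; apply: Hr; rewrite -ball_normE /= sub0r normrN.
have := @second_derivative_at_max (fun t => phi (z + t *: v)) (fun t => 'D_v phi (z + t *: v)) r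
  ('D_v ('D_v phi) z) r0.
rewrite z0; apply.
- by move=> t /inr [/(Cr_derivable C2 (v := v)) /derivable_line [d1 d2] _]; apply: DeriveDef.
- by move=> t /inr [].
- have := @derivable_line _ _ _ ('D_v phi) z v 0; rewrite z0.
  by move=> /(_ (Cr_derivable (Cr_derive v C2) Uz)) [d1 d2]; apply: DeriveDef.
Qed.

End MaximumPrinciple.

(** * The barrier function and its derivatives *)

Section Barrier.
Context {R : realType} {n : nat}.
Implicit Types (z y v : 'rV[R]_n).

Lemma is_derive_quadratic (E : normedModType R) (f : E -> R) (z v : E) (a b : R) :
  (forall h : R, f (h *: v + z) = f z + h * a + h * h * b) -> is_derive z v f a.
Proof.
move=> H.
have cv : h^-1 *: (f (h *: v + z) - f z) @[h --> (0 : R)^'] --> a.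
  have cv1 : (a + h * b) @[h --> (0 : R)^'] --> a.
    rewrite -[X in _ --> X]addr0; apply: cvgD; first exact: cvg_cst.
    rewrite -[X in _ --> X](mul0r b); apply: cvgMr_tmp; exact: nbhs_dnbhs.
  apply: cvg_trans cv1; apply: near_eq_cvg.
  have : \forall h \near (0 : R)^', h != 0 by exact: nbhs_dnbhs_neq.
  apply: filterS => h h0; rewrite H.
  by rewrite -[RHS]/(h^-1 * _); field.
by apply: DeriveDef; [apply/cvg_ex; exists a|exact: cvg_lim cv].
Qed.

Variables (y : 'rV[R]_n) (c alpha : R).
Let s z := c - dot (z - y) (z - y).
(** A polynomial substitute for Hopf's exponential barrier: the second-order Taylor polynomial of
    (exp (alpha s) - 1) / alpha. It vanishes on the sphere s = 0 and has the sign of s while |alpha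
    s| is small. *)
Let b z := s z + alpha / 2 * (s z * s z).

Lemma is_derive_dist z v : is_derive z v s (- 2 * dot v (z - y)).
Proof.
apply: (@is_derive_quadratic _ _ _ _ _ (- dot v v)) => h.
rewrite /s; set w := z - y; have -> : h *: v + z - y = h *: v + w by rewrite /w addrA.
clearbody w.
rewrite !(dotDl, dotDr, dotZl, dotZr) (dotC w v); ring.
Qed.

Lemma is_derive_lin z v : is_derive z v (fun z => - 2 * dot v (z - y)) (- 2 * dot v v).
Proof.
apply: (@is_derive_quadratic _ _ _ _ _ 0) => h.
have -> : h *: v + z - y = h *: v + (z - y) by rewrite addrA.
by rewrite !(dotDr, dotZr); ring.
Qed.

Lemma derive_barrier z v : 'D_v b z = (1 + alpha * s z) * (- 2 * dot v (z - y)).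
Proof.
have ds := is_derive_dist z v.
have dss : is_derive z v (s * s) (s z *: (- 2 * dot v (z - y)) + s z *: (- 2 * dot v (z - y))).
  exact: is_deriveM.
have := is_deriveD ds (is_deriveZ (alpha / 2) dss).
move=> [_ E]; rewrite -[LHS]/('D_v (s + (alpha / 2) \*: (s * s)) z) E.
by rewrite -[(alpha / 2) *: _]/(alpha / 2 * (s z * _ + s z * _)); field.
Qed.

Lemma derive2_barrier z v : 'D_v ('D_v b) z =
  alpha * (- 2 * dot v (z - y)) ^+ 2 - 2 * (1 + alpha * s z) * dot v v.
Proof.
have -> : 'D_v b = (fun z => (1 + alpha * s z) * (- 2 * dot v (z - y))).
  by apply/funext => w; exact: derive_barrier.
have ds := is_derive_dist z v.
have d1 := is_deriveD (is_derive_cst (1 : R) z v) (is_deriveZ alpha ds).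
have d2 := is_deriveM d1 (is_derive_lin z v).
by case: d2 => _ E; apply: (etrans E);
  rewrite -[LHS]/((1 + alpha * s z) * (- 2 * dot v v) + (- 2 * dot v (z - y)) * (0 + alpha * (- 2 * dot v (z - y)))); ring.
Qed.

Lemma Cr_barrier r (U : set 'rV[R]_n) : open U -> Cr r U s /\ Cr r U b.
Proof.
move=> oU; have Hs : Cr r U s.
  apply: CrB => //; first exact: Cr_cst.
  by apply: Cr_dot => //; apply: CrB => //; [exact: Cr_id|exact: Cr_cst|exact: Cr_id|exact: Cr_cst].
split=> //; apply: CrD => //; apply: CrM => //; first exact: Cr_cst.
exact: CrM.
Qed.

End Barrier.

Section StrongMaximumPrinciple.
Context {R : realType}.

Lemma closed_superlevel (T : topologicalType) (f : T -> R) a :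
  (forall t, {for t, continuous f}) -> closed [set t | a <= f t].
Proof.
move=> cf; apply: (@preimage_closed _ _ f [set t | a <= t]); last exact: closed_ge.
by move=> t _; exact: cf.
Qed.

Lemma derive_comb (E : normedModType R) r (U : set E) (f g : E -> R) (e : R) u v :
  Cr r.+1 U f -> Cr r.+1 U g -> U u ->
  'D_v (fun z => f z + e * g z) u = 'D_v f u + e * 'D_v g u.
Proof.
move=> Hf Hg Uu.
have df := Cr_derivable (v := v) Hf Uu; have dg := Cr_derivable (v := v) Hg Uu.
have := is_deriveD (derivableP df) (is_deriveZ e (derivableP dg)).
by case.
Qed.

Arguments derive_comb {E r U f g} e {u v}.

Lemma derive2_comb (E : normedModType R) (U : set E) (f g : E -> R) (e : R) u v : open U ->
  Cr 2 U f -> Cr 2 U g -> U u ->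
  'D_v ('D_v (fun z => f z + e * g z)) u = 'D_v ('D_v f) u + e * 'D_v ('D_v g) u.
Proof.
move=> oU Hf Hg Uu; rewrite -(derive_comb e (Cr_derive v Hf) (Cr_derive v Hg) Uu).
apply: near_eq_derive.
have : nbhs u U by exact: open_nbhs_nbhs.
by apply: nbhsS => w Uw; exact: derive_comb Hf Hg Uw.
Qed.

Arguments derive2_comb {E U f g} e {u v}.

Lemma Cr_row (E : normedModType R) m n r (U : set E) (f : E -> 'M[R]_(m, n)) l : open U ->
  Cr r U f -> Cr r U (fun u => row l (f u)).
Proof.
move=> oU Hf; apply: (Cr_mxP _ _ oU).2 => i j; under eq_fun do rewrite mxE.
exact: ((Cr_mxP _ _ oU).1 Hf).
Qed.

(** The diffusion matrix is B^T B, see [ell_opE]. Keeping the factor B makes the second-order part a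
    sum of pure second derivatives along lines, to which one-variable calculus applies at a
    maximum. *)
Definition ell_op n p (B : 'M[R]_(p, n)) (beta : 'rV[R]_n) (w : 'rV[R]_n -> R) (u : 'rV[R]_n) : R :=
  \sum_l 'D_(row l B) ('D_(row l B) w) u + 'D_beta w u.

Lemma ell_op_comb n p (U : set 'rV[R]_n) (f g : 'rV[R]_n -> R) (e : R) (B : 'M[R]_(p, n)) beta u :
  open U -> Cr 2 U f -> Cr 2 U g -> U u ->
  ell_op B beta (fun z => f z + e * g z) u = ell_op B beta f u + e * ell_op B beta g u.
Proof.
move=> oU Hf Hg Uu; rewrite /ell_op mulrDr mulr_sumr addrACA -big_split /=; congr (_ + _).
  by apply: eq_bigr => l _; exact: (derive2_comb e oU Hf Hg Uu).
exact: (derive_comb e Hf Hg Uu).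
Qed.

Lemma ell_op_max n p (B : 'M[R]_(p, n)) (beta : 'rV[R]_n) (U : set 'rV[R]_n) (w : 'rV[R]_n -> R) u : open U ->
  Cr 2 U w -> U u -> nbhs u [set y | w y <= w u] -> ell_op B beta w u <= 0.
Proof.
move=> oU Hw Uu nu.
have H v : 'D_v w u = 0 /\ 'D_v ('D_v w) u <= 0.
  apply: (max_derivatives oU Hw Uu) => //.
  exact: (Cr_cont (@Cr_affine R 1 n 0 setT u v openT) I).
rewrite /ell_op (H beta).1 addr0; apply: sumr_le0 => l _; exact: (H _).2.
Qed.

Lemma ell_op_barrier n p (B : 'M[R]_(p, n)) (beta : 'rV[R]_n) (y : 'rV[R]_n) (c alpha : R) z :
  let s z := c - dot (z - y) (z - y) in
  ell_op B beta (fun z => s z + alpha / 2 * (s z * s z)) z =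
  4 * alpha * \sum_l dot (row l B) (z - y) ^+ 2
  - 2 * (1 + alpha * s z) * (\sum_l dot (row l B) (row l B) + dot beta (z - y)).
Proof.
move=> s; rewrite /ell_op derive_barrier.
under eq_bigr do rewrite derive2_barrier.
rewrite sumrB -!mulr_sumr.
under eq_bigr do rewrite exprMn.
by rewrite -mulr_sumr -/(s z); ring.
Qed.

(* Hopf's argument: if the closed ball around y through z1 met the zero set
   only at z1, then w plus a small multiple of the barrier, a strict subsolution
   near z1 that is negative outside the ball, would have an interior maximum.
   Jm is a left inverse of the diffusion matrix and plays the role of
   ellipticity. *)
Lemma no_contact n p (U : set 'rV[R]_n) (w : 'rV[R]_n -> R)
  (B : 'rV[R]_n -> 'M[R]_(p, n)) (Jm : 'rV[R]_n -> 'M[R]_(n, p)) (beta : 'rV[R]_n -> 'rV[R]_n)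
  (z1 y : 'rV[R]_n) :
  open U -> Cr 2 U w -> Cr 0 U B -> Cr 0 U beta -> U z1 -> Jm z1 *m B z1 = 1%:M ->
  (forall u, U u -> w u <= 0) -> (forall u, U u -> 0 <= ell_op (B u) (beta u) w u) ->
  w z1 = 0 -> z1 != y ->
  (forall z, U z -> z != z1 -> dot (z - y) (z - y) <= dot (z1 - y) (z1 - y) -> w z < 0) ->
  False.
Proof.
move=> oU Hw HB Hbeta Uz1 JB w_le0 Lw wz1 z1y wneg.
pose S z := \sum_l dot (row l (B z)) (z - y) ^+ 2.
pose TV z := \sum_l dot (row l (B z)) (row l (B z)) + dot (beta z) (z - y).
have Hzy : Cr 0 U (fun z : 'rV[R]_n => z - y) by apply: CrB; [exact: oU|exact: Cr_id|exact: Cr_cst].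
have cS : Cr 0 U S.
  apply: Cr_sum; [exact: oU|move=> l _; under eq_fun do rewrite expr2].
  by apply: CrM; [exact: oU| |]; (apply: Cr_dot; [exact: oU|exact: Cr_row|exact: Hzy]).
have cTV : Cr 0 U TV.
  apply: CrD; [exact: oU| |exact: Cr_dot].
  by apply: Cr_sum; [exact: oU|move=> l _; apply: Cr_dot; [exact: oU|exact: Cr_row|exact: Cr_row]].
(* Were the sum zero, all rows of [B z1] would be orthogonal to z1 - y, and the left inverse [Jm z1]
   would give z1 = y. *)
have S1 : 0 < S z1.
  rewrite lt_neqAle sumr_ge0 ?andbT; last by move=> l _; exact: sqr_ge0.
  apply: contra z1y => /eqP/esym S0; rewrite -subr_eq0; apply/eqP.
  have c0 : B z1 *m (z1 - y)^T = 0.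
    apply/matrixP => l j; rewrite ord1 [RHS]mxE.
    have := psumr_eq0P (fun l _ => sqr_ge0 (dot (row l (B z1)) (z1 - y))) S0 => /(_ l isT)/eqP.
    rewrite sqrf_eq0 => /eqP; rewrite dotE => E; rewrite mxE -[RHS]E.
    by apply: eq_bigr => i _; rewrite !mxE.
  apply: trmx_inj; rewrite trmx0 -[LHS]mul1mx -JB -mulmxA c0 mulmx0 //.
pose C := `|TV z1| + 1.
have C0 : 0 < C by rewrite ltr_wpDl.
pose q1 := dot (z1 - y) (z1 - y).
(* Where S z > S z1 / 2, the main term 4 alpha S z exceeds 2 alpha S z1 = 3 C + 1, while |alpha s| <
   1/2 and |TV| < C bound the other term by 2 (3/2) C = 3 C. *)
pose alpha := (3 * C + 1) / (2 * S z1).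
have a0 : 0 < alpha by rewrite divr_gt0 ?mulr_gt0 //; lra.
have aS : 2 * alpha * S z1 = 3 * C + 1 by rewrite /alpha; field; rewrite gt_eqF.
pose s z := q1 - dot (z - y) (z - y).
pose b z := s z + alpha / 2 * (s z * s z).
have [Hs _] := Cr_barrier y q1 alpha 0 oU.
have [_ Hb] := Cr_barrier y q1 alpha 2 oU.
have sz1 : s z1 = 0 by rewrite /s subrr.
have Lb z : S z1 / 2 < S z -> `|TV z| < C -> `|alpha * s z| < 1 / 2 ->
    0 < ell_op (B z) (beta z) b z.
  rewrite /b /s => HS HTV Has; rewrite ell_op_barrier -/(S z) -/(TV z).
  have H1 : alpha * S z1 < 2 * alpha * S z.
    have HS' : 0 < S z - S z1 / 2 by rewrite subr_gt0.
    by have := mulr_gt0 a0 HS'; lra.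
  have H2 : `|2 * (1 + alpha * s z) * TV z| <= 3 * C.
    rewrite normrM ler_pM // ?(ltW HTV) //.
    by move: Has; rewrite -/(s z) ltr_norml ler_norml => /andP[? ?]; apply/andP; split; lra.
  move: H2; rewrite ler_norml -/(s z) => /andP[_ H2].
  by lra.
have : nbhs z1 [set z | [/\ U z, S z1 / 2 < S z, `|TV z| < C & `|alpha * s z| < 1 / 2]].
  have n1 : nbhs z1 U by exact: open_nbhs_nbhs.
  have n2 := (continuous_dist S z1).1 (Cr_cont cS Uz1) _ (divr_gt0 S1 (ltr0Sn R 1)).
  have n3 := (continuous_dist TV z1).1 (Cr_cont cTV Uz1) 1 ltr01.
  have d0 : 0 < 1 / 2 / alpha by apply: divr_gt0; [lra|exact: a0].
  have n4 := (continuous_dist s z1).1 (Cr_cont Hs Uz1) _ d0.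
  apply: (nbhsS2 _ (nbhsI n1 n2) (nbhsI n3 n4)) => z [Uz /= z2] [/= z3 z4]; split=> //.
  - by move: z2; rewrite ltr_norml => /andP[? ?]; lra.
  - have := ler_normB (TV z1) (TV z1 - TV z); rewrite subKr /C; lra.
  - by move: z4; rewrite sz1 sub0r normrN normrM (gtr0_norm a0) (mulrC alpha) (ltr_pdivlMr _ _ a0).
move=> /nbhs_ballP [eta /= eta0 Heta].
pose N := [set z | `|z1 - z| <= eta / 2].
have Nb z : N z -> [/\ U z, S z1 / 2 < S z, `|TV z| < C & `|alpha * s z| < 1 / 2].
  by rewrite /N /= => Nz; apply: Heta; rewrite -ball_normE /=; lra.
have cN : compact N by apply: compact_norm_ball; lra.
have N0 : N z1 by rewrite /N /= subrr normr0; lra.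
have cw : {within N, continuous w}.
  by apply: continuous_in_subspaceT => z /set_mem /Nb [Uz _ _ _]; exact: Cr_cont Hw Uz.
(* The part of the boundary of [N] inside the closed ball around [y]. It is compact and [w] is
   negative on it, hence at most some - delta. *)
pose A := N `&` [set z | eta / 2 <= `|z1 - z| /\ 0 <= s z].
have Hs' : forall z, {for z, continuous s}.
  by move=> z; have [H _] := Cr_barrier y q1 alpha 0 (@openT 'rV[R]_n); exact: Cr_cont H I.
have cA : compact A.
  apply: compact_closedI => //.
  have c1 : continuous (fun z : 'rV[R]_n => `|z1 - z|).
    move=> z; have H : Cr 0 setT (fun z : 'rV[R]_n => z1 - z).
      by apply: CrB; [exact: openT|exact: Cr_cst|exact: Cr_id].
    exact: (continuous_norm (Cr_cont H I)).
  exact: (closedI (closed_superlevel (a := eta / 2) c1) (closed_superlevel (a := 0) Hs')).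
have Aneg z : A z -> w z < 0.
  move=> [Nz [ez sz]]; have [Uz _ _ _] := Nb _ Nz; apply: wneg => //.
    by apply: contraTneq ez => ->; rewrite subrr normr0 -ltNge; lra.
  by move: sz; rewrite /s subr_ge0.
have [delta d0 Hd] : exists2 delta : R, 0 < delta & forall z, A z -> w z <= - delta.
  have [A0|/set0P A0] := eqVneq A set0.
    by exists 1 => // z; rewrite A0.
  have cwA : {within A, continuous w}.
    by apply: continuous_subspaceW cw => z [].
  have [z2 /set_mem Az2 Hz2] := EVT_max_rV A0 cA cwA.
  exists (- w z2); first by rewrite oppr_gt0 Aneg.
  by move=> z Az; rewrite opprK; apply: Hz2; exact: mem_set.
(* On [N] one has alpha b < 1, so e b <= delta / 2 cannot compensate w <= - delta on [A]. *)
pose e := delta * alpha / 2.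
have e0 : 0 < e by rewrite divr_gt0 // mulr_gt0.
pose phi z := w z + e * b z.
have Hphi : Cr 2 U phi.
  by apply: CrD; [exact: oU|exact: Hw|apply: CrM; [exact: oU|exact: Cr_cst|exact: Hb]].
have cphi : {within N, continuous phi}.
  by apply: continuous_in_subspaceT => z /set_mem /Nb [Uz _ _ _]; exact: Cr_cont Hphi Uz.
have [z2 /set_mem Nz2 Hz2] := EVT_max_rV (ex_intro _ _ N0) cN cphi.
have phi0 : 0 <= phi z2.
  have := Hz2 z1 (mem_set N0); rewrite {1}/phi wz1 /b sz1 !mulr0 !addr0 mulr0 addr0 //.
have [Uz2 Sz2 TVz2 sz2] := Nb _ Nz2.
(* An interior maximum of [phi] contradicts L phi > 0. On the boundary of [N], either z2 is in [A],
   or s z2 < 0 makes the barrier negative; both contradict phi z2 >= phi z1 = 0. *)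
have [lt2|ge2] := ltP `|z1 - z2| (eta / 2).
  have : ell_op (B z2) (beta z2) phi z2 <= 0.
    refine (ell_op_max (B z2) (beta z2) oU Hphi Uz2 _).
    have : nbhs z2 (ball z1 (eta / 2)).
      by apply: open_nbhs_nbhs; split; [exact: ball_open|rewrite -ball_normE].
    apply: nbhsS => z; rewrite -ball_normE /= => /ltW Nz; apply: Hz2; exact: mem_set.
  rewrite (ell_op_comb e (B z2) (beta z2) oU Hw Hb Uz2).
  have := mulr_gt0 e0 (Lb _ Sz2 TVz2 sz2); have := Lw _ Uz2; lra.
have as2 : - (1 / 2) < alpha * s z2 /\ alpha * s z2 < 1 / 2.
  by move: sz2; rewrite ltr_norml => /andP[].
have bE : alpha * b z2 = alpha * s z2 * (1 + alpha * s z2 / 2) by rewrite /b; field.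
have eb : e * b z2 = delta / 2 * (alpha * b z2) by rewrite /e; field.
set x := alpha * s z2 in as2 bE.
have [sz|sz] := leP 0 (s z2).
  have := Hd z2 (conj Nz2 (conj ge2 sz)).
  have : alpha * b z2 < 1 by rewrite bE; case: as2 => ? ?; nra.
  move=> H H2; have : e * b z2 <= delta / 2 by rewrite eb ler_piMr ?divr_ge0 ?(ltW d0) // ltW.
  by move: phi0; rewrite /phi; lra.
have x0 : x < 0 by rewrite /x pmulr_rlt0.
have : alpha * b z2 < 0 by rewrite bE nmulr_rlt0 //; case: as2 => ? ?; lra.
rewrite pmulr_rlt0 // => b0.
have : e * b z2 < 0 by rewrite pmulr_rlt0.
by have := w_le0 _ Uz2; move: phi0; rewrite /phi; lra.
Qed.

End StrongMaximumPrinciple.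
Arguments derive_comb {R E r U f g} e {u v}.
Arguments derive2_comb {R E U f g} e {u v}.

(** The points of [A] where [P] holds form a relatively clopen set. This serves as an induction
    principle along time, on the source of a lift and on Sigma. *)
Lemma connected_locally_constant (T : topologicalType) (A : set T) (P : T -> Prop) :
  connected A -> (forall t, A t -> nbhs t [set t' | A t' -> (P t' <-> P t)]) ->
  forall a b, A a -> A b -> P a -> P b.
Proof.
move=> cA loc a b Aa Ab Pa.
suff E : A `&` P = A by have [] : (A `&` P) b by rewrite E.
apply: cA; first by exists a.
- exists ([set t | A t -> P t]^°)%classic; first exact: open_interior.
  apply/seteqP; split=> t [At H]; split=> //; last exact: (interior_subset H).
  by apply: nbhsS (loc t At) => t' H' /H' ->.
- exists (~` ([set t | A t -> ~ P t]^°)%classic); first exact/open_closedC/open_interior.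
  apply/seteqP; split=> t [At H]; split=> //.
    by move=> /interior_subset /(_ At).
  apply: contrapT => nP; apply: H.
  by apply: nbhsS (loc t At) => t' H' /H' ->.
Qed.

Section StrongMaximum.
Context {R : realType}.

Lemma enorm0 n : enorm (0 : 'rV[R]_n) = 0.
Proof. by rewrite /enorm -(scale0r (0 : 'rV[R]_n)) dotZl mul0r sqrtr0. Qed.

Lemma continuous_dist_to n (y z : 'rV[R]_n) : {for z, continuous (fun z : 'rV[R]_n => dot (z - y) (z - y))}.
Proof.
have H : Cr 0 setT (fun z : 'rV[R]_n => z - y).
  by apply: CrB; [exact: openT|exact: Cr_id|exact: Cr_cst].
exact: (Cr_cont (Cr_dot openT H H) I).
Qed.

Arguments continuous_dist_to {n} y z.

Lemma continuous_enorm_dist n (y z : 'rV[R]_n) : {for z, continuous (fun z : 'rV[R]_n => enorm (z - y))}.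
Proof.
by apply: (@continuous_comp _ _ _ (fun z : 'rV[R]_n => dot (z - y) (z - y)) (@Num.sqrt R) z); [exact: continuous_dist_to|exact: sqrt_continuous].
Qed.

Arguments continuous_enorm_dist {n} y z.

Lemma enorm_ball_nbhs n (z0 : 'rV[R]_n) (r : R) : 0 < r ->
  nbhs z0 [set z | enorm (z - z0) < r].
Proof.
move=> r0; have := (continuous_dist _ z0).1 (continuous_enorm_dist z0 z0) r r0.
by apply: nbhsS => z /=; rewrite subrr enorm0 sub0r normrN ger0_norm ?enorm_ge0.
Qed.

Lemma closed_sublevel (T : topologicalType) (f : T -> R) a :
  (forall t, {for t, continuous f}) -> closed [set t | f t <= a].
Proof.
move=> cf; apply: (@preimage_closed _ _ f [set t | t <= a]); last exact: closed_le.
by move=> t _; exact: cf.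
Qed.

(** If [w] were negative at a point [y] close to z0, a zero of [w] nearest to [y] would lie on the
    boundary of a Euclidean ball free of zeros, the situation excluded by [no_contact]. *)
Lemma strong_maximum n p (U : set 'rV[R]_n) (w : 'rV[R]_n -> R)
  (B : 'rV[R]_n -> 'M[R]_(p, n)) (Jm : 'rV[R]_n -> 'M[R]_(n, p)) (beta : 'rV[R]_n -> 'rV[R]_n)
  (z0 : 'rV[R]_n) :
  open U -> Cr 2 U w -> Cr 0 U B -> Cr 0 U beta -> (forall u, U u -> Jm u *m B u = 1%:M) ->
  (forall u, U u -> w u <= 0) -> (forall u, U u -> 0 <= ell_op (B u) (beta u) w u) ->
  U z0 -> w z0 = 0 -> nbhs z0 [set z | w z = 0].
Proof.
move=> oU Hw HB Hbeta JB w_le0 Lw Uz0 wz0.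
have /nbhs_ballP[r0 /= r0_gt0 Hr0] := open_nbhs_nbhs (conj oU Uz0).
(* A zero nearest to a point at distance less than rho from z0 is within 2 rho of z0, so the zeros
   are sought in that ball, which must lie in [U]. *)
pose rho := r0 / 4; have rho0 : 0 < rho by rewrite divr_gt0.
have KU z : enorm (z - z0) <= 2 * rho -> U z.
  move=> Kz; apply: Hr0; rewrite -ball_normE /= distrC.
  by have := norm_le_enorm (z - z0); move: Kz; rewrite /rho; lra.
apply: nbhsS (enorm_ball_nbhs z0 rho0) => y /= yz0.
have Uy : U y by apply: KU; lra.
apply/eqP; rewrite eq_le w_le0 //= leNgt; apply/negP => wy.
pose Z := [set z | enorm (z - z0) <= 2 * rho /\ w z = 0].
have cZ : compact Z.
  have r2 : 0 < 2 * rho by rewrite mulr_gt0.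
  have sub : Z `<=` [set z | `|z0 - z| <= 2 * rho].
    by move=> z [Kz _] /=; rewrite distrC; apply: le_trans (norm_le_enorm _) Kz.
  suff clZ : closed Z by exact: (subclosed_compact clZ (@compact_norm_ball R n z0 _ r2) sub).
  move=> t clt.
  have Kt : enorm (t - z0) <= 2 * rho.
    have := @closed_sublevel _ (fun z : 'rV[R]_n => enorm (z - z0)) (2 * rho) (fun t => continuous_enorm_dist z0 t).
    by apply; move: clt; apply: closureS => z [].
  split=> //; apply: contrapT => /eqP wt.
  have ct := (continuous_dist w t).1 (Cr_cont Hw (KU _ Kt)) `|w t|.
  rewrite normr_gt0 in ct; have [z [[Kz wz] /=]] := clt _ (ct wt).
  by rewrite wz subr0 ltxx.
have Zz0 : Z z0.
  split=> //; rewrite subrr enorm0; lra.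
have cd : {within Z, continuous (fun z : 'rV[R]_n => dot (z - y) (z - y))}.
  by apply: continuous_in_subspaceT => z _; exact: continuous_dist_to.
have [z1 /set_mem [Kz1 wz1] Hz1] := EVT_min_rV (ex_intro _ _ Zz0) cZ cd.
(* z1 is a zero nearest to y; shrinking the ball to the one centered at the
   midpoint y2 makes z1 its only zero. *)
pose y2 := 2^-1 *: (y + z1).
have E1 z : z - y = (z - y2) + (z1 - y2).
  have two : y2 + y2 = y + z1 by rewrite /y2 -scalerDl (_ : 2^-1 + 2^-1 = 1) ?scale1r //; lra.
  rewrite addrACA -opprD two opprD addrACA subrr addr0 //.
have yz1 : y != z1 by apply: contraTneq wy => ->; rewrite wz1 ltxx.
apply: (@no_contact R n p U w B Jm beta z1 y2 oU Hw HB Hbeta (KU _ Kz1) (JB _ (KU _ Kz1)) w_le0 Lw wz1).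
  by apply: contra yz1 => /eqP E; rewrite eq_sym -subr_eq0 E1 -E subrr addr0.
move=> z Uz zz1 Hz.
have lt : dot (z - y) (z - y) < dot (z1 - y) (z1 - y).
  have := dot_gt0 (v := z - z1); rewrite subr_eq0 => /(_ zz1).
  have -> : z - z1 = (z - y2) - (z1 - y2) by rewrite opprB addrA subrK.
  rewrite !E1; move: Hz; set a := z - y2; set b := z1 - y2; clearbody a b.
  by rewrite !(dotDl, dotDr, dotNl, dotNr) (dotC b a); lra.
rewrite lt_neqAle w_le0 // andbT; apply/eqP => wz.
have le0 := Hz1 z0 (mem_set Zz0).
have zy : enorm (z - y) <= enorm (z0 - y) by rewrite ler_wsqrtr //; apply: le_trans (ltW lt) le0.
(* A zero strictly closer to [y] than z1 is no farther from [y] than z0 is; hence it belongs to [Z],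
   against the choice of z1. *)
have Kz : enorm (z - z0) <= 2 * rho.
  have -> : z - z0 = (z - y) + (y - z0) by rewrite addrA subrK.
  apply: le_trans (enormD _ _) _.
  by move: zy; rewrite -(enormN (z0 - y)) opprB; lra.
by have := Hz1 z (mem_set (conj Kz wz)); rewrite leNgt lt.
Qed.

End StrongMaximum.

(** * Coordinate expression and Leibniz rule of the operator *)

Section EllOpCoordinates.
Context {R : realType}.

Lemma is_derive_lincomb (E : normedModType R) (I : Type) (s : seq I) (a : I -> R)
    (f : I -> E -> R) (df : I -> R) (u v : E) :
  (forall i, is_derive u v (f i) (df i)) ->
  is_derive u v (fun z => \sum_(i <- s) a i * f i z) (\sum_(i <- s) a i * df i).
Proof.
move=> H; elim: s => [|i s IH].
  by under eq_fun do rewrite big_nil; rewrite big_nil; exact: is_derive_cst.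
under eq_fun do rewrite big_cons; rewrite big_cons.
exact: is_deriveD (is_deriveZ (a i) (H i)) IH.
Qed.

Lemma derive2_coord n (U : set 'rV[R]_n) (f : 'rV[R]_n -> R) u v : open U -> Cr 2 U f -> U u ->
  'D_v ('D_v f) u = \sum_i \sum_j v 0 i * v 0 j * pd i (pd j f) u.
Proof.
move=> oU Hf Uu.
rewrite (C1_differentiable oU (Cr_derive v Hf) Uu).2.
apply: eq_bigr => i _.
have -> : pd i ('D_v f) u = \sum_j v 0 j * pd i (pd j f) u.
  have E : \forall w \near u, 'D_v f w = \sum_j v 0 j * pd j f w.
    have : nbhs u U by exact: open_nbhs_nbhs.
    by apply: nbhsS => w Uw; rewrite (C1_differentiable oU (Cr_pred Hf) Uw).2.
  rewrite /pd (near_eq_derive _ E).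
  have := @is_derive_lincomb _ _ (index_enum 'I_n) (fun j => v 0 j) (fun j => pd j f) (fun j => pd i (pd j f) u) u (delta_mx 0 i).
  case=> // j; apply: derivableP; exact: (Cr_derivable (Cr_derive _ Hf)).
by rewrite mulr_sumr; apply: eq_bigr => j _; rewrite mulrA.
Qed.

Lemma ell_opE n p (U : set 'rV[R]_n) (f : 'rV[R]_n -> R) (B : 'M[R]_(p, n)) beta u :
  open U -> Cr 2 U f -> U u ->
  ell_op B beta f u = \sum_i \sum_j (B^T *m B) i j * pd i (pd j f) u + \sum_k beta 0 k * pd k f u.
Proof.
move=> oU Hf Uu; rewrite /ell_op (C1_differentiable oU (Cr_pred Hf) Uu).2; congr (_ + _).
under eq_bigr => l _ do rewrite (derive2_coord _ oU Hf Uu).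
rewrite exchange_big; apply: eq_bigr => i _ /=.
rewrite exchange_big; apply: eq_bigr => j _ /=.
rewrite mxE mulr_suml; apply: eq_bigr => l _; by rewrite !mxE.
Qed.

Lemma pd_coord2 n q (U : set 'rV[R]_n) (X : 'rV[R]_n -> 'rV[R]_q) u i j a :
  open U -> Cr 2 U X -> U u ->
  (pd i (pd j X) u) 0 a = pd i (pd j (fun w => X w 0 a)) u.
Proof.
move=> oU HX Uu; rewrite /pd derive_mx ?mxE; last exact: (Cr_derivable (Cr_derive _ HX)).
apply: near_eq_derive; have : nbhs u U by exact: open_nbhs_nbhs.
apply: nbhsS => w Uw; rewrite derive_mx ?mxE //; exact: (Cr_derivable HX).
Qed.

Lemma ell_op_cst n p (a : R) (B : 'M[R]_(p, n)) beta u : ell_op B beta (fun=> a) u = 0.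
Proof.
have E v : 'D_v (fun=> a) = (fun=> 0) :> ('rV[R]_n -> R) by apply/funext => w; exact: derive_cst.
by rewrite /ell_op derive_cst addr0 big1 // => l _; rewrite E derive_cst.
Qed.

Lemma ell_op_lincomb n p (U : set 'rV[R]_n) (I : Type) (s : seq I) (a : I -> R)
    (f : I -> 'rV[R]_n -> R) (B : 'M[R]_(p, n)) beta u :
  open U -> (forall i, Cr 2 U (f i)) -> U u ->
  ell_op B beta (fun w => \sum_(i <- s) a i * f i w) u = \sum_(i <- s) a i * ell_op B beta (f i) u.
Proof.
move=> oU Hf Uu; elim: s => [|i s IH].
  by under eq_fun do rewrite big_nil; rewrite big_nil; exact: ell_op_cst.
under eq_fun do rewrite big_cons addrC; rewrite big_cons addrC -IH.
apply: (ell_op_comb _ _ _ oU _ (Hf i) Uu).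
apply: Cr_sum; [exact: oU|move=> j _]; apply: CrM; [exact: oU|exact: Cr_cst|exact: Hf].
Qed.

(** The sum of squares is the carré du champ; for the frame of an immersion it is |grad f|^2. *)
Lemma ell_op_sqr n p (U : set 'rV[R]_n) (f : 'rV[R]_n -> R) (B : 'M[R]_(p, n)) beta u :
  open U -> Cr 2 U f -> U u ->
  ell_op B beta (fun w => f w * f w) u =
  2 * (f u * ell_op B beta f u + \sum_l ('D_(row l B) f u) ^+ 2).
Proof.
move=> oU Hf Uu.
have d1 v w : U w -> 'D_v (fun w => f w * f w) w = 2 * (f w * 'D_v f w).
  move=> Uw; have df := Cr_derivable (v := v) Hf Uw.
  by apply: (etrans (deriveM df df)); rewrite -[LHS]/(f w * 'D_v f w + f w * 'D_v f w); ring.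
have d2 v : 'D_v ('D_v (fun w => f w * f w)) u = 2 * (f u * 'D_v ('D_v f) u + ('D_v f u) ^+ 2).
  have E : \forall w \near u, 'D_v (fun w => f w * f w) w = 2 * (f w * 'D_v f w).
    have : nbhs u U by exact: open_nbhs_nbhs.
    by apply: nbhsS => w; exact: d1.
  rewrite (near_eq_derive _ E).
  have df := derivableP (Cr_derivable (v := v) Hf Uu).
  have ddf := derivableP (Cr_derivable (v := v) (Cr_derive v Hf) Uu).
  have [_ H] := is_deriveZ 2 (is_deriveM df ddf).
  apply: (etrans H); rewrite -[LHS]/(2 * (f u * 'D_v ('D_v f) u + 'D_v f u * 'D_v f u)).
  by rewrite expr2.
rewrite /ell_op d1 //; under eq_bigr do rewrite d2.
rewrite -mulr_sumr big_split -mulr_sumr /=; ring.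
Qed.

End EllOpCoordinates.

(** * Self-shrinkers inside a cylinder *)

Section FrameAlgebra.
Context {R : realType} {n q : nat} (J : 'M[R]_(n, q)).
Hypothesis Jfree : row_free J.
Let G := J *m J^T.
(** The Moore-Penrose right inverse of J. It satisfies B^T B = G^-1, and B J is the orthogonal
    projection on the row space of J. *)
Let B := J^T *m invmx G.

Lemma gram_unitmx : G \in unitmx.
Proof.
rewrite -row_free_unit -kermx_eq0; apply/rowV0P => v /sub_kermxP vG.
have vJ : v *m J = 0.
  apply: dot_eq0; rewrite /dot trmx_mul -mulmxA [J *m _]mulmxA.
  by rewrite mulmxA vG mul0mx mxE.
by apply: (row_free_inj Jfree); rewrite mul0mx.
Qed.

Lemma gram_trmx : G^T = G.
Proof. by rewrite /G trmx_mul trmxK. Qed.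

Lemma invgram_trmx : (invmx G)^T = invmx G.
Proof. by rewrite trmx_inv gram_trmx. Qed.

Lemma frame_right_inverse : J *m B = 1%:M.
Proof. by rewrite /B mulmxA mulmxV // gram_unitmx. Qed.

Lemma frame_gram : B^T *m B = invmx G.
Proof.
rewrite /B trmx_mul trmxK invgram_trmx -mulmxA [J *m _]mulmxA.
by rewrite mulmxV ?mulmx1 // gram_unitmx.
Qed.

Let P := B *m J.

(** [P] is symmetric and idempotent. For J the Jacobian of an immersion, both sides are the squared
    norm of the gradient of the coordinate x_a. *)
Lemma proj_diag_sum a : \sum_l P l a ^+ 2 = P a a.
Proof.
have Psym : P^T = P by rewrite /P /B !trmx_mul trmxK invgram_trmx mulmxA.
have PP : P *m P = P by rewrite /P -mulmxA [J *m (B *m J)]mulmxA frame_right_inverse mul1mx.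
rewrite -[RHS]/(P a a) -{2}PP mxE; apply: eq_bigr => l _.
by rewrite expr2 -{1}Psym mxE.
Qed.

Lemma proj_diag_le1 a : P a a <= 1.
Proof.
have := proj_diag_sum a; rewrite (bigD1 a) //= => E.
have : P a a ^+ 2 <= P a a by rewrite -{2}E lerDl; apply: sumr_ge0 => l _; exact: sqr_ge0.
by set p := P a a => H; rewrite leNgt; apply/negP => lt; nra.
Qed.

Lemma proj_trace : \sum_a P a a = n%:R.
Proof.
rewrite -[LHS]/(\tr P) /P mxtrace_mulC frame_right_inverse.
exact: mxtrace1.
Qed.

End FrameAlgebra.

Lemma card_gt_ord (m k : nat) : (k <= m)%N -> #|[pred i : 'I_m.+1 | ~~ (i <= k)%N]| = (m - k)%N.
Proof.
move=> km.
have := cardC [pred i : 'I_m.+1 | (i <= k)%N]; rewrite card_ord.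
have -> : #|[pred i : 'I_m.+1 | (i <= k)%N]| = k.+1.
  rewrite cardE -(size_map val) -[RHS](size_iota 0).
  apply: perm_size; apply: uniq_perm; [by rewrite map_inj_uniq ?enum_uniq //; exact: val_inj|exact: iota_uniq|].
  move=> i; rewrite mem_iota /= add0n ltnS; apply/mapP/idP => [[j + ->]|ik].
    by rewrite mem_enum inE.
  have im : (i < m.+1)%N by rewrite ltnS (leq_trans ik).
  by exists (Ordinal im); rewrite ?mem_enum ?inE.
move=> E; apply/eqP; rewrite -(eqn_add2l k.+1) E; apply/eqP; lia.
Qed.

(* The projection has trace m and its m - k remaining diagonal entries are at
   most 1. *)
Lemma proj_head_ge (R : realType) (m k : nat) (J : 'M[R]_(m, m.+1)) : row_free J -> (k <= m)%N ->
  k%:R <= \sum_(a < m.+1 | (a <= k)%N) (J^T *m invmx (J *m J^T) *m J) a a.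
Proof.
move=> Jf km; have := proj_trace Jf; rewrite (bigID (fun a : 'I_m.+1 => (a <= k)%N)) /=.
move=> E; have : \sum_(a < m.+1 | ~~ (a <= k)%N) (J^T *m invmx (J *m J^T) *m J) a a <= (m - k)%:R.
  apply: le_trans (ler_sum _ (fun a _ => proj_diag_le1 Jf a)) _.
  by rewrite sumr_const card_gt_ord.
by rewrite natrB //; lra.
Qed.

(** * Chart manipulations *)

Section Charts.
Context {R : realType} {m : nat} {M : manifold R m}.
Implicit Types c : chart R m M.

Lemma chart_cod_open c : atlas c -> open (chart_cod c).
Proof. by move=> /atlas_chart []. Qed.

Lemma chart_inv_cod c u : atlas c -> chart_cod c u ->
  chart_dom c (chart_inv c u) /\ c (chart_inv c u) = u.
Proof. by move=> /atlas_chart [_ _ cK _ _] [p dp <-]; rewrite cK. Qed.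

Lemma chart_dom_cod c p : chart_dom c p -> chart_cod c (c p).
Proof. by move=> dp; exists p. Qed.

Lemma chartK c p : atlas c -> chart_dom c p -> chart_inv c (c p) = p.
Proof. by move=> /atlas_chart [_ _ cK _ _]; exact: cK. Qed.

Lemma chart_nbhs c p (P : set 'rV[R]_m) : atlas c -> chart_dom c p ->
  nbhs (c p) P -> nbhs p [set p' | chart_dom c p' /\ P (c p')].
Proof.
move=> /atlas_chart [odom _ _ cc _] dp nP.
exact: nbhsI (open_nbhs_nbhs (conj odom dp)) (cc p dp P nP).
Qed.

Lemma continuous_in_chart (n : nat) (w : M -> 'rV[R]_n) : smooth_map w -> continuous w.
Proof.
move=> Sw p.
pose c := chart_at p; have Ac : atlas c := chart_at_atlas p; have dp : chart_dom c p := chart_at_dom p.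
have cX := Cr_cont (Sw c Ac 0%N) (chart_dom_cod dp).
move=> P nP; have := cX P; rewrite /in_chart /= chartK // => /(_ nP) nQ.
by apply: nbhsS (chart_nbhs Ac dp nQ) => p' [dp' /=]; rewrite /= chartK.
Qed.

Lemma metric_preserving_gram (g : riemannian_metric M) (x : M -> 'rV[R]_m.+1) c u :
  metric_preserving g x -> atlas c -> chart_cod c u ->
  g c u = jac (in_chart x c) u *m (jac (in_chart x c) u)^T.
Proof.
move=> mp Ac cu; rewrite (mp c u Ac cu); apply/matrixP => i j.
by rewrite !mxE dotE; apply: eq_bigr => a _; rewrite !mxE.
Qed.

End Charts.

Section Shrinker.
Context {R : realType} {m : nat} {M : manifold R m}.
Variables (g : riemannian_metric M) (x : M -> 'rV[R]_m.+1).
Hypothesis hx : self_shrinker g x.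

(** Row l holds the chart coordinates of the tangential projection of the l-th basis vector of the
    ambient space. *)
Definition frame_mx (c : chart R m M) (u : 'rV[R]_m) : 'M[R]_(m.+1, m) :=
  (jac (in_chart x c) u)^T *m invmx (jac (in_chart x c) u *m (jac (in_chart x c) u)^T).

(** The first-order part of the Laplace-Beltrami operator, - g^ij Gamma^k_ij, minus the chart
    coordinates of the tangential part of x. *)
Definition drift (c : chart R m M) (u : 'rV[R]_m) : 'rV[R]_m :=
  \row_k (- (\sum_i \sum_j invmx (g c u) i j * christoffel g c k i j u)
          - (in_chart x c u *m frame_mx c u) 0 k).

Lemma shrinker_smooth c : atlas c -> smooth_on (chart_cod c) (in_chart x c).
Proof. by move=> Ac; have [_ [[S _] _] _] := hx; exact: (S c Ac). Qed.

Lemma shrinker_free c u : atlas c -> chart_cod c u -> row_free (jac (in_chart x c) u).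
Proof. by move=> Ac cu; have [_ [[_ F] _] _] := hx; exact: (F c u Ac cu). Qed.

Lemma shrinker_gram c u : atlas c -> chart_cod c u ->
  g c u = jac (in_chart x c) u *m (jac (in_chart x c) u)^T.
Proof. by have [_ [_ mp] _] := hx; exact: metric_preserving_gram. Qed.

Lemma smooth_frame c : atlas c -> smooth_on (chart_cod c) (frame_mx c).
Proof.
move=> Ac r; have oU := chart_cod_open Ac.
have HJ := Cr_jac oU (shrinker_smooth Ac r.+1).
apply: Cr_mulmx; [exact: oU|exact: Cr_trmx|].
apply: Cr_invmx; [exact: oU| |apply: Cr_mulmx; [exact: oU|exact: HJ|exact: Cr_trmx]].
by move=> u cu; apply: gram_unitmx; exact: shrinker_free.
Qed.

Lemma Cr_drift c : atlas c -> Cr 0 (chart_cod c) (drift c).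
Proof.
move=> Ac; have oU := chart_cod_open Ac.
have Hg r i j : Cr r (chart_cod c) (fun u => g c u i j).
  exact: ((Cr_mxP _ _ oU).1 (gram_smooth g Ac r)).
have Hpd i j k : Cr 0 (chart_cod c) (pd i (fun w => g c w j k)).
  exact: (Cr_derive _ (Hg 1%N j k)).
have Hi i j : Cr 0 (chart_cod c) (fun u => invmx (g c u) i j).
  apply: (Cr_mxP _ _ oU).1; apply: Cr_invmx; [exact: oU| |exact: gram_smooth].
  by move=> u cu; rewrite shrinker_gram //; apply: gram_unitmx; exact: shrinker_free.
apply: (Cr_mxP _ _ oU).2 => i k; under eq_fun do rewrite mxE.
apply: CrB; [exact: oU| |]; last first.
  apply: ((Cr_mxP _ _ oU).1 _ 0 k); apply: Cr_mulmx; [exact: oU| |exact: smooth_frame].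
  exact: shrinker_smooth.
apply: CrN; first exact: oU.
apply: Cr_sum; [exact: oU|move=> a _]; apply: Cr_sum; [exact: oU|move=> b _].
apply: CrM; [exact: oU|exact: Hi|].
apply: CrM; [exact: oU|exact: Cr_cst|].
apply: Cr_sum; [exact: oU|move=> l _]; apply: CrM; [exact: oU|exact: Hi|].
apply: CrB; [exact: oU| |exact: Hpd].
apply: CrD; [exact: oU|exact: Hpd|exact: Hpd].
Qed.

(* The self-shrinker equation in a chart: the position vector is an
   eigenfunction of the drift Laplacian. *)
Lemma drift_laplacian_position c u a : atlas c -> chart_cod c u ->
  ell_op (frame_mx c u) (drift c u) (fun w => in_chart x c w 0 a) u = - in_chart x c u 0 a.
Proof.
move=> Ac cu; have oU := chart_cod_open Ac; have Jf := shrinker_free Ac cu.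
have HX r : Cr r (chart_cod c) (fun w => in_chart x c w 0 a).
  exact: ((Cr_mxP _ _ oU).1 (shrinker_smooth Ac r)).
rewrite (ell_opE _ _ oU (HX 2%N) cu) (frame_gram Jf) -(shrinker_gram Ac cu).
have [_ _ /(_ c u Ac cu)/rowP/(_ a)] := hx.
set X := in_chart x c; set K := invmx (g c u).
have JE k : jac X u k a = pd k (fun w => X w 0 a) u.
  by rewrite jacE //; exact: (Cr_derivable (shrinker_smooth Ac 1%N)).
(* Coordinate by coordinate, H is the Laplace-Beltrami operator applied to x: after exchanging the
   sums, the Christoffel terms are the first half of [drift]. *)
have -> : (- mean_curvature g x c u) 0 a = - (\sum_i \sum_j K i j * pd i (pd j (fun w => X w 0 a)) u
   - \sum_k (\sum_i \sum_j K i j * christoffel g c k i j u) * pd k (fun w => X w 0 a) u).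
  rewrite mxE; congr (- _); rewrite /mean_curvature summxE.
  transitivity (\sum_i \sum_j (K i j * pd i (pd j (fun w => X w 0 a)) u
     - K i j * \sum_k christoffel g c k i j u * pd k (fun w => X w 0 a) u)).
    apply: eq_bigr => i _; rewrite summxE; apply: eq_bigr => j _.
    rewrite mxE -mulrBr; congr (_ * _); rewrite !mxE (pd_coord2 _ _ _ oU (shrinker_smooth Ac 2%N) cu) summxE.
    congr (_ - _); apply: eq_bigr => k _; rewrite mxE -JE jac_mxE //.
  under eq_bigr do rewrite sumrB; rewrite sumrB; congr (_ - _).
  transitivity (\sum_i \sum_j \sum_k K i j * christoffel g c k i j u * pd k (fun w => X w 0 a) u).
    by apply: eq_bigr => i _; apply: eq_bigr => j _; rewrite mulr_sumr; apply: eq_bigr => k _; rewrite mulrA.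
  under eq_bigr do rewrite exchange_big /=; rewrite exchange_big /=.
  by apply: eq_bigr => k _; rewrite mulr_suml; apply: eq_bigr => i _; rewrite mulr_suml.
have -> : normal_part (jac X u) (X u) 0 a = X u 0 a - \sum_k (X u *m frame_mx c u) 0 k * pd k (fun w => X w 0 a) u.
  rewrite /normal_part mxE [in LHS](_ : X u *m _ *m _ *m _ = (X u *m frame_mx c u) *m jac X u); last by rewrite /frame_mx !mulmxA.
  by congr (_ + _); rewrite mxE; congr (- _); rewrite mxE; apply: eq_bigr => k _; rewrite JE.
have -> : \sum_k drift c u 0 k * pd k (fun w => X w 0 a) u =
   - (\sum_k (\sum_i \sum_j K i j * christoffel g c k i j u) * pd k (fun w => X w 0 a) u)
   - \sum_k (X u *m frame_mx c u) 0 k * pd k (fun w => X w 0 a) u.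
  by rewrite -sumrN -sumrB; apply: eq_bigr => k _; rewrite mxE mulrDl !mulNr.
lra.
Qed.

(** In a chart the zero set is open by [strong_maximum], its complement is open by continuity, and
    Sigma is connected. *)
Lemma shrinker_strong_maximum (w : M -> R) (p0 : M) :
  (forall c, atlas c -> Cr 2 (chart_cod c) (w \o chart_inv c)) -> (forall p, w p <= 0) ->
  (forall c u, atlas c -> chart_cod c u ->
     0 <= ell_op (frame_mx c u) (drift c u) (w \o chart_inv c) u) ->
  w p0 = 0 -> forall p, w p = 0.
Proof.
move=> Hw w_le0 Lw wp0 p.
have [conM _ _] := hx.
apply: (connected_locally_constant conM (P := fun p => w p = 0) _ (a := p0) (b := p)) => // t _.
pose c := chart_at t; have Ac : atlas c := chart_at_atlas t; have dt : chart_dom c t := chart_at_dom t.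
have oU := chart_cod_open Ac; have ct := chart_dom_cod dt.
have [wt|/eqP wt] := eqVneq (w t) 0.
  have JB u : chart_cod c u -> jac (in_chart x c) u *m frame_mx c u = 1%:M.
    by move=> cu; apply: frame_right_inverse; exact: shrinker_free.
  have := strong_maximum oU (Hw c Ac) (smooth_frame Ac 0%N) (Cr_drift Ac) JB
    (fun u _ => w_le0 _) (fun u cu => Lw c u Ac cu) ct.
  rewrite /= chartK // => /(_ wt) nz.
  by apply: nbhsS (chart_nbhs Ac dt nz) => t' [dt' /=]; rewrite chartK // => -> _; rewrite wt.
have cw := (continuous_dist (w \o chart_inv c) (c t)).1 (Cr_cont (Hw c Ac) ct) `|w t|.
have w0 : 0 < `|w t| by rewrite normr_gt0; exact/eqP.
apply: nbhsS (chart_nbhs Ac dt (cw w0)) => t' [dt' /=]; rewrite !chartK // => H _; split=> // w'.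
by move: H; rewrite w' subr0 ltxx.
Qed.

End Shrinker.

Section Confinement.
Context {R : realType} {m : nat} {M : manifold R m}.
Variables (g : riemannian_metric M) (x : M -> 'rV[R]_m.+1).
Hypothesis hx : self_shrinker g x.

Definition head_sqr k (y : 'rV[R]_m.+1) : R := \sum_(i < m.+1 | (i <= k)%N) y 0 i ^+ 2.

Lemma head_sqr_ge0 k (y : 'rV[R]_m.+1) : 0 <= head_sqr k y.
Proof. by apply: sumr_ge0 => i _; exact: sqr_ge0. Qed.

Lemma head_normE k (y : 'rV[R]_m.+1) (r : R) : 0 <= r -> head_norm k y = r <-> head_sqr k y = r ^+ 2.
Proof.
move=> r0; rewrite /head_norm -/(head_sqr k y); split=> [<-|->].
  by rewrite sqr_sqrtr ?head_sqr_ge0.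
by rewrite sqrtr_sqr ger0_norm.
Qed.

Lemma head_norm_le k (y : 'rV[R]_m.+1) (r : R) : 0 <= r -> head_norm k y <= r -> head_sqr k y <= r ^+ 2.
Proof.
move=> r0 H; rewrite -(sqr_sqrtr (head_sqr_ge0 k y)) ler_pXn2r // ?nnegrE ?sqrtr_ge0 //.
Qed.

Lemma Cr_coord_in_chart c a r : atlas c -> Cr r (chart_cod c) (fun w => in_chart x c w 0 a).
Proof. move=> Ac; exact: ((Cr_mxP _ _ (chart_cod_open Ac)).1 (shrinker_smooth hx Ac r)). Qed.

Lemma Cr_head c k s : atlas c -> Cr 2 (chart_cod c) ((fun p => head_sqr k (x p) - s) \o chart_inv c).
Proof.
move=> Ac; have oU := chart_cod_open Ac.
apply: CrB; [exact: oU| |exact: Cr_cst].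
apply: Cr_sum; [exact: oU|move=> i _]; under eq_fun do rewrite expr2.
by apply: CrM; [exact: oU| |]; exact: Cr_coord_in_chart.
Qed.

Lemma drift_laplacian_head c u k s : atlas c -> chart_cod c u ->
  ell_op (frame_mx x c u) (drift g x c u) ((fun p => head_sqr k (x p) - s) \o chart_inv c) u =
  2 * (\sum_(a < m.+1 | (a <= k)%N) (frame_mx x c u *m jac (in_chart x c) u) a a
       - head_sqr k (in_chart x c u)).
Proof.
move=> Ac cu; have oU := chart_cod_open Ac.
(* Indicator weights and a multiple of the constant 1 put the function in the form handled by the
   linearity lemmas. *)
have -> : (fun p => head_sqr k (x p) - s) \o chart_inv c =
   (fun w => (\sum_(i < m.+1) (i <= k)%N%:R * (in_chart x c w 0 i * in_chart x c w 0 i)) + (- s) * 1).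
  apply/funext => w /=; rewrite mulr1 /head_sqr [in LHS]big_mkcond /=; congr (_ - _).
  by apply: eq_bigr => i _; case: ifP => _; rewrite ?mul1r ?mul0r ?expr2.
have HX a : Cr 2 (chart_cod c) (fun w => in_chart x c w 0 a * in_chart x c w 0 a).
  by apply: CrM; [exact: oU| |]; exact: Cr_coord_in_chart.
rewrite (ell_op_comb _ _ _ oU _ (Cr_cst _ _ _) cu); last first.
  apply: Cr_sum; [exact: oU|move=> i _]; apply: CrM; [exact: oU|exact: Cr_cst|exact: HX].
rewrite ell_op_cst mulr0 addr0 (ell_op_lincomb _ _ _ _ oU HX cu).
rewrite /head_sqr -sumrB mulr_sumr [in RHS]big_mkcond; apply: eq_bigr => a _ /=.
case: ifP => _; last by rewrite mul0r.
rewrite mul1r (ell_op_sqr _ _ oU (Cr_coord_in_chart a 2 Ac) cu) (drift_laplacian_position hx a Ac cu).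
have Jf := shrinker_free hx Ac cu.
have -> : \sum_l ('D_(row l (frame_mx x c u)) (fun w => in_chart x c w 0 a) u) ^+ 2 =
    (frame_mx x c u *m jac (in_chart x c) u) a a.
  rewrite /frame_mx -(proj_diag_sum Jf); apply: eq_bigr => l _; congr (_ ^+ 2).
  rewrite (C1_differentiable oU (Cr_coord_in_chart a 1 Ac) cu).2 mxE; apply: eq_bigr => i _.
  rewrite jacE; first by rewrite mxE.
  exact: (Cr_derivable (shrinker_smooth hx Ac 1%N)).
by congr (2 * _); rewrite mulrN addrC expr2.
Qed.

Lemma shrinker_in_hyperplane (D : set 'rV[R]_m.+1) (r : R) : cylinder_domain 0 r D ->
  range x `<=` D -> range x `&` [set y | y 0 0 = 0] !=set0 -> forall p, x p 0 0 = 0.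
Proof.
move=> hD hxD [_ [[p0 _ <-] /= p00]] p.
(* The sign e makes the height nonpositive on either half-space; then L (e x_0) = - e x_0 >= 0. *)
have [e [e2 He]] : exists e : R, e * e = 1 /\ forall p, e * x p 0 0 <= 0.
  case: hD => E; [exists (-1)|exists 1]; split; rewrite ?mulrNN ?mulr1 // => q.
    by have := hxD (x q); rewrite E /= mulN1r oppr_le0; apply; exists q.
  by have := hxD (x q); rewrite E /= mul1r; apply; exists q.
suff H : e * x p 0 0 = 0 by rewrite -[LHS]mul1r -e2 -mulrA H mulr0.
have hw c : (fun p => e * x p 0 0) \o chart_inv c = (fun w => 0 + e * in_chart x c w 0 0).
  by apply/funext => w /=; rewrite add0r.
apply: (shrinker_strong_maximum hx (w := fun p => e * x p 0 0) (p0 := p0)) => [c Ac|//|c u Ac cu|].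
- rewrite hw; have oU := chart_cod_open Ac.
  apply: CrD; [exact: oU|exact: Cr_cst|apply: CrM; [exact: oU|exact: Cr_cst|exact: Cr_coord_in_chart]].
- rewrite hw (ell_op_comb _ _ _ (chart_cod_open Ac) (Cr_cst _ _ _) (Cr_coord_in_chart 0 2 Ac) cu).
  rewrite ell_op_cst add0r (drift_laplacian_position hx 0 Ac cu) mulrN oppr_ge0.
  exact: He.
- by rewrite p00 mulr0.
Qed.

Lemma touching_radius_ge (k : nat) (r : R) (p0 : M) : (k <= m)%N ->
  (forall p, head_sqr k (x p) <= r ^+ 2) -> head_sqr k (x p0) = r ^+ 2 -> k%:R <= r ^+ 2.
Proof.
move=> km hle E.
pose c := chart_at p0; have Ac : atlas c := chart_at_atlas p0; have dp : chart_dom c p0 := chart_at_dom p0.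
have cp := chart_dom_cod dp.
have := @ell_op_max R m _ (frame_mx x c (c p0)) (drift g x c (c p0)) _ _ _ (chart_cod_open Ac) (Cr_head k (r ^+ 2) Ac) cp.
rewrite (drift_laplacian_head k (r ^+ 2) Ac cp) /in_chart /= chartK // E.
have := proj_head_ge (shrinker_free hx Ac cp) km; rewrite -/(frame_mx x c (c p0)) => H1 H2.
have H3 : nbhs (c p0) [set y | head_sqr k (x (chart_inv c y)) - r ^+ 2 <= r ^+ 2 - r ^+ 2].
  by apply: filterE => y /=; rewrite lerB.
by have := H2 H3; lra.
Qed.

Definition head_part k (y : 'rV[R]_m.+1) : 'rV[R]_m.+1 :=
  \row_a (if (a <= k)%N then y 0 a else 0).

Lemma dot_head_part k (y z : 'rV[R]_m.+1) :
  dot y (head_part k z) = \sum_(a < m.+1 | (a <= k)%N) y 0 a * z 0 a.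
Proof.
rewrite dotE [RHS]big_mkcond; apply: eq_bigr => a _; rewrite mxE.
by case: ifP => _; rewrite ?mulr0.
Qed.

Lemma dot_head_sqr k (y : 'rV[R]_m.+1) : dot y (head_part k y) = head_sqr k y.
Proof. by rewrite dot_head_part; apply: eq_bigr => a _; rewrite expr2. Qed.

Lemma dot_head_head k (y z : 'rV[R]_m.+1) : dot (head_part k y) (head_part k z) = dot y (head_part k z).
Proof.
rewrite !dot_head_part; apply: eq_bigr => a ak; by rewrite mxE ak.
Qed.

(** First-order condition at a maximum of |y'|^2: its gradient is twice the tangential part of y'.
    It is also applied when Sigma lies in the cylinder, where every point is a maximum. *)
Lemma touching_tangent (k : nat) (s : R) (p0 : M) c : atlas c -> chart_dom c p0 ->
  (forall p, head_sqr k (x p) <= s) -> head_sqr k (x p0) = s ->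
  jac (in_chart x c) (c p0) *m (head_part k (x p0))^T = 0.
Proof.
move=> Ac dp hle E.
have cp := chart_dom_cod dp; have oU := chart_cod_open Ac.
set u := c p0 in cp *.
have xu : in_chart x c u = x p0 by rewrite /in_chart /= chartK.
set J := jac (in_chart x c) u.
apply/matrixP => i j; rewrite ord1 [RHS]mxE.
have [D0 _] : 'D_(delta_mx 0 i) ((fun p => head_sqr k (x p) - s) \o chart_inv c) u = 0 /\
  'D_(delta_mx 0 i) ('D_(delta_mx 0 i) ((fun p => head_sqr k (x p) - s) \o chart_inv c)) u <= 0.
  apply: (max_derivatives oU (Cr_head k s Ac) cp).
    exact: (Cr_cont (@Cr_affine R 1 m 0 setT u _ openT) I).
  by apply: filterE => y /=; rewrite -/(in_chart x c u) chartK // E lerB.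
have HE : (fun p => head_sqr k (x p) - s) \o chart_inv c =
  (fun w => \sum_(a < m.+1) (a <= k)%N%:R * (in_chart x c w 0 a * in_chart x c w 0 a) + (- s) * 1).
  apply/funext => w /=; rewrite mulr1 /head_sqr [in LHS]big_mkcond /=; congr (_ - _).
  by apply: eq_bigr => a _; case: ifP => _; rewrite ?mul1r ?mul0r ?expr2.
have HD (a : 'I_m.+1) : is_derive u (delta_mx 0 i) (fun w => in_chart x c w 0 a * in_chart x c w 0 a) (2 * (x p0 0 a * J i a)).
  have da : is_derive u (delta_mx 0 i) (fun w => in_chart x c w 0 a) (J i a).
    rewrite /J jacE; first by apply: derivableP; exact: (Cr_derivable (Cr_coord_in_chart a 1 Ac)).
    exact: (Cr_derivable (shrinker_smooth hx Ac 1%N)).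
  apply: (is_derive_eq (is_deriveM da da)).
  by rewrite -[LHS]/(in_chart x c u 0 a * J i a + in_chart x c u 0 a * J i a) xu; ring.
have HL := is_derive_lincomb (index_enum 'I_m.+1) (fun a => (a <= k)%N%:R) HD.
have [_ HL'] := is_deriveD HL (is_deriveZ (- s) (is_derive_cst (1 : R) u (delta_mx 0 i))).
have : 2 * \sum_a J i a * (head_part k (x p0)) 0 a = 0.
  rewrite -[RHS]D0 HE; apply: esym; apply: (etrans HL').
  rewrite -[LHS]/(\sum_(a < m.+1) (a <= k)%N%:R * (2 * (x p0 0 a * J i a)) + (- s) * 0).
  rewrite mulr0 addr0 mulr_sumr; apply: eq_bigr => a _; rewrite [head_part k _ 0 a]mxE.
  case: ifP => _; last by rewrite mul0r !mulr0.
  by rewrite mul1r [J i a * _]mulrC.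
move/eqP; rewrite mulf_eq0 pnatr_eq0 /= => /eqP E0; rewrite mxE -[RHS]E0.
by apply: eq_bigr => a _; rewrite [(head_part k _)^T _ _]mxE.
Qed.

(* At p0 the head part of x is normal, hence r^2 = <x, y'> = - <H, y'>. *)
Lemma touching_radius_le (k : nat) (r : R) (p0 : M) : 0 < r ->
  (forall c u, atlas c -> chart_cod c u -> enorm (mean_curvature g x c u) <= Num.sqrt k%:R) ->
  (forall p, head_sqr k (x p) <= r ^+ 2) -> head_sqr k (x p0) = r ^+ 2 -> r <= Num.sqrt k%:R.
Proof.
move=> r0 hH hle E.
pose c := chart_at p0; have Ac : atlas c := chart_at_atlas p0; have dp : chart_dom c p0 := chart_at_dom p0.
have cp := chart_dom_cod dp.
set X' := head_part k (x p0).
have [_ _ /(_ c _ Ac cp)] := hx; rewrite {2}/in_chart /= chartK // => EH.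
have := Cauchy_Schwarz (- mean_curvature g x c (c p0)) X'.
have -> : dot (- mean_curvature g x c (c p0)) X' = r ^+ 2.
  rewrite -EH /normal_part dotDl dot_head_sqr E dotNl /dot -!mulmxA.
  by rewrite (touching_tangent Ac dp hle E) !mulmx0 mxE subr0.
have -> : enorm X' = r by rewrite /enorm dot_head_head dot_head_sqr E sqrtr_sqr gtr0_norm.
by rewrite enormN expr2 ler_pM2r // => /le_trans; apply; exact: hH.
Qed.

Lemma shrinker_in_cylinder (k : nat) (r : R) (D : set 'rV[R]_m.+1) : (k <= m)%N -> 0 < r ->
  (forall c u, atlas c -> chart_cod c u -> enorm (mean_curvature g x c u) <= Num.sqrt k%:R) ->
  cylinder_domain k r D -> range x `<=` D -> range x `&` cylinder k r !=set0 ->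
  ((0 < k)%N -> r = Num.sqrt k%:R) /\ forall p, cylinder k (Num.sqrt k%:R) (x p).
Proof.
case: k => [|k] km r0 hH hD hxD htouch.
  by split=> // p; exact: (shrinker_in_hyperplane hD hxD htouch).
case: htouch => _ [[p0 _ <-] /= /(head_normE _ _ (ltW r0)) E].
have hle p : head_sqr k.+1 (x p) <= r ^+ 2.
  apply: head_norm_le; first exact: ltW.
  by have := hxD (x p); rewrite hD /=; apply; exists p.
have r2 : r ^+ 2 = k.+1%:R.
  apply/eqP; rewrite eq_le (touching_radius_ge km hle E) andbT.
  rewrite -[leRHS](@sqr_sqrtr R) ?ler0n // ler_pXn2r // ?nnegrE ?sqrtr_ge0 ?(ltW r0) //.
  exact: touching_radius_le r0 hH hle E.
have rE : r = Num.sqrt k.+1%:R by rewrite -r2 sqrtr_sqr gtr0_norm.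
split=> // p /=; rewrite -rE; apply/(head_normE _ _ (ltW r0))/eqP; rewrite -subr_eq0; apply/eqP.
apply: (shrinker_strong_maximum hx (w := fun p => head_sqr k.+1 (x p) - r ^+ 2) (p0 := p0)) => [c Ac|q|c u Ac cu|].
- exact: Cr_head.
- by rewrite subr_le0.
- rewrite (drift_laplacian_head _ _ Ac cu) mulr_ge0 // subr_ge0.
  apply: le_trans (proj_head_ge (shrinker_free hx Ac cu) km).
  by rewrite -r2; exact: hle.
- by rewrite E subrr.
Qed.

End Confinement.

Lemma open_preimage_on (T U : topologicalType) (O : set T) (V : set U) (f : T -> U) :
  open O -> (forall t, O t -> {for t, continuous f}) -> open V -> open (O `&` f @^-1` V).
Proof.
move=> oO cf oV; rewrite openE => t [Ot Vt].
apply: nbhsI; first exact: open_nbhs_nbhs.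
by apply: (cf t Ot V); exact: open_nbhs_nbhs.
Qed.

Lemma open_preimage (T U : topologicalType) (V : set U) (f : T -> U) :
  (forall t, {for t, continuous f}) -> open V -> open (f @^-1` V).
Proof. by move=> cf oV; rewrite -[_ @^-1` _]setTI; apply: open_preimage_on => //; exact: openT. Qed.

(** The orthogonal complement of a tangent space of dimension m in R^(m+1) is a line. *)
Lemma kernel_line (R : realType) (m : nat) (J : 'M[R]_(m, m.+1)) (nu w : 'rV[R]_m.+1) :
  row_free J -> nu != 0 -> J *m nu^T = 0 -> w *m J^T = 0 -> exists s, w = s *: nu.
Proof.
move=> Jf nu0 Jnu wJ.
have rk : \rank (kermx J^T) = 1%N.
  by rewrite mxrank_ker mxrank_tr (eqP Jf) subSnn.
have nuJ : (nu <= kermx J^T)%MS.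
  by apply/sub_kermxP; apply: trmx_inj; rewrite trmx_mul trmxK Jnu trmx0.
have : (kermx J^T <= nu)%MS.
  have := mxrank_leqif_sup nuJ => -[_ <-]; by rewrite rk rank_rV nu0.
have wk : (w <= kermx J^T)%MS by apply/sub_kermxP.
by move=> /(submx_trans wk) /sub_rVP.
Qed.

(** * Local isometries from complete manifolds *)

Section LocalSections.
Context {R : realType} {m : nat} {M : manifold R m}.

(** [G] lives on an open set of the ambient space, so its smoothness involves no structure on [C];
    [N] is the sheet through [p]. The inverse property [ls_right] is asked only at points of [C]. *)
Record local_section (x : M -> 'rV[R]_m.+1) (C : set 'rV[R]_m.+1) (p : M)
    (N : set M) (O : set 'rV[R]_m.+1) (G : 'rV[R]_m.+1 -> M) : Prop := {
  ls_openN : open N;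
  ls_N : N p;
  ls_openO : open O;
  ls_smooth : smooth_into O G;
  ls_left : forall p', N p' -> O (x p') /\ G (x p') = p';
  ls_right : forall y, O y -> C y -> N (G y) /\ x (G y) = y }.

Lemma chart_overlap_open (c d : chart R m M) : atlas c -> atlas d ->
  open (c @` (chart_dom c `&` chart_dom d)).
Proof.
move=> Ac Ad.
have -> : c @` (chart_dom c `&` chart_dom d) = chart_cod c `&` (chart_inv c) @^-1` (chart_dom d).
  apply/seteqP; split=> [_ [p [cp dp] <-]|u [cu du]].
    by split; [exact: chart_dom_cod|rewrite /= chartK].
  have [ci cE] := chart_inv_cod Ac cu.
  by exists (chart_inv c u).
apply: open_preimage_on; first exact: chart_cod_open.
  by have [_ _ _ _] := atlas_chart Ac.
by have [] := atlas_chart Ad.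
Qed.

(* The component of the position along the tangent space at p is a chart of
   M near p; its inverse, read on C, is the section. *)
Lemma local_section_exists (x : M -> 'rV[R]_m.+1) (C : set 'rV[R]_m.+1) (p : M) (c : chart R m M)
    (nu : 'rV[R]_m.+1) (O1 : set 'rV[R]_m.+1) :
  smooth_map x -> (forall q, C (x q)) -> atlas c -> chart_dom c p ->
  row_free (jac (in_chart x c) (c p)) -> nu != 0 -> jac (in_chart x c) (c p) *m nu^T = 0 ->
  open O1 -> O1 (x p) -> (forall y z s, C y -> C z -> O1 y -> O1 z -> y - z = s *: nu -> y = z) ->
  exists N O G, local_section x C p N O G.
Proof.
move=> Sx xC Ac dp; set X := in_chart x c; set u0 := c p; set J := jac X u0.
move=> Jf nu0 Jnu oO1 O1p O1inj.
have oU := chart_cod_open Ac; have cu0 : chart_cod c u0 := chart_dom_cod dp.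
pose Phi u := X u *m J^T.
have SPhi : smooth_on (chart_cod c) Phi.
  by move=> r; apply: Cr_mulmx; [exact: oU|exact: Sx|exact: Cr_cst].
have jacPhi : jac Phi u0 = J *m J^T.
  apply/matrixP => i j; rewrite jacE; last exact: (Cr_derivable (SPhi 1%N)).
  have dX a : is_derive u0 (delta_mx 0 i) (fun w => X w 0 a) (J i a).
    rewrite /J jacE; last exact: (Cr_derivable (Sx c Ac 1%N)).
    by apply: derivableP; exact: (Cr_derivable ((Cr_mxP _ _ oU).1 (Sx c Ac 1%N) 0 a)).
  have [_ H] := is_derive_lincomb (index_enum 'I_m.+1) (fun a => J j a) dX.
  rewrite /pd; transitivity ('D_(delta_mx 0 i) (fun z => \sum_a J j a * X z 0 a) u0).
    congr (derive _ _ _); apply/funext => w; rewrite mxE; apply: eq_bigr => a _.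
    by rewrite mxE mulrC.
  by rewrite H mxE; apply: eq_bigr => a _; rewrite [J^T _ _]mxE mulrC.
have uPhi : jac Phi u0 \in unitmx by rewrite jacPhi; exact: gram_unitmx.
have [N0 [V0 [h [[oN0 N0u N0U oV0] [Sh hN hO]]]]] := inverse_function oU SPhi cu0 uPhi.
pose theta y := h (y *m J^T).
pose G y := chart_inv c (theta y).
pose Opre := [set y : 'rV[R]_m.+1 | V0 (y *m J^T)].
have Spsi r (V : set 'rV[R]_m.+1) : open V -> Cr r V (fun y : 'rV[R]_m.+1 => y *m J^T).
  by move=> oV; apply: Cr_mulmx; [exact: oV|exact: Cr_id|exact: Cr_cst].
have oOpre : open Opre.
  apply: (open_preimage (f := fun y : 'rV[R]_m.+1 => y *m J^T) _ oV0).
  by move=> y; exact: (Cr_cont (Spsi 0%N setT openT) I).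
have Stheta r : Cr r Opre theta.
  by apply: (@Cr_comp R _ _ _ _ r Opre V0 h (fun y => y *m J^T) oOpre oV0 _ (Sh r)); [|exact: Spsi].
have thetaU y : Opre y -> chart_cod c (theta y).
  by move=> Oy; apply: N0U; have [] := hN _ Oy.
have cG y : Opre y -> {for y, continuous G}.
  move=> Oy; have [_ _ _ _ ci] := atlas_chart Ac.
  exact: (continuous_comp (Cr_cont (Stheta 0%N) Oy) (ci _ (thetaU _ Oy))).
have cx : continuous x := continuous_in_chart Sx.
(* Both [y] and [x (G y)] have to lie in [O1], where two points of [C] differing by a multiple of
   [nu] are equal. *)
pose O := (Opre `&` G @^-1` (x @^-1` O1)) `&` O1.
have oO : open O.
  by apply: openI => //; apply: (open_preimage_on oOpre cG); exact: open_preimage.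
have GE p' : chart_dom c p' -> N0 (c p') -> Opre (x p') /\ G (x p') = p'.
  move=> dp' Np'; have [OP hP] := hO _ Np'.
  have xE : x p' *m J^T = Phi (c p') by rewrite /Phi /X /in_chart /= chartK.
  by rewrite /Opre /G /theta /= xE hP chartK.
pose N := chart_dom c `&` c @^-1` N0 `&` x @^-1` O.
have odom : open (chart_dom c) by have [] := atlas_chart Ac.
exists N, O, G; split.
- apply: openI; last exact: open_preimage.
  by apply: open_preimage_on => //; have [_ _ _ cc _] := atlas_chart Ac.
- have [OP GP] := GE p dp N0u.
  by split; split=> //; split=> //=; rewrite GP.
- exact: oO.
- split=> [y [[Oy _] _]|d Ad r]; first exact: cG.
  have oV : open (O `&` G @^-1` chart_dom d).
    apply: open_preimage_on => //; first by move=> y [[Oy _] _]; exact: cG.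
    by have [] := atlas_chart Ad.
  have VO : O `&` G @^-1` chart_dom d `<=` Opre by move=> y [[[]]].
  apply: (Cr_comp oV (chart_overlap_open Ac Ad) _ (atlas_compat Ac Ad r) (Cr_subset VO (Stheta r))).
  move=> y Vy; have [ci cE] := chart_inv_cod Ac (thetaU _ (VO _ Vy)).
  by exists (G y) => //; split=> //; case: Vy.
- move=> p' [[dp' Np'] Op']; split=> //; exact: (GE _ dp' Np').2.
- move=> y [[Oy O1G] O1y] Cy.
  have [ci cE] := chart_inv_cod Ac (thetaU _ Oy).
  have [Nh Ph] := hN _ Oy.
  (* By construction [y] and [x (G y)] have the same tangential component, so they differ by a
     multiple of the normal [nu]. *)
  have xG : x (G y) = y.
    apply/esym; have : (y - x (G y)) *m J^T = 0.
      by rewrite mulmxBl; apply/eqP; rewrite subr_eq0 eq_sym -[X in _ == X]Ph.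
    move=> /(kernel_line Jf nu0 Jnu) [s Es].
    exact: O1inj Cy (xC _) O1y O1G Es.
  split=> //; split; last by rewrite /= xG.
  by split=> //=; rewrite cE.
Qed.

End LocalSections.

Section Calculus1D.
Context {R : realType}.

Lemma derivable_dir (V : normedModType R) (f : R -> V) (t v : R) : derivable f t 1 ->
  derivable f t v /\ 'D_v f t = v *: 'D_1 f t.
Proof.
move=> /derivable1_diffP df; split; first exact: diff_derivable.
by rewrite !deriveE // -{1}[v]mulr1 -[v * 1]/(v *: 1) linearZ.
Qed.

Lemma Cr1_real (V : normedModType R) (U : set R) (f : R -> V) : open U ->
  (forall t, U t -> derivable f t 1) -> (forall t, U t -> {for t, continuous ('D_1 f)}) -> Cr 1 U f.
Proof.
move=> oU df cf; apply: CrS.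
  by move=> t Ut; apply: differentiable_continuous; apply/derivable1_diffP; exact: df.
move=> v; split=> [t Ut|]; first exact: (derivable_dir v (df t Ut)).1.
have H : Cr 0 U (fun t => v *: 'D_1 f t).
  by apply: Cr0 => t Ut; exact: (cvgZl_tmp (k := v) (cf t Ut)).
by apply: (Cr_ext oU _ H) => t Ut; rewrite (derivable_dir v (df t Ut)).2.
Qed.

Lemma Cr1_line (V : normedModType R) (f : R -> V) (s e : R) : Cr 1 setT f ->
  Cr 1 setT (fun t : R => f (s + t * e)) /\
  forall t, 'D_1 (fun t : R => f (s + t * e)) t = e *: 'D_1 f (s + t * e).
Proof.
move=> Hf.
have df t : derivable f t 1 := Cr_derivable Hf I.
have line t : derivable (fun t : R => f (s + t * e)) t 1 /\
   'D_1 (fun t : R => f (s + t * e)) t = e *: 'D_1 f (s + t * e).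
  have [d1 d2] := derivable_dir e (df (s + t * e)).
  by have [l1 l2] := derivable_line d1; split=> //; rewrite -d2 -l2.
split=> [|t]; last exact: (line t).2.
apply: Cr1_real; [exact: openT|by move=> t _; exact: (line t).1|move=> t _].
have -> : 'D_1 (fun t : R => f (s + t * e)) = (fun t => e *: 'D_1 f (s + t * e)).
  by apply/funext => w; exact: (line w).2.
have c1 : {for t, continuous (fun t : R => s + t * e)}.
  apply: cvgD; first exact: cvg_cst.
  by apply: cvgMr_tmp; exact: cvg_id.
have c2 : {for s + t * e, continuous ('D_1 f)} := Cr_cont (Cr_derive (1 : R) Hf) I.
exact: (cvgZl_tmp (k := e) (continuous_comp c1 c2)).
Qed.

Lemma derive_comp_jac n p (E : normedModType R) (W : set 'rV[R]_n) (F : 'rV[R]_n -> 'rV[R]_p)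
   (s : E -> 'rV[R]_n) (u v : E) : open W -> Cr 1 W F -> W (s u) -> derivable s u v ->
  'D_v (F \o s) u = 'D_v s u *m jac F (s u).
Proof.
move=> oW HF Ws ds.
have HFa a := (Cr_mxP _ _ oW).1 HF 0 a.
have dFs : derivable (F \o s) u v.
  apply: (derivable_mxP (F \o s) u v).2 => i j.
  have := (derive_comp_C1 oW ((Cr_mxP _ _ oW).1 HF i j) Ws ds).1; exact.
apply/rowP => a; rewrite (derive_mx dFs) !mxE.
rewrite -[LHS]/('D_v ((fun y => F y 0 a) \o s) u) (derive_comp_C1 oW (HFa a) Ws ds).2.
by apply: eq_bigr => j _; rewrite (jacE a (Cr_derivable HF Ws)).
Qed.

End Calculus1D.

(** * Uniqueness and length of lifts *)

Section Lifts.
Context {R : realType} {m : nat} {M : manifold R m}.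
Variables (g : riemannian_metric M) (x : M -> 'rV[R]_m.+1) (C : set 'rV[R]_m.+1).
Hypotheses (Sx : smooth_map x) (mp : metric_preserving g x) (hg : complete_metric g).
Hypothesis xC : forall p, C (x p).
Hypothesis sec : forall p, exists N O G, local_section x C p N O G.

Lemma hausdorff_disjoint (p q : M) : p <> q ->
  exists A B, [/\ nbhs p A, nbhs q B & forall z, A z -> B z -> False].
Proof.
move=> pq; apply: contrapT => H; apply: pq; apply: (@manifold_hausdorff R m M) => A B nA nB.
apply: contrapT => AB; apply: H; exists A, B; split=> // z Az Bz; apply: AB; by exists z.
Qed.

(** Where two lifts meet they enter a common sheet, on which [x] is injective; where they differ,
    the Hausdorff property separates them. The source is any connected set: an interval, the line,
    or Sigma itself. *)
Lemma lift_unique (T : topologicalType) (A : set T) (l1 l2 : T -> M) a : connected A ->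
  (forall t, A t -> {for t, continuous l1}) -> (forall t, A t -> {for t, continuous l2}) ->
  (forall t, A t -> x (l1 t) = x (l2 t)) -> A a -> l1 a = l2 a ->
  forall b, A b -> l1 b = l2 b.
Proof.
move=> cA c1 c2 E Aa Ea b Ab.
apply: (connected_locally_constant cA (P := fun t => l1 t = l2 t) _ (a := a) (b := b)) => // t At.
have [Et|Et] := pselect (l1 t = l2 t).
  have [N [V' [G lsG]]] := sec (l1 t).
  have nN := open_nbhs_nbhs (conj (ls_openN lsG) (ls_N lsG)).
  have n1 := c1 t At _ nN; have n2 : nbhs t (l2 @^-1` N) by apply: (c2 t At); rewrite -Et.
  apply: (nbhsS2 _ n1 n2) => t' N1 N2 At'; split=> // _.
  by rewrite -(ls_left lsG N1).2 -(ls_left lsG N2).2 E.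
have [A1 [A2 [nA1 nA2 dis]]] := hausdorff_disjoint Et.
apply: (nbhsS2 _ (c1 t At _ nA1) (c2 t At _ nA2)) => t' N1 N2 At'; split=> // E'.
by exfalso; apply: (dis (l1 t')); rewrite // E'.
Qed.

Variable gamma : R -> 'rV[R]_m.+1.
Hypotheses (Cgamma : Cr 1 setT gamma) (gammaC : forall t, C (gamma t)).

Definition is_lift (l : R -> M) (a b : R) : Prop :=
  forall t, a < t < b -> {for t, continuous l} /\ x (l t) = gamma t.

Lemma itv_connected (a b : R) : connected [set t : R | a < t < b].
Proof.
apply/connected_intervalP => s t /andP[s1 s2] /andP[t1 t2] u /andP[u1 u2] /=.
by rewrite (lt_le_trans s1 u1) (le_lt_trans u2 t2).
Qed.

Lemma itv_open (a b : R) : open [set t : R | a < t < b].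
Proof.
have -> : [set t : R | a < t < b] = [set` `]a, b[] by apply/seteqP; split=> t /=; rewrite in_itv.
exact: interval_open.
Qed.

Lemma lift_unique_itv l1 l2 (a b s t : R) : is_lift l1 a b -> is_lift l2 a b ->
  a < s < b -> a < t < b -> l1 s = l2 s -> l1 t = l2 t.
Proof.
move=> H1 H2 As At E.
apply: (@lift_unique R _ l1 l2 s (@itv_connected a b)) => // u Au.
- exact: (H1 u Au).1.
- exact: (H2 u Au).1.
- by rewrite (H1 u Au).2 (H2 u Au).2.
Qed.

Section SubCurve.
Variables (l : R -> M) (a b s t : R).
Hypotheses (Hl : is_lift l a b) (abs : a < s < b) (abt : a < t < b).
(** The arc of the lift from [s] to [t], in either order, rescaled to [0, 1]; [par] is the open set
    of parameters that [C1_curve] asks for. *)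
Let sigma (tau : R) := l (s + tau * (t - s)).
Let par := [set tau : R | a < s + tau * (t - s) < b].

Let aff_cont (tau : R) : {for tau, continuous (fun tau : R => s + tau * (t - s))}.
Proof.
apply: cvgD; first exact: cvg_cst.
by apply: cvgMr_tmp; exact: cvg_id.
Qed.

Let openIv : open par.
Proof. exact: (open_preimage aff_cont (@itv_open a b)). Qed.

Let unitI (tau : R) : 0 <= tau <= 1 -> par tau.
Proof.
move: abs abt => /andP[? ?] /andP[? ?] /andP[? ?]; rewrite /par /=.
by apply/andP; split; have [st|/ltW st] := leP s t; nra.
Qed.

Let sigma_cont tau : par tau -> {for tau, continuous sigma}.
Proof. by move=> It; exact: (continuous_comp (@aff_cont tau) (Hl It).1). Qed.

(** Locally the lift is [G] composed with the curve below, so it inherits the regularity of that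
    curve. *)
Let sigma_C1 c : atlas c -> Cr 1 (par `&` sigma @^-1` chart_dom c) (chart_map c \o sigma).
Proof.
move=> Ac; apply: Cr_local => tau [It dt].
have [N [V' [G lsG]]] := sec (sigma tau).
have odom : open (chart_dom c) by have [] := atlas_chart Ac.
pose U' := par `&` sigma @^-1` (N `&` chart_dom c).
have oU' : open U'.
  by apply: (open_preimage_on openIv sigma_cont); exact: openI (ls_openN lsG) odom.
pose delta (tau : R) := gamma (s + tau * (t - s)).
have GE tau' : U' tau' -> V' (delta tau') /\ G (delta tau') = sigma tau'.
  by move=> [It' [Nt' _]]; have := ls_left lsG Nt'; rewrite (Hl It').2.
pose W := V' `&` G @^-1` chart_dom c.
have oW : open W by apply: (open_preimage_on (ls_openO lsG) (ls_smooth lsG).1 odom).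
exists U'; first by split=> //; split=> //; exact: ls_N lsG.
have UW tau' : U' tau' -> W (delta tau').
  by move=> Ut'; have [Od Gd] := GE _ Ut'; split=> //=; rewrite Gd; case: Ut' => _ [].
have Hd : Cr 1 U' delta := Cr_subset (@subsetT _ _) (Cr1_line s (t - s) Cgamma).1.
apply: (Cr_ext oU' _ (Cr_comp oU' oW UW ((ls_smooth lsG).2 c Ac 1%N) Hd)) => tau' Ut'.
by rewrite /= (GE _ Ut').2.
Qed.

Let sigma_C1_curve : C1_curve sigma.
Proof.
exists par; split; [exact: openIv| |exact: sigma_cont|exact: sigma_C1].
by move=> tau /=; rewrite in_itv /=; exact: unitI.
Qed.

(** Since [x] pulls the Euclidean metric back to [g], the lift moves at the speed of the curve it
    covers. *)
Let sigma_speed tau : par tau -> speed g sigma tau = `|t - s| * enorm ('D_1 gamma (s + tau * (t - s))).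
Proof.
move=> It; rewrite /speed; set c := chart_at (sigma tau).
have Ac : atlas c := chart_at_atlas _; have dc : chart_dom c (sigma tau) := chart_at_dom _.
have odom : open (chart_dom c) by have [] := atlas_chart Ac.
set v := 'D_1 _ tau.
have cc := chart_dom_cod dc.
rewrite (metric_preserving_gram mp Ac cc).
have dcs : derivable (chart_map c \o sigma) tau 1 := Cr_derivable (sigma_C1 Ac) (conj It dc).
have vJ : v *m jac (in_chart x c) (c (sigma tau)) = (t - s) *: 'D_1 gamma (s + tau * (t - s)).
  rewrite /v -(derive_comp_jac (chart_cod_open Ac) (Sx Ac 1%N) cc dcs).
  rewrite -(Cr1_line s (t - s) Cgamma).2; apply: near_eq_derive.
  have nI := open_nbhs_nbhs (conj openIv It).
  have nD := sigma_cont It (open_nbhs_nbhs (conj odom dc)).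
  apply: (nbhsS2 _ nI nD) => tau' It' Dt'.
  by rewrite /in_chart /= chartK // (Hl It').2.
by rewrite -enormZ -vJ /enorm /dot trmx_mul !mulmxA.
Qed.

Lemma lift_dist_le (K : R) : (forall u, a < u < b -> enorm ('D_1 gamma u) <= K) ->
  (riemannian_dist g (l s) (l t) <= (K * `|t - s|)%:E)%E.
Proof.
move=> HK.
have -> : l s = sigma 0 by rewrite /sigma mul0r addr0.
have -> : l t = sigma 1 by rewrite /sigma mul1r addrC subrK.
apply: (@le_trans _ _ (curve_length g sigma + 0)%E).
  by apply: ereal_inf_lbound; apply: pw_cons; [exact: sigma_C1_curve|exact: pw_nil].
rewrite adde0 /curve_length.
pose k (tau : R) := `|t - s| * enorm ('D_1 gamma (s + tau * (t - s))).
have ck : continuous k.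
  move=> tau.
  have c1 : {for tau, continuous (fun tau : R => 'D_1 gamma (s + tau * (t - s)))}.
    exact: (continuous_comp (@aff_cont tau) (Cr_cont (Cr_derive (1 : R) Cgamma) I)).
  have c2 : {for tau, continuous (fun tau : R => dot ('D_1 gamma (s + tau * (t - s))) ('D_1 gamma (s + tau * (t - s))))}.
    have H : Cr 0 setT (fun tau : R => 'D_1 gamma (s + tau * (t - s))).
      by apply: Cr0 => tau' _; exact: (continuous_comp (@aff_cont tau') (Cr_cont (Cr_derive (1 : R) Cgamma) I)).
    exact: (Cr_cont (Cr_dot openT H H) I).
  apply: cvgMl_tmp.
  exact: (continuous_comp c2 (@sqrt_continuous R _)).
have -> : (\int[lebesgue_measure]_(tau in `[0%R, 1%R]) (speed g sigma tau)%:E =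
  \int[lebesgue_measure]_(tau in `[0%R, 1%R]) (k tau)%:E)%E.
  apply: eq_integral => tau /set_mem /=; rewrite in_itv /= => /unitI It.
  by rewrite sigma_speed.
apply: (@le_trans _ _ (\int[lebesgue_measure]_(tau in `[0%R, 1%R]) (cst (K * `|t - s|)%:E) tau)%E).
  apply: ge0_le_integral => //.
  - by move=> tau _; rewrite lee_fin mulr_ge0 // enorm_ge0.
  - apply/measurable_EFinP; apply: measurable_funTS; exact: continuous_measurable_fun.
  - move=> tau /=; rewrite in_itv /= => /unitI It.
    by rewrite lee_fin /k mulrC ler_wpM2r //; exact: HK.
rewrite integral_cst //= lebesgue_measure_itv /= lte_fin ltr01.
by rewrite -EFinB subr0 mule1.
Qed.

End SubCurve.
End Lifts.

Lemma continuous_near_eq (T U : topologicalType) (f h : T -> U) t :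
  nbhs t [set t' | f t' = h t'] -> {for t, continuous f} -> {for t, continuous h}.
Proof.
move=> E cf P; rewrite -(nbhs_singleton E) => nP.
by apply: (nbhsS2 _ E (cf P nP)) => t' /= <-.
Qed.

(** * Lifting of C^1 paths *)

Section PathLifting.
Context {R : realType} {m : nat} {M : manifold R m}.
Variables (g : riemannian_metric M) (x : M -> 'rV[R]_m.+1) (C : set 'rV[R]_m.+1).
Hypotheses (Sx : smooth_map x) (mp : metric_preserving g x) (hg : complete_metric g).
Hypothesis sec : forall p, exists N O G, local_section x C p N O G.

(** The place where completeness enters: the speed is bounded on [a, b], so the lift is Lipschitz
    and sends a convergent sequence of times to a Cauchy sequence. *)
Lemma lift_limit (gamma : R -> 'rV[R]_m.+1) (l : R -> M) (a b : R) (s : nat -> R) :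
  Cr 1 setT gamma -> a < b -> is_lift x gamma l a b -> (forall n, a < s n < b) ->
  s @ \oo --> b -> exists p : M, (l \o s) @ \oo --> p.
Proof.
move=> Cg ab Hl sab sb; apply: hg => e e0.
have ck : {within `[a, b], continuous (fun u => enorm ('D_1 gamma u))}.
  apply: continuous_subspaceT => u.
  have H : Cr 0 setT ('D_1 gamma) := Cr_derive (1 : R) Cg.
  exact: (continuous_comp (Cr_cont (Cr_dot openT H H) (u := u) I) (@sqrt_continuous R _)).
have [u0 _ HK] := EVT_max (ltW ab) ck.
pose K := enorm ('D_1 gamma u0) + 1.
have K0 : 0 < K by rewrite ltr_wpDl ?enorm_ge0.
have eK : 0 < e / (2 * K) by rewrite divr_gt0 // mulr_gt0.
have /cvgrPdist_lt/(_ _ eK) [N _ HN] := sb.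
exists N => i j iN jN.
have HK' u : a < u < b -> enorm ('D_1 gamma u) <= K.
  move=> /andP[au ub]; apply: (@le_trans _ _ (enorm ('D_1 gamma u0))).
    by apply: HK; rewrite in_itv /= !ltW.
  by rewrite /K lerDl.
apply: le_lt_trans (lift_dist_le Sx mp sec Cg Hl (sab i) (sab j) HK') _.
rewrite lte_fin -ltr_pdivlMl // mulrC.
have := HN i iN; have := HN j jN; rewrite /= invfM.
rewrite !ltr_norml => /andP[? ?] /andP[? ?].
have -> : e / K = e * (2^-1 / K) + e * (2^-1 / K) by field; rewrite gt_eqF.
by apply/andP; split; lra.
Qed.

Lemma approaching_sequence (a b : R) : a < b ->
  exists s : nat -> R, (forall n, a < s n < b) /\ s @ \oo --> b.
Proof.
move=> ab; exists (fun n => b - (b - a) / 2 * harmonic n); split=> [n|].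
  have h1 : harmonic n <= (1 : R) by rewrite /harmonic invf_le1 ?ler1n // ltr0n.
  have h0 : 0 < harmonic n :> R by rewrite /harmonic invr_gt0 ltr0n.
  by apply/andP; split; nra.
rewrite -[X in _ --> X]subr0; apply: cvgB; first exact: cvg_cst.
rewrite -(mulr0 ((b - a) / 2)); apply: cvgMl_tmp; exact: cvg_harmonic.
Qed.

(** The limit point p lies over [gamma b]. The section through p continues the lift beyond b, and
    both agree before b because the lift enters the sheet of p at some time s n. *)
Lemma lift_extend_right (gamma : R -> 'rV[R]_m.+1) (l : R -> M) (a b : R) :
  Cr 1 setT gamma -> (forall t, C (gamma t)) -> a < b -> is_lift x gamma l a b ->
  exists b' l', [/\ b < b', is_lift x gamma l' a b' & forall t, a < t < b -> l' t = l t].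
Proof.
move=> Cg gC ab Hl.
have cg t : {for t, continuous gamma} := Cr_cont Cg I.
have [s [sab sb]] := approaching_sequence ab.
have [p lp] := lift_limit Cg ab Hl sab sb.
have cx := continuous_in_chart Sx.
have xp : x p = gamma b.
  have c1 : (x \o (l \o s)) @ \oo --> x p by exact: (cvg_comp _ _ lp (cx p)).
  have c2 : (gamma \o s) @ \oo --> gamma b by exact: (cvg_comp _ _ sb (cg b)).
  have E : x \o (l \o s) = gamma \o s by apply/funext => n /=; rewrite (Hl _ (sab n)).2.
  rewrite E in c1; exact: (cvg_unique _ c1 c2).
have [N [V [G ls]]] := sec p.
have Vb : nbhs (gamma b) V.
  by rewrite -xp; apply: open_nbhs_nbhs; split; [exact: ls_openO ls|exact: (ls_left ls (ls_N ls)).1].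
have /nbhs_ballP[d /= d0 Hd] := cg b V Vb.
have GV t : b - d < t < b + d -> V (gamma t).
  move=> /andP[t1 t2]; apply: Hd; rewrite -ball_normE /= ltr_norml; apply/andP; split; lra.
have GL : is_lift x (gamma) (G \o gamma) (b - d) (b + d).
  move=> t /GV Vt; split; last exact: (ls_right ls Vt (gC t)).2.
  exact: (continuous_comp (cg t) ((ls_smooth ls).1 _ Vt)).
have nN : \forall n \near \oo, N (l (s n)).
  by apply: lp; apply: open_nbhs_nbhs; split; [exact: ls_openN ls|exact: ls_N ls].
have nd : \forall n \near \oo, b - d < s n.
  have /cvgrPdist_lt/(_ _ d0) := sb; apply: filterS => n; rewrite ltr_norml => /andP[_]; lra.
have [n [Nn dn]] := filter_ex (filterI nN nd).
(* From [a1] on, both the old lift and the one given by the section are defined. *)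
pose a1 := Num.max a (b - d).
have a1a : a <= a1 by rewrite le_max lexx.
have a1b : b - d <= a1 by rewrite le_max lexx orbT.
have a1lt u : a < u -> b - d < u -> a1 < u by rewrite gt_max => -> ->.
have agree t : a1 < t < b -> l t = G (gamma t).
  move=> /andP[t1 t2]; have /andP[sn1 sn2] := sab n.
  apply: (lift_unique_itv (a := a1) (b := b) (s := s n) sec _ _ _ _ _ (l2 := G \o gamma)).
  - by move=> u /andP[u1 u2]; apply: Hl; rewrite u2 (le_lt_trans a1a u1).
  - move=> u /andP[u1 u2]; apply: GL; rewrite (le_lt_trans a1b u1) /=; lra.
  - by rewrite sn2 andbT; exact: a1lt.
  - by rewrite t1.
  - by have := (ls_left ls Nn).2; rewrite /= (Hl _ (sab n)).2 => ->.
pose l' t := if t < b then l t else G (gamma t).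
have l'l t : t < b -> l' t = l t by rewrite /l' => ->.
have l'G t : a1 < t -> l' t = G (gamma t).
  by rewrite /l'; case: ifP => // tb t1; apply: agree; rewrite t1.
exists (b + d), l'; split; first by rewrite ltrDl.
  move=> t /andP[t1 t2]; have [tb|bt] := ltP t b.
    have atb : a < t < b by rewrite t1.
    rewrite l'l // (Hl _ atb).2; split=> //.
    apply: (continuous_near_eq (f := l) _ (Hl _ atb).1).
    apply: nbhsS (open_nbhs_nbhs (conj (@itv_open _ a b) atb)) => u /andP[_ ub].
    by rewrite /= l'l.
  have tG : b - d < t < b + d by rewrite t2 andbT; lra.
  have ta1 : a1 < t < b + d by rewrite t2 andbT; apply: a1lt => //; lra.
  rewrite l'G; last by case/andP: ta1.
  split; last exact: (GL _ tG).2.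
  apply: (continuous_near_eq (f := G \o gamma) _ (GL _ tG).1).
  apply: nbhsS (open_nbhs_nbhs (conj (@itv_open _ a1 (b + d)) ta1)) => u /andP[u1 _].
  by rewrite /= l'G.
by move=> t /andP[_ tb]; exact: l'l.
Qed.

Lemma Cr1_opp (gamma : R -> 'rV[R]_m.+1) : Cr 1 setT gamma -> Cr 1 setT (fun t => gamma (- t)).
Proof.
move=> Cg; have := (Cr1_line 0 (-1) Cg).1.
by have -> : (fun t : R => gamma (0 + t * -1)) = (fun t => gamma (- t)) by apply/funext => t; rewrite add0r mulrN1.
Qed.

Lemma is_lift_opp (gamma : R -> 'rV[R]_m.+1) (l : R -> M) (a b : R) :
  is_lift x gamma l a b -> is_lift x (fun t => gamma (- t)) (fun t => l (- t)) (- b) (- a).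
Proof.
move=> Hl t /andP[t1 t2].
have nt : a < - t < b by apply/andP; split; lra.
split; last exact: (Hl _ nt).2.
have c1 : {for t, continuous (fun u : R => - u)} by apply: cvgN; exact: cvg_id.
exact: (continuous_comp c1 (Hl _ nt).1).
Qed.

Lemma lift_extend (gamma : R -> 'rV[R]_m.+1) (l : R -> M) (T : R) :
  Cr 1 setT gamma -> (forall t, C (gamma t)) -> 0 < T -> is_lift x gamma l (- T) T ->
  exists T' l', [/\ T < T', is_lift x gamma l' (- T') T' & l' 0 = l 0].
Proof.
move=> Cg gC T0 Hl.
have aT : - T < T by lra.
have [b [l1 [Tb Hl1 El1]]] := lift_extend_right Cg gC aT Hl.
have Hl2 := is_lift_opp Hl1; rewrite opprK in Hl2.
have bT : - b < T by lra.
have [a [l3 [Ta Hl3 El3]]] := lift_extend_right (Cr1_opp Cg) (fun t => gC (- t)) bT Hl2.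
have Hl4 := is_lift_opp Hl3; rewrite opprK in Hl4.
pose T' := Num.min a b.
have T'a : T' <= a by rewrite ge_min lexx.
have T'b : T' <= b by rewrite ge_min lexx orbT.
exists T', (fun t => l3 (- t)); split; first by rewrite lt_min Ta.
  move=> t /andP[t1 t2].
  have tab : - a < t < b by apply/andP; split; lra.
  have [c4 x4] := Hl4 t tab; split=> //.
  by rewrite x4 opprK.
rewrite oppr0 El3; last by apply/andP; split; lra.
by rewrite oppr0 El1 //; apply/andP; split; lra.
Qed.

(** Intervals symmetric about 0 reduce the maximality argument to the supremum of one number. *)
Definition symmetric_lift (gamma : R -> 'rV[R]_m.+1) p (T : R) (l : R -> M) :=
  [/\ 0 < T, is_lift x gamma l (- T) T & l 0 = p].

Lemma symmetric_lift_unique gamma p T1 T2 l1 l2 (t : R) : symmetric_lift gamma p T1 l1 ->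
  symmetric_lift gamma p T2 l2 -> `|t| < T1 -> `|t| < T2 -> l1 t = l2 t.
Proof.
move=> [T10 H1 E1] [T20 H2 E2] t1 t2.
pose T := Num.min T1 T2.
have TT1 : T <= T1 by rewrite ge_min lexx.
have TT2 : T <= T2 by rewrite ge_min lexx orbT.
have T0 : 0 < T by rewrite lt_min T10.
apply: (lift_unique_itv (gamma := gamma) (a := - T) (b := T) (s := 0) sec).
- by move=> u /andP[u1 u2]; apply: H1; apply/andP; split; lra.
- by move=> u /andP[u1 u2]; apply: H2; apply/andP; split; lra.
- by apply/andP; split; lra.
- by rewrite -ltr_norml lt_min t1.
- by rewrite E1 E2.
Qed.

Lemma lift_glue gamma p (A : set R) :
  (forall t, A t -> exists T l, symmetric_lift gamma p T l /\ `|t| < T) -> A 0 ->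
  exists l, l 0 = p /\ forall t, A t -> {for t, continuous l} /\ x (l t) = gamma t.
Proof.
move=> H A0.
(* Partial lifts starting at p agree wherever both are defined, so any choice of a value at [t] is
   consistent. *)
pose rel t q := exists T l, [/\ symmetric_lift gamma p T l, `|t| < T & l t = q].
pose l t := xget p (rel t).
have lE T l1 t : symmetric_lift gamma p T l1 -> `|t| < T -> l t = l1 t.
  move=> S1 tT; rewrite /l; case: xgetP => [q _ [T2 [l2 [S2 t2 <-]]]|/(_ (l1 t))].
    exact: (symmetric_lift_unique S2 S1).
  by case; exists T, l1.
exists l; split.
  have [T [l1 [S1 t1]]] := H 0 A0; rewrite (lE T l1) //; by case: S1.
move=> t At; have [T [l1 [S1 t1]]] := H t At.
have [_ H1 _] := S1.
have t1' : - T < t < T by rewrite -ltr_norml.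
rewrite (lE T l1) // (H1 t t1').2; split=> //.
apply: (continuous_near_eq (f := l1) _ (H1 t t1').1).
apply: nbhsS (open_nbhs_nbhs (conj (@itv_open _ (- T) T) t1')) => u /=.
by rewrite -ltr_norml => uT; rewrite (lE T l1).
Qed.

Lemma path_lift (gamma : R -> 'rV[R]_m.+1) (p : M) :
  Cr 1 setT gamma -> (forall t, C (gamma t)) -> x p = gamma 0 ->
  exists l : R -> M, l 0 = p /\ forall t, {for t, continuous l} /\ x (l t) = gamma t.
Proof.
move=> Cg gC xp.
have cg t : {for t, continuous gamma} := Cr_cont Cg I.
pose S := [set T | exists l, symmetric_lift gamma p T l].
have S0 : S !=set0.
  have [N [V [G ls]]] := sec p.
  have Vb : nbhs (gamma 0) V.
    by rewrite -xp; apply: open_nbhs_nbhs; split; [exact: ls_openO ls|exact: (ls_left ls (ls_N ls)).1].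
  have /nbhs_ballP[d /= d0 Hd] := cg 0 V Vb.
  exists d, (G \o gamma); split=> //; last by rewrite /= -xp (ls_left ls (ls_N ls)).2.
  move=> t td; have Vt : V (gamma t) by apply: Hd; rewrite -ball_normE /= sub0r normrN ltr_norml.
  split; last exact: (ls_right ls Vt (gC t)).2.
  exact: (continuous_comp (cg t) ((ls_smooth ls).1 _ Vt)).
(* If the half-lengths were bounded, gluing would produce a lift up to their supremum and
   [lift_extend] a longer one. *)
suff Sunb : forall T0, exists2 T, S T & T0 < T.
  have [l [l0 Hl]] : exists l, l 0 = p /\ forall t, setT t -> {for t, continuous l} /\ x (l t) = gamma t.
    by apply: lift_glue => // t _; have [T [l Sl] tT] := Sunb `|t|; exists T, l.
  by exists l; split=> // t; exact: Hl.
move=> T0; apply: contrapT => HT0.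
have ubS : ubound S T0 by move=> T ST; rewrite leNgt; apply/negP => lt; apply: HT0; exists T.
have supS : has_sup S by split=> //; exists T0.
pose T1 := sup S.
have T1ub : ubound S T1 := sup_upper_bound supS.
have T1gt0 : 0 < T1 by have [T [l Sl]] := S0; apply: lt_le_trans (T1ub T _); [case: Sl|exists l].
have [l [l0 Hl]] : exists l, l 0 = p /\ forall t, [set t | - T1 < t < T1] t -> {for t, continuous l} /\ x (l t) = gamma t.
  apply: lift_glue => [t|]; last by rewrite /= oppr_lt0 T1gt0.
  rewrite /= -ltr_norml => tT1.
  have [T [l Sl] tT] : exists2 T, S T & `|t| < T.
    have e0 : 0 < T1 - `|t| by rewrite subr_gt0.
    by have [T ST] := sup_adherent e0 supS; rewrite subKr => ?; exists T.
  by exists T, l.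
have [T2 [l2 [T12 Hl2 E2]]] := lift_extend Cg gC T1gt0 Hl.
have : S T2 by exists l2; split=> //; [exact: lt_trans T1gt0 T12|rewrite E2].
by move=> /T1ub; rewrite leNgt T12.
Qed.

End PathLifting.

(** * Sections and sheets obtained from families of paths *)

Section Sections.
Context {R : realType} {m : nat} {M : manifold R m}.
Variables (g : riemannian_metric M) (x : M -> 'rV[R]_m.+1) (C : set 'rV[R]_m.+1).
Hypotheses (Sx : smooth_map x) (mp : metric_preserving g x) (hg : complete_metric g).
Hypothesis xC : forall p, C (x p).
Hypothesis sec : forall p, exists N O G, local_section x C p N O G.

(** Time runs over all of R, as [path_lift] requires. The last field is continuity in endpoint and
    time together, relative to [C] and [O]. *)
Record star_paths (q : 'rV[R]_m.+1) (O : set 'rV[R]_m.+1) (gamma : 'rV[R]_m.+1 -> R -> 'rV[R]_m.+1) := {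
  sp_C1 : forall y, C y -> O y -> Cr 1 setT (gamma y);
  sp_C : forall y t, C y -> O y -> C (gamma y t);
  sp_0 : forall y, C y -> O y -> gamma y 0 = q;
  sp_1 : forall y, C y -> O y -> gamma y 1 = y;
  sp_cont : forall y t (V : set 'rV[R]_m.+1), C y -> O y -> nbhs (gamma y t) V ->
    exists2 d : R, 0 < d & nbhs y [set y' | C y' -> O y' ->
      forall s, `|s - t| < d -> V (gamma y' s)] }.

Lemma real_connected : connected [set: R].
Proof. by apply/connected_intervalP. Qed.

(** Continuity for the subspace topology, spelled out with ambient neighbourhoods since [V] need not
    be open. *)
Definition relatively_continuous (V : set 'rV[R]_m.+1) (F : 'rV[R]_m.+1 -> M) :=
  forall y, V y -> forall N, nbhs (F y) N -> nbhs y [set y' | V y' -> N (F y')].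

(** Continuity of y -> L y t at y0 holds at t = 0, where the lifts all start at p, and propagates to
    t = 1 by connectedness of the time axis. *)
Lemma star_lifts_continuous q O gamma p (L : 'rV[R]_m.+1 -> R -> M) : star_paths q O gamma ->
  (forall y, C y -> O y -> L y 0 = p /\ forall t, {for t, continuous (L y)} /\ x (L y t) = gamma y t) ->
  relatively_continuous (C `&` O) (fun y => L y 1).
Proof.
move=> sp HL y0 [Cy0 Oy0].
pose P t := forall N, nbhs (L y0 t) N -> nbhs y0 [set y | (C `&` O) y -> N (L y t)].
suff : P 1 by [].
have P0 : P 0.
  move=> N; rewrite (HL y0 Cy0 Oy0).1 => nN; apply: filterE => y [Cy Oy].
  by rewrite (HL y Cy Oy).1; exact: nbhs_singleton nN.
apply: (connected_locally_constant real_connected (P := P) _ (a := 0) (b := 1)) => // t0 _.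
have [c0 x0] := (HL y0 Cy0 Oy0).2 t0.
have [N [W [G ls]]] := sec (L y0 t0).
have nN : nbhs (L y0 t0) N by apply: open_nbhs_nbhs; split; [exact: ls_openN ls|exact: ls_N ls].
have nW : nbhs (gamma y0 t0) W.
  by rewrite -x0; apply: open_nbhs_nbhs; split; [exact: ls_openO ls|exact: (ls_left ls (ls_N ls)).1].
have [d d0 nY] := sp_cont sp Cy0 Oy0 nW.
have /nbhs_ballP[d' /= d'0 Hd'] := c0 N nN.
pose eta := Num.min d d'.
have eta0 : 0 < eta by rewrite lt_min d0.
have etad : eta <= d by rewrite ge_min lexx.
have etad' : eta <= d' by rewrite ge_min lexx orbT.
(* In this window of times the lifts of nearby paths are given by one and the same [G], so
   continuity passes from any of its times to any other. *)
have key s1 s2 : `|s1 - t0| < eta -> `|s2 - t0| < eta -> P s1 -> P s2.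
  move=> H1 H2 Ps1 N2 nN2.
  have Ns1 : nbhs (L y0 s1) N.
    apply: open_nbhs_nbhs; split; first exact: ls_openN ls.
    by apply: Hd'; rewrite -ball_normE /= distrC (lt_le_trans H1).
  have nY1 := nbhsI nY (Ps1 N Ns1).
  have E y : C y -> O y -> (forall s, `|s - t0| < d -> W (gamma y s)) -> N (L y s1) ->
      L y s2 = G (gamma y s2).
    move=> Cy Oy Wy Ny.
    have cgy s : {for s, continuous (gamma y)} := Cr_cont (sp_C1 sp Cy Oy) I.
    have inW s : t0 - eta < s < t0 + eta -> W (gamma y s).
      move=> /andP[s1' s2']; apply: Wy; apply: lt_le_trans etad.
      by rewrite ltr_norml; apply/andP; split; lra.
    have itv s : `|s - t0| < eta -> t0 - eta < s < t0 + eta.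
      by rewrite ltr_norml => /andP[? ?]; apply/andP; split; lra.
    apply: (lift_unique_itv (gamma := gamma y) (l2 := G \o gamma y) (a := t0 - eta) (b := t0 + eta) (s := s1) sec).
    - by move=> s _; exact: (HL y Cy Oy).2.
    - move=> s /inW Ws; split; last exact: (ls_right ls Ws (sp_C sp s Cy Oy)).2.
      exact: (continuous_comp (cgy s) ((ls_smooth ls).1 _ Ws)).
    - exact: itv.
    - exact: itv.
    - by rewrite /= -((HL y Cy Oy).2 s1).2 (ls_left ls Ny).2.
  have Wy0 := nbhs_singleton nY Cy0 Oy0.
  have Ws2 : W (gamma y0 s2) by apply: Wy0; exact: lt_le_trans H2 etad.
  have E0 := E y0 Cy0 Oy0 Wy0 (nbhs_singleton Ns1).
  rewrite E0 in nN2.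
  have [d2 d20 nY2] := sp_cont sp Cy0 Oy0 ((ls_smooth ls).1 _ Ws2 _ nN2).
  apply: (nbhsS2 _ nY1 nY2) => y [Wy Ny] Gy [Cy Oy].
  rewrite (E y Cy Oy (Wy Cy Oy) (Ny (conj Cy Oy))).
  by apply: (Gy Cy Oy); rewrite subrr normr0.
have nt : nbhs t0 [set t' | `|t' - t0| < eta].
  have := nbhsx_ballx t0 eta eta0; apply: nbhsS => t'.
  by rewrite -ball_normE /= distrC.
apply: nbhsS nt => t' Ht' _.
have t00 : `|t0 - t0| < eta by rewrite subrr normr0.
by split; exact: key.
Qed.

Lemma lift_unique_real (l1 l2 : R -> M) (s t : R) :
  (forall u, {for u, continuous l1}) -> (forall u, {for u, continuous l2}) ->
  (forall u, x (l1 u) = x (l2 u)) -> l1 s = l2 s -> l1 t = l2 t.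
Proof.
by move=> c1 c2 E H; apply: (lift_unique sec real_connected (l1 := l1) (l2 := l2) (a := s)).
Qed.

Lemma star_sections q O gamma : star_paths q O gamma -> exists F : M -> 'rV[R]_m.+1 -> M,
  [/\ forall p y, x p = q -> C y -> O y -> x (F p y) = y,
      forall p, x p = q -> relatively_continuous (C `&` O) (F p),
      forall p', O (x p') -> exists2 p, x p = q & F p (x p') = p' &
      forall p1 p2 y, x p1 = q -> x p2 = q -> C y -> O y -> F p1 y = F p2 y -> p1 = p2].
Proof.
move=> sp.
have exL (py : M * 'rV[R]_m.+1) : exists l : R -> M, x py.1 = q -> C py.2 -> O py.2 ->
    l 0 = py.1 /\ forall t, {for t, continuous l} /\ x (l t) = gamma py.2 t.
  have [[xp Cy Oy]|nH] := pselect [/\ x py.1 = q, C py.2 & O py.2].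
    have xp0 : x py.1 = gamma py.2 0 by rewrite (sp_0 sp).
    have [l Hl] := path_lift Sx mp hg sec (sp_C1 sp Cy Oy) (fun t => sp_C sp t Cy Oy) xp0.
    by exists l.
  by exists (fun=> py.1) => xp Cy Oy; exfalso; apply: nH.
have [L' HL'] := choice exL.
pose L p y := L' (p, y).
have HL p : x p = q -> forall y, C y -> O y ->
    L p y 0 = p /\ forall t, {for t, continuous (L p y)} /\ x (L p y t) = gamma y t.
  by move=> xp y Cy Oy; exact: (HL' (p, y) xp Cy Oy).
exists (fun p y => L p y 1); split.
- by move=> p y xp Cy Oy; rewrite ((HL p xp y Cy Oy).2 1).2 (sp_1 sp).
- move=> p xp; exact: (star_lifts_continuous sp (HL p xp)).
- move=> p' Op'; set y := x p'; have Cy : C y := xC p'.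
  (* The reversed path, lifted from p', ends at the point of the fibre of q whose own lift ends at
     p'. *)
  have cg' := (Cr1_line 1 (-1) (sp_C1 sp Cy Op')).1.
  have xp' : x p' = gamma y (1 + 0 * -1) by rewrite mul0r addr0 (sp_1 sp).
  have [l [l0 Hl]] := path_lift Sx mp hg sec cg' (fun t => sp_C sp _ Cy Op') xp'.
  have xl1 : x (l 1) = q by rewrite (Hl 1).2 mul1r subrr (sp_0 sp).
  exists (l 1) => //.
  have [L0 HL1] := HL _ xl1 y Cy Op'.
  rewrite -[RHS]l0.
  have -> : l 0 = (fun t : R => l (1 - t)) 1 by rewrite subrr.
  apply: (@lift_unique_real (L (l 1) y) (fun t : R => l (1 - t)) 0 1).
  + by move=> u; exact: (HL1 u).1.
  + move=> u; have c1 : {for u, continuous (fun t : R => 1 - t)}.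
      by apply: cvgB; [exact: cvg_cst|exact: cvg_id].
    exact: (continuous_comp c1 (Hl _).1).
  + by move=> u; rewrite (HL1 u).2 (Hl _).2; congr (gamma y _); lra.
  + by rewrite L0 subr0.
- move=> p1 p2 y x1 x2 Cy Oy E.
  have [L1 H1] := HL p1 x1 y Cy Oy; have [L2 H2] := HL p2 x2 y Cy Oy.
  rewrite -L1 -L2; apply: (@lift_unique_real (L p1 y) (L p2 y) 1 0 _ _ _ E).
  + by move=> u; exact: (H1 u).1.
  + by move=> u; exact: (H2 u).1.
  + by move=> u; rewrite (H1 u).2 (H2 u).2.
Qed.

Lemma smooth_into_restrict (O O' : set 'rV[R]_m.+1) (G : 'rV[R]_m.+1 -> M) :
  O' `<=` O -> smooth_into O G -> smooth_into O' G.
Proof.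
move=> sub [cG sG]; split=> [y /sub|c Ac r]; first exact: cG.
apply: Cr_subset (sG c Ac r) => y [Oy Gy]; split=> //; exact: sub.
Qed.

(** A continuous section stays locally in the sheet of a local section, where it must coincide with
    the smooth map [G]. *)
Lemma section_smooth (V : set 'rV[R]_m.+1) (F : 'rV[R]_m.+1 -> M) : V `<=` C ->
  relatively_continuous V F -> (forall y, V y -> x (F y) = y) -> smooth_into_subset V F.
Proof.
move=> VC cF xF q Vq.
have [N [W [G ls]]] := sec (F q).
have nN : nbhs (F q) N by apply: open_nbhs_nbhs; split; [exact: ls_openN ls|exact: ls_N ls].
have nq := cF q Vq N nN.
exists (W `&` ([set y' | V y' -> N (F y')]^°)%classic), G; split.
- by apply: openI; [exact: ls_openO ls|exact: open_interior].
- split; last exact: nq.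
  by have := (ls_left ls (ls_N ls)).1; rewrite xF.
- by apply: smooth_into_restrict (ls_smooth ls) => y [].
- move=> y [Wy /interior_subset /= Hy] Vy.
  by rewrite -{1}(ls_left ls (Hy Vy)).2 xF.
Qed.

(** For p'' near p', [F (x p'')] and p'' lie in one sheet over the same point, hence are equal. *)
Lemma sheet_open (O : set 'rV[R]_m.+1) (F : 'rV[R]_m.+1 -> M) : open O ->
  relatively_continuous (C `&` O) F -> (forall y, C y -> O y -> x (F y) = y) ->
  open [set p' | O (x p') /\ F (x p') = p'].
Proof.
move=> oO cF xF; rewrite openE => p' [Op' Fp'].
have [N [W [G ls]]] := sec p'.
have nN : nbhs p' N by apply: open_nbhs_nbhs; split; [exact: ls_openN ls|exact: ls_N ls].
have cx := continuous_in_chart Sx.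
have nF : nbhs (F (x p')) N by rewrite Fp'.
have n1 := cx p' _ (cF _ (conj (xC p') Op') N nF).
have n2 := cx p' _ (open_nbhs_nbhs (conj oO Op')).
apply: (nbhsS2 _ (nbhsI n1 n2) nN) => p'' [/= H1 O2] Np''; split=> //.
have NF := H1 (conj (xC p'') O2).
by rewrite -{2}(ls_left ls Np'').2 -(ls_left ls NF).2 xF //; exact: xC.
Qed.

(** The sheets are indexed by the fibre over q: the one of p consists of the endpoints of lifts
    started at p. *)
Lemma evenly_covered q O gamma : open O -> star_paths q O gamma ->
  exists (I : Type) (W : I -> set M),
    [/\ forall i, open (W i), trivIset setT W, x @^-1` O = \bigcup_i W i &
      forall i, diffeo_onto x (W i) (C `&` O)].
Proof.
move=> oO sp; have [F [xF cF Fsurj Finj]] := star_sections sp.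
exists {p | x p = q}, (fun i => [set p' | O (x p') /\ F (sval i) (x p') = p']); split.
- move=> [p xp] /=; apply: (sheet_open oO); first exact: cF.
  by move=> y; exact: xF.
- move=> [p1 x1] [p2 x2] _ _ [p' [/= [Op' E1] [_ E2]]].
  have E : p1 = p2 by apply: (Finj _ _ (x p')) => //; rewrite E1 E2.
  by subst p2; congr (exist _ _ _); exact: Prop_irrelevance.
- apply/seteqP; split=> [p' /= Op'|p' [i _ []]//].
  by have [p xp Fp] := Fsurj p' Op'; exists (exist _ p xp).
- move=> [p xp] /=; split.
    apply/seteqP; split=> [_ [p' [Op' _] <-]|y [Cy Oy]]; first by split.
    by exists (F p y); [split; rewrite xF|exact: xF].
  exists (F p); last by move=> p' [].
  apply: section_smooth; [by move=> y []|exact: cF|by move=> y []; exact: xF].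
Qed.

End Sections.

(** * Paths on the cylinder *)

Section CylinderGeometry.
Context {R : realType} {m : nat}.
Variable k : nat.
Hypothesis k_gt0 : (0 < k)%N.
Implicit Types q y z : 'rV[R]_m.+1.

Let C := [set y : 'rV[R]_m.+1 | head_sqr k y = k%:R].

Definition head_dot y z : R := \sum_(a < m.+1 | (a <= k)%N) y 0 a * z 0 a.

Lemma head_dotE y z : head_dot y z = dot y (head_part k z).
Proof. by rewrite dot_head_part. Qed.

Lemma head_dotC y z : head_dot y z = head_dot z y.
Proof. by apply: eq_bigr => a _; rewrite mulrC. Qed.

Lemma head_dotDl y y' z : head_dot (y + y') z = head_dot y z + head_dot y' z.
Proof. by rewrite !head_dotE dotDl. Qed.

Lemma head_dotZl c y z : head_dot (c *: y) z = c * head_dot y z.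
Proof. by rewrite !head_dotE dotZl. Qed.

Lemma head_dotDr y y' z : head_dot z (y + y') = head_dot z y + head_dot z y'.
Proof. by rewrite !(head_dotC z) head_dotDl. Qed.

Lemma head_dotZr c y z : head_dot z (c *: y) = c * head_dot z y.
Proof. by rewrite !(head_dotC z) head_dotZl. Qed.

Lemma head_dotyy y : head_dot y y = head_sqr k y.
Proof. by apply: eq_bigr => a _; rewrite expr2. Qed.

Lemma head_sqr0P y : head_sqr k y = 0 <-> head_part k y = 0.
Proof.
split=> H.
  by apply: dot_eq0; rewrite dot_head_head dot_head_sqr.
by rewrite -dot_head_sqr H /dot trmx0 mulmx0 mxE.
Qed.

Lemma head_partD y z : head_part k (y + z) = head_part k y + head_part k z.
Proof. by apply/rowP => a; rewrite !mxE; case: ifP; rewrite ?addr0. Qed.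

Lemma head_partZ c y : head_part k (c *: y) = c *: head_part k y.
Proof. by apply/rowP => a; rewrite !mxE; case: ifP; rewrite ?mulr0. Qed.

Lemma head_partN y : head_part k (- y) = - head_part k y.
Proof. by rewrite -scaleN1r head_partZ scaleN1r. Qed.

Lemma head_sqrN y : head_sqr k (- y) = head_sqr k y.
Proof. by apply: eq_bigr => a _; rewrite mxE sqrrN. Qed.

Lemma head_dot_le y z : C y -> C z -> head_dot y z <= k%:R.
Proof.
move=> Cy Cz; have := head_sqr_ge0 k (y - z).
rewrite -head_dotyy -scaleN1r !(head_dotDl, head_dotDr, head_dotZl, head_dotZr) !head_dotyy.
by rewrite Cy Cz (head_dotC z y); lra.
Qed.

(** The head part b' of [2 *: q + t *: (y - q)] joins the antipode - q' to the point q' + t (y' -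
    q') of the chord, and this is |b'|^2. The factor [lam] below, 2 <q', b'> / |b'|^2, solves |- q'
    + lam b'|^2 = k, the other root being 0. *)
Definition stereo_den q y (t : R) : R := head_sqr k (2 *: q + t *: (y - q)).

(* Path of the cylinder from q to y whose projection from the antipode of q
   is a segment: unlike a geodesic it is a rational function. *)
Definition stereo_path q y (t : R) : 'rV[R]_m.+1 :=
  let b := 2 *: q + t *: (y - q) in
  let lam := 2 * head_dot q b * (stereo_den q y t)^-1 in
  \row_a (if (a <= k)%N then - q 0 a + lam * b 0 a else q 0 a + t * (y 0 a - q 0 a)).

(** The complement of the fibre y' = - q', stated as a positivity so that it is visibly open. *)
Definition stereo_dom q := [set y | 0 < head_sqr k (y + q)].

Lemma stereo_den_gt0 q y t : C q -> C y -> stereo_dom q y -> 0 < stereo_den q y t.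
Proof.
move=> Cq Cy; rewrite /stereo_dom /stereo_den /=.
have := head_dot_le Cq Cy.
rewrite -![head_sqr k (_ + _)]head_dotyy -scaleN1r.
rewrite !(head_dotDl, head_dotDr, head_dotZl, head_dotZr) !head_dotyy (head_dotC y q) Cq Cy.
have : 0 < k%:R :> R by rewrite ltr0n.
set c := head_dot q y; set K : R := k%:R => K0 cK cK'.
(* With c = <q', y'> and K = k, the denominator equals 2 (K + c) + 2 (t - 1)^2 (K - c), and 2 (K +
   c) = |y' + q'|^2 > 0. *)
have := mulr_ge0 (sqr_ge0 (t - 1)) (_ : 0 <= K - c); rewrite subr_ge0 => /(_ cK).
by rewrite expr2; lra.
Qed.

Lemma stereo_pathC q y t : C q -> C y -> stereo_dom q y -> C (stereo_path q y t).
Proof.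
move=> Cq Cy Dy; have N0 := stereo_den_gt0 t Cq Cy Dy.
rewrite /C /= /stereo_path; set b := 2 *: q + _; set lam := _ * _^-1.
have -> : head_sqr k (\row_a (if (a <= k)%N then - q 0 a + lam * b 0 a else q 0 a + t * (y 0 a - q 0 a))) =
    head_sqr k ((-1) *: q + lam *: b).
  by apply: eq_bigr => a ak; rewrite !mxE ak mulN1r.
have E : lam * head_sqr k b = 2 * head_dot q b.
  by rewrite /lam /stereo_den -/b divfK // gt_eqF.
clearbody lam b.
rewrite -head_dotyy !(head_dotDl, head_dotDr, head_dotZl, head_dotZr) !head_dotyy (head_dotC b q) Cq.
by rewrite E; ring.
Qed.

Lemma stereo_path0 q y : C q -> stereo_path q y 0 = q.
Proof.
move=> Cq; apply/rowP => a; rewrite mxE; case: ifP => _; last by rewrite mul0r addr0.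
rewrite /stereo_den !scale0r !addr0 -head_dotyy !(head_dotZl, head_dotZr) head_dotyy Cq mxE.
have K0 : k%:R != 0 :> R by rewrite pnatr_eq0 -lt0n.
by field.
Qed.

Lemma stereo_path1 q y : C q -> C y -> stereo_dom q y -> stereo_path q y 1 = y.
Proof.
move=> Cq Cy Dy; have N0 := stereo_den_gt0 1 Cq Cy Dy.
apply/rowP => a; rewrite mxE; case: ifP => _; last by rewrite mul1r addrC subrK.
(* Since |q'| = |y'|, 2 <q', q' + y'> = |q' + y'|^2, so [lam] is 1 at t = 1. *)
have -> : 2 * head_dot q (2 *: q + 1 *: (y - q)) = stereo_den q y 1.
  rewrite /stereo_den -[RHS]head_dotyy -scaleN1r !(head_dotDl, head_dotDr, head_dotZl, head_dotZr).
  by rewrite !head_dotyy (head_dotC y q) Cq Cy; ring.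
by rewrite divff ?gt_eqF // !mxE; ring.
Qed.

Lemma Cr_head_sqr (E : normedModType R) r (U : set E) (Y : E -> 'rV[R]_m.+1) : open U ->
  Cr r U Y -> Cr r U (fun u => head_sqr k (Y u)).
Proof.
move=> oU HY; apply: Cr_sum; [exact: oU|move=> i _].
under eq_fun do rewrite expr2.
by apply: CrM; [exact: oU| |]; exact: ((Cr_mxP _ _ oU).1 HY).
Qed.

Lemma Cr_scale (E : normedModType R) r (U : set E) (T : E -> R) (Y : E -> 'rV[R]_m.+1) : open U ->
  Cr r U T -> Cr r U Y -> Cr r U (fun u => T u *: Y u).
Proof.
move=> oU HT HY; apply: (Cr_mxP _ _ oU).2 => i j; under eq_fun do rewrite mxE.
by apply: CrM; [exact: oU|exact: HT|exact: ((Cr_mxP _ _ oU).1 HY)].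
Qed.

Lemma Cr_stereo_path (E : normedModType R) r (U : set E) (Y : E -> 'rV[R]_m.+1) (T : E -> R) q : open U ->
  Cr r U Y -> Cr r U T -> (forall u, U u -> stereo_den q (Y u) (T u) != 0) ->
  Cr r U (fun u => stereo_path q (Y u) (T u)).
Proof.
move=> oU HY HT HN.
have Hb : Cr r U (fun u => 2 *: q + T u *: (Y u - q)).
  apply: CrD; [exact: oU|exact: Cr_cst|apply: Cr_scale; [exact: oU|exact: HT|]].
  by apply: CrB; [exact: oU|exact: HY|exact: Cr_cst].
have Hlam : Cr r U (fun u => 2 * head_dot q (2 *: q + T u *: (Y u - q)) * (stereo_den q (Y u) (T u))^-1).
  apply: CrM; [exact: oU| |apply: CrV; [exact: oU|exact: HN|exact: Cr_head_sqr]].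
  apply: CrM; [exact: oU|exact: Cr_cst|apply: Cr_sum; [exact: oU|move=> a _]].
  by apply: CrM; [exact: oU|exact: Cr_cst|exact: ((Cr_mxP _ _ oU).1 Hb)].
apply: (Cr_mxP _ _ oU).2 => i a; under eq_fun do rewrite mxE.
case: (a <= k)%N.
  apply: CrD; [exact: oU|exact: Cr_cst|apply: CrM; [exact: oU|exact: Hlam|]].
  exact: ((Cr_mxP _ _ oU).1 Hb).
apply: CrD; [exact: oU|exact: Cr_cst|apply: CrM; [exact: oU|exact: HT|]].
apply: CrB; [exact: oU|exact: ((Cr_mxP _ _ oU).1 HY)|exact: Cr_cst].
Qed.

Lemma joint_continuity (f : 'rV[R]_m.+1 -> R -> 'rV[R]_m.+1) y t (V : set 'rV[R]_m.+1) :
  {for (y, t), continuous (fun yt : 'rV[R]_m.+1 * R => f yt.1 yt.2)} -> nbhs (f y t) V ->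
  exists2 d : R, 0 < d & nbhs y [set y' | forall s, `|s - t| < d -> V (f y' s)].
Proof.
move=> cf nV; have := cf V nV => -[[A B] /= [nA /nbhs_ballP[d /= d0 Hd]] AB].
exists d => //; apply: nbhsS nA => y' Ay' s st.
by apply: (AB (y', s)); split=> //; apply: Hd; rewrite -ball_normE /= distrC.
Qed.

Lemma Cr0_fst (U : set ('rV[R]_m.+1 * R)) : Cr 0 U (fun yt => yt.1).
Proof. by apply: Cr0 => u _; exact: cvg_fst. Qed.

Lemma Cr0_snd (U : set ('rV[R]_m.+1 * R)) : Cr 0 U (fun yt => yt.2).
Proof. by apply: Cr0 => u _; exact: cvg_snd. Qed.

Lemma stereo_dom_open q : open (stereo_dom q).
Proof.
have H : Cr 0 setT (fun y : 'rV[R]_m.+1 => head_sqr k (y + q)).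
  by apply: Cr_head_sqr; [exact: openT|apply: CrD; [exact: openT|exact: Cr_id|exact: Cr_cst]].
have c y : {for y, continuous (fun y : 'rV[R]_m.+1 => head_sqr k (y + q))} := Cr_cont H I.
exact: (open_preimage c (@open_gt R 0)).
Qed.

Lemma stereo_dom_base q : C q -> stereo_dom q q.
Proof.
move=> Cq; rewrite /stereo_dom /= -head_dotyy !(head_dotDl, head_dotDr) head_dotyy Cq.
have : 0 < k%:R :> R by rewrite ltr0n.
lra.
Qed.

Lemma stereo_star_paths q : C q -> star_paths C q (stereo_dom q) (stereo_path q).
Proof.
move=> Cq; split.
- move=> y Cy Dy; apply: Cr_stereo_path; [exact: openT|exact: Cr_cst|exact: Cr_id|].
  by move=> t _; rewrite gt_eqF // stereo_den_gt0.
- by move=> y t Cy Dy; exact: stereo_pathC.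
- by move=> y _ _; exact: stereo_path0.
- by move=> y Cy Dy; exact: stereo_path1.
- move=> y t V Cy Dy nV.
  pose den (yt : 'rV[R]_m.+1 * R) := stereo_den q yt.1 yt.2.
  have Hden : Cr 0 setT den.
    apply: Cr_head_sqr; first exact: openT.
    apply: CrD; [exact: openT|exact: Cr_cst|apply: Cr_scale; [exact: openT|exact: Cr0_snd|]].
    by apply: CrB; [exact: openT|exact: Cr0_fst|exact: Cr_cst].
  pose U := [set yt | 0 < den yt].
  have oU : open U.
    by apply: (open_preimage (f := den) _ (@open_gt R 0)) => u; exact: (Cr_cont Hden I).
  have HU : Cr 0 U (fun yt : 'rV[R]_m.+1 * R => stereo_path q yt.1 yt.2).
    apply: Cr_stereo_path; [exact: oU|exact: Cr0_fst|exact: Cr0_snd|].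
    by move=> u Uu; rewrite gt_eqF.
  have Uyt : U (y, t) by exact: stereo_den_gt0.
  have [d d0 Hd] := joint_continuity (Cr_cont HU Uyt) nV.
  by exists d => //; apply: nbhsS Hd => y' Hy' _ _.
Qed.

Lemma stereo_path_span q y t : exists a b, head_part k (stereo_path q y t) = a *: head_part k q + b *: head_part k y.
Proof.
pose b := 2 *: q + t *: (y - q).
pose lam := 2 * head_dot q b * (stereo_den q y t)^-1.
exists (- 1 + lam * (2 - t)), (lam * t); apply/rowP => a; rewrite !mxE -/b -/lam.
case ak: (a <= k)%N; last by rewrite !mulr0 addr0.
by ring.
Qed.

(** n < k + 1 vectors cannot span the first k + 1 coordinate directions, so a multiple of some basis
    vector escapes. The case n = 1 joins antipodal fibres; n = 2 is where k >= 2 enters. *)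
Lemma outside_span n (S : 'M[R]_(n, m.+1)) : (n <= k)%N -> (k <= m)%N ->
  exists e, C e /\ ~~ (head_part k e <= S)%MS.
Proof.
move=> nk km.
have : ~~ ((pid_mx k.+1 : 'M[R]_(k.+1, m.+1)) <= S)%MS.
  apply/negP => /mxrankS; rewrite rank_pid_mx ?ltnS // => H.
  by have := leq_trans H (rank_leq_row S); rewrite leqNgt ltnS nk.
move/row_subPn => [i Hi].
have rowE : row i (pid_mx k.+1 : 'M[R]_(k.+1, m.+1)) = delta_mx 0 (widen_ord (n := k.+1) (m := m.+1) km i).
  apply/rowP => a; rewrite !mxE eqxx ltn_ord andbT /=.
  by rewrite [i == a :> nat]eq_sym.
pose e : 'rV[R]_m.+1 := Num.sqrt k%:R *: delta_mx 0 (widen_ord (n := k.+1) (m := m.+1) km i).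
have hE : head_part k e = e.
  apply/rowP => a; rewrite !mxE eqxx /=; case: ifP => // /negbT ak.
  case: eqP => [E|]; last by rewrite mulr0.
  by move: ak; rewrite E /= -ltnS ltn_ord.
have k0 : 0 <= k%:R :> R by rewrite ler0n.
have sk : Num.sqrt k%:R != 0 :> R by rewrite gt_eqF // sqrtr_gt0 ltr0n.
exists e; split.
  rewrite /C /= -dot_head_sqr hE /e dotZl dotZr mulrA -expr2 sqr_sqrtr //.
  rewrite dotE (bigD1 (widen_ord (n := k.+1) (m := m.+1) km i)) //= big1 ?addr0.
    by rewrite mxE !eqxx !mulr1.
  by move=> a ai; rewrite mxE (negbTE ai) andbF mul0r.
rewrite hE; apply: contra Hi; rewrite rowE => H.
by have := scalemx_sub (Num.sqrt k%:R)^-1 H; rewrite /e scalerA mulVf // scale1r.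
Qed.

End CylinderGeometry.

(** * Covering and isometry *)

Section StarCovering.
Context {R : realType} {m : nat} {M : manifold R m}.
Variables (g : riemannian_metric M) (x : M -> 'rV[R]_m.+1) (C : set 'rV[R]_m.+1).
Hypotheses (Sx : smooth_map x) (mp : metric_preserving g x) (hg : complete_metric g).
Hypothesis xC : forall p, C (x p).
Hypothesis sec : forall p, exists N O G, local_section x C p N O G.

Lemma range_star q O gamma y : star_paths C q O gamma -> range x q -> C y -> O y -> range x y.
Proof.
move=> sp [p _ xp] Cy Oy; have [F [xF _ _ _]] := star_sections Sx mp hg xC sec sp.
by exists (F p y) => //; exact: xF.
Qed.

Lemma star_covering :
  (forall q, C q -> exists O gamma, [/\ open O, O q & star_paths C q O gamma]) ->
  C `<=` range x -> riemannian_covering g x C.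
Proof.
move=> star sub; split=> //.
  by apply/seteqP; split=> // _ [p _ <-]; exact: xC.
move=> q Cq; have [V [gamma [oV Vq sp]]] := star q Cq.
exists V; split=> //.
exact: (evenly_covered Sx mp hg xC sec oV sp).
Qed.

End StarCovering.

(** * The hyperplane, k = 0 *)

Section HyperplaneCase.
Context {R : realType} {m : nat} {M : manifold R m}.
Variables (g : riemannian_metric M) (x : M -> 'rV[R]_m.+1).
Hypotheses (hx : self_shrinker g x) (hg : complete_metric g).
Let C := [set y : 'rV[R]_m.+1 | y 0 0 = 0].
Hypothesis xC : forall p, C (x p).

Lemma hyperplane_local_section p : exists N O G, local_section x C p N O G.
Proof.
have [_ [[Sx _] mp] _] := hx.
pose c := chart_at p; have Ac : atlas c := chart_at_atlas p; have dp : chart_dom c p := chart_at_dom p.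
have cp := chart_dom_cod dp.
apply: (local_section_exists (nu := delta_mx 0 0) (O1 := setT) Sx xC Ac dp (shrinker_free hx Ac cp)) => //.
- by apply/eqP => /rowP/(_ 0); rewrite !mxE eqxx => /eqP; rewrite oner_eq0.
- apply/matrixP => i j; rewrite ord1 [RHS]mxE mxE (bigD1 0) //= big1 ?addr0; last first.
    by move=> a a0; rewrite !mxE (negbTE a0) andbF mulr0.
  rewrite [_^T _ _]mxE [delta_mx _ _ _ _]mxE !eqxx mulr1.
  rewrite (jacE 0 (Cr_derivable (Sx c Ac 1%N) cp)) /pd.
  have -> : (fun w => in_chart x c w 0 0) = (fun=> 0) by apply/funext => w; exact: xC.
  exact: derive_cst.
- exact: openT.
- move=> y z s Cy Cz _ _ E; have := congr1 (fun w : 'rV[R]_m.+1 => w 0 0) E.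
  rewrite !mxE !eqxx Cy Cz subrr mulr1 => s0.
  by move: E; rewrite -s0 scale0r => /eqP; rewrite subr_eq0 => /eqP.
Qed.

Lemma segment_star_paths q : C q -> star_paths C q setT (fun y t => q + t *: (y - q)).
Proof.
move=> Cq; split.
- by move=> y _ _; apply: Cr_affine; exact: openT.
- by move=> y t Cy _; rewrite /C /= !mxE Cq Cy subrr mulr0 addr0.
- by move=> y _ _; rewrite scale0r addr0.
- by move=> y _ _; rewrite scale1r addrC subrK.
- move=> y t V Cy _ nV.
  have H : Cr 0 setT (fun yt : 'rV[R]_m.+1 * R => q + yt.2 *: (yt.1 - q)).
    apply: CrD; [exact: openT|exact: Cr_cst|apply: Cr_scale; [exact: openT|exact: Cr0_snd|]].
    by apply: CrB; [exact: openT|exact: Cr0_fst|exact: Cr_cst].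
  have [d d0 Hd] := joint_continuity (f := fun y t => q + t *: (y - q)) (Cr_cont (u := (y, t)) H I) nV.
  by exists d => //; apply: nbhsS Hd => y' Hy' _ _.
Qed.

Lemma hyperplane_covering (p0 : M) : riemannian_covering g x C.
Proof.
have [_ [[Sx _] mp] _] := hx.
apply: (star_covering Sx mp hg xC hyperplane_local_section).
  move=> q Cq; exists setT, (fun y t => q + t *: (y - q)); split=> //; first exact: openT.
  exact: segment_star_paths.
move=> y Cy; apply: (range_star Sx mp hg xC hyperplane_local_section (segment_star_paths (xC p0)) _ Cy I).
by exists p0.
Qed.

End HyperplaneCase.

(** * The cylinder, k >= 1 *)

Section CylinderCase.
Context {R : realType} {m : nat} {M : manifold R m}.
Variables (g : riemannian_metric M) (x : M -> 'rV[R]_m.+1) (k : nat).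
Hypotheses (hx : self_shrinker g x) (hg : complete_metric g) (k_gt0 : (0 < k)%N) (km : (k <= m)%N).
Let C := [set y : 'rV[R]_m.+1 | head_sqr k y = k%:R].
Hypothesis xC : forall p, C (x p).

Let K_gt0 : 0 < k%:R :> R. Proof. by rewrite ltr0n. Qed.

Lemma cylinder_local_section p : exists N O G, local_section x C p N O G.
Proof.
have [_ [[Sx _] mp] _] := hx.
pose c := chart_at p; have Ac : atlas c := chart_at_atlas p; have dp : chart_dom c p := chart_at_dom p.
have cp := chart_dom_cod dp.
pose nu := head_part k (x p).
have nunu : dot nu nu = k%:R by rewrite /nu dot_head_head dot_head_sqr; exact: xC.
(* On the cylinder |y'|^2 is constant, so the first-order condition makes y' normal at every
   point. *)
have hle p' : head_sqr k (x p') <= k%:R by rewrite (xC p').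
have tang := touching_tangent hx Ac dp hle (xC p).
have nuE : head_part k nu = nu by apply/rowP => a; rewrite !mxE; case: (a <= k)%N.
(* If y = z + s nu and both points are on the cylinder, then s (<y, nu> + <z, nu>) = 0; on this
   half-space the bracket is positive. *)
apply: (local_section_exists (nu := nu) (O1 := [set y | 0 < dot y nu]) Sx xC Ac dp (shrinker_free hx Ac cp)) => //.
- apply/eqP => n0; move: nunu; rewrite n0 /dot mul0mx mxE => E.
  by have := K_gt0; rewrite -E ltxx.
- have H : Cr 0 setT (fun y : 'rV[R]_m.+1 => dot y nu).
    by apply: Cr_dot; [exact: openT|exact: Cr_id|exact: Cr_cst].
  by apply: (open_preimage (f := fun y : 'rV[R]_m.+1 => dot y nu) _ (@open_gt R 0)) => y; exact: (Cr_cont H I).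
- by rewrite /= /nu dot_head_sqr (xC p).
- move=> y z s Cy Cz /= Vy Vz E.
  have yE : y = z + s *: nu by rewrite -E addrC subrK.
  have hd : head_dot k z nu = dot z nu by rewrite head_dotE nuE.
  have hnn : head_sqr k nu = k%:R by rewrite -dot_head_sqr nuE.
  have : head_sqr k y = head_sqr k z by rewrite Cy Cz.
  rewrite yE -[LHS]head_dotyy !(head_dotDl, head_dotDr, head_dotZl, head_dotZr) !head_dotyy hnn (head_dotC k nu z) hd => E2.
  have : s * (dot y nu + dot z nu) = 0 by rewrite yE dotDl dotZl nunu; lra.
  move/eqP; rewrite mulf_eq0 => /orP[/eqP s0|/eqP H]; last by have := addr_gt0 Vy Vz; rewrite H ltxx.
  by rewrite s0 scale0r addr0.
Qed.

Lemma cylinder_star q : C q -> exists O gamma, [/\ open O, O q & star_paths C q O gamma].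
Proof.
move=> Cq; exists (stereo_dom k q), (stereo_path k q); split.
- exact: stereo_dom_open.
- exact: (stereo_dom_base k_gt0 Cq).
- exact: (stereo_star_paths k_gt0 Cq).
Qed.

Lemma head_neq0 y : C y -> head_part k y != 0.
Proof.
move=> Cy; apply/eqP => /head_sqr0P E; have := K_gt0.
by rewrite -Cy E ltxx.
Qed.

Lemma not_stereo_dom (q y : 'rV[R]_m.+1) : ~ stereo_dom k q y -> head_part k y = - head_part k q.
Proof.
rewrite /stereo_dom /= => /negP; rewrite lt_neqAle head_sqr_ge0 andbT negbK => /eqP/esym/head_sqr0P.
by rewrite head_partD => /eqP; rewrite addr_eq0 => /eqP.
Qed.

Lemma cylinder_range (p0 : M) : C `<=` range x.
Proof.
have [_ [[Sx _] mp] _] := hx.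
move=> y Cy; set q := x p0; have Cq : C q := xC p0.
have step q' y' : range x q' -> C y' -> stereo_dom k q' y' -> range x y'.
  move=> Rq' Cy' Dy'; have Cq' : C q' by case: Rq' => p _ <-; exact: xC.
  exact: (range_star Sx mp hg xC cylinder_local_section (stereo_star_paths k_gt0 Cq') Rq' Cy' Dy').
have Rq : range x q by exists p0.
have [Dy|/not_stereo_dom Ny] := pselect (stereo_dom k q y); first exact: step Dy.
(* The antipodal fibre is reached in two moves, through a point whose head part is not proportional
   to that of q. *)
have [e [Ce He]] := outside_span k_gt0 (head_part k q) k_gt0 km.
have De : stereo_dom k q e.
  apply: contrapT => /not_stereo_dom E; move: He; rewrite E.
  by rewrite eqmx_opp submx_refl.
have Re := step q e Rq Ce De.
apply: (step e y Re Cy); apply: contrapT => /not_stereo_dom E; move: He.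
by rewrite -[head_part k e]opprK -E Ny opprK submx_refl.
Qed.

Lemma cylinder_covering (p0 : M) : riemannian_covering g x C.
Proof.
have [_ [[Sx _] mp] _] := hx.
apply: (star_covering Sx mp hg xC cylinder_local_section cylinder_star).
exact: cylinder_range.
Qed.

(* The condition on the span keeps the stereographic path from z to y away from
   the fibres of q and of its antipode, where one of the sections is undefined. *)
Lemma sections_agree_along (q : 'rV[R]_m.+1) (F1 F2 : 'rV[R]_m.+1 -> M) (V1 V2 : set 'rV[R]_m.+1) z y :
  relatively_continuous (C `&` V1) F1 -> relatively_continuous (C `&` V2) F2 ->
  (forall w, C w -> V1 w -> x (F1 w) = w) -> (forall w, C w -> V2 w -> x (F2 w) = w) ->
  (forall w, C w -> head_part k w != head_part k q -> head_part k w != - head_part k q -> V1 w /\ V2 w) ->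
  C z -> C y -> stereo_dom k z y ->
  (forall a b, a *: head_part k z + b *: head_part k y != head_part k q) ->
  F1 z = F2 z -> F1 y = F2 y.
Proof.
move=> c1 c2 x1 x2 HV Cz Cy Dy span E.
have spl := stereo_star_paths k_gt0 Cz.
pose gamma := stereo_path k z y.
have Cg t : C (gamma t) := sp_C spl t Cy Dy.
have cg t : {for t, continuous gamma} := Cr_cont (sp_C1 spl Cy Dy) I.
have Vg t : V1 (gamma t) /\ V2 (gamma t).
  have [a [b Eab]] := stereo_path_span k z y t.
  apply: HV => //; rewrite [head_part k (gamma t)]Eab; first exact: span.
  have := span (- a) (- b); apply: contra => /eqP H.
  by rewrite !scaleNr -opprD H opprK.
have clift (F : 'rV[R]_m.+1 -> M) V t : relatively_continuous (C `&` V) F -> (forall u, V (gamma u)) ->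
    {for t, continuous (F \o gamma)}.
  move=> cF VF N nN; have nW := cg t _ (cF _ (conj (Cg t) (VF t)) N nN).
  by apply: nbhsS nW => u /= H; apply: H; split.
have E0 : gamma 0 = z := sp_0 spl Cy Dy; have E1 : gamma 1 = y := sp_1 spl Cy Dy.
rewrite -E1; apply: (@lift_unique_real _ _ _ x C cylinder_local_section (F1 \o gamma) (F2 \o gamma) 0 1).
- by move=> u; apply: (clift F1 V1) => // v; exact: (Vg v).1.
- by move=> u; apply: (clift F2 V2) => // v; exact: (Vg v).2.
- by move=> u; rewrite /= x1 ?x2 //; [exact: (Vg u).2|exact: (Vg u).1].
- by rewrite /= E0.
Qed.

Lemma cylinder_isometry (p0 : M) : (2 <= k)%N -> riemannian_isometry g x C.
Proof.
move=> k2; have [conM [[Sx _] mp] _] := hx.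
have rangeC : x @` setT = C.
  by apply/seteqP; split=> [_ [p _ <-]|]; [exact: xC|exact: cylinder_range].
split=> //; split=> //.
set q := x p0; have Cq : C q := xC p0.
have Cnq : C (- q) by rewrite /C /= head_sqrN.
have [F1' [xF1 cF1 F1surj F1inj]] := star_sections Sx mp hg xC cylinder_local_section (stereo_star_paths k_gt0 Cq).
have [F2' [xF2 cF2 F2surj F2inj]] := star_sections Sx mp hg xC cylinder_local_section (stereo_star_paths k_gt0 Cnq).
have HV w : C w -> head_part k w != head_part k q -> head_part k w != - head_part k q ->
    stereo_dom k q w /\ stereo_dom k (- q) w.
  move=> Cw w1 w2; split; apply: contrapT => /not_stereo_dom E.
    by move: w2; rewrite E eqxx.
  by move: w1; rewrite E head_partN opprK eqxx.
have HV' w : stereo_dom k q w -> stereo_dom k (- q) w -> C w ->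
    head_part k w != head_part k q /\ head_part k w != - head_part k q.
  rewrite /stereo_dom /= => d1 d2 Cw; split; apply/eqP => E.
    have : head_sqr k (w + - q) = 0 by apply/head_sqr0P; rewrite head_partD head_partN E subrr.
    by move=> H; move: d2; rewrite H ltxx.
  have : head_sqr k (w + q) = 0 by apply/head_sqr0P; rewrite head_partD E addNr.
  by move=> H; move: d1; rewrite H ltxx.
have k1 : (1 <= k)%N := k_gt0.
have [z [Cz Hz]] := outside_span k_gt0 (head_part k q) k1 km.
have z1 : head_part k z != head_part k q by apply: contra Hz => /eqP ->.
have z2 : head_part k z != - head_part k q by apply: contra Hz => /eqP ->; rewrite eqmx_opp.
have [Dz Dz'] := HV z Cz z1 z2.
pose F1 := F1' p0.
have xF1z : x (F1 z) = z by exact: xF1.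
(* The second section, over the complement of the fibre of q, is started at the point over - q for
   which it agrees with the first at z. *)
have [p2 xp2 F2z] : exists2 p, x p = - q & F2' p (x (F1 z)) = F1 z.
  by apply: F2surj; rewrite xF1z.
pose F2 := F2' p2; rewrite xF1z in F2z.
have X1 w : C w -> stereo_dom k q w -> x (F1 w) = w by move=> *; exact: xF1.
have X2 w : C w -> stereo_dom k (- q) w -> x (F2 w) = w by move=> *; exact: xF2.
have c1 : relatively_continuous (C `&` stereo_dom k q) F1 by exact: cF1.
have c2 : relatively_continuous (C `&` stereo_dom k (- q)) F2 by exact: cF2.
have along z' y' := @sections_agree_along q F1 F2 _ _ z' y' c1 c2 X1 X2 HV.
have antipode (z' y' : 'rV[R]_m.+1) : (forall a : R, head_part k y' != a *: head_part k z') -> stereo_dom k z' y'.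
  move=> H; apply: contrapT => /not_stereo_dom E; have := H (-1).
  by rewrite scaleN1r E eqxx.
have normq w a : C w -> head_part k q = a *: head_part k w ->
   head_part k w = head_part k q \/ head_part k w = - head_part k q.
  move=> Cw E.
  have a2 : a ^+ 2 = 1.
    have : head_sqr k q = a ^+ 2 * head_sqr k w.
      by rewrite -(dot_head_sqr k q) -(dot_head_head k q q) -(dot_head_sqr k w) -(dot_head_head k w w) E dotZl dotZr mulrA expr2.
    have K0 : k%:R != 0 :> R by rewrite gt_eqF.
    by rewrite Cq Cw => H; apply: (mulIf K0); rewrite mul1r -H.
  move/eqP: a2; rewrite sqrf_eq1 => /orP[] /eqP aE; rewrite aE in E.
    by left; rewrite E scale1r.
  by right; rewrite E scaleN1r opprK.
have agree y : C y -> stereo_dom k q y -> stereo_dom k (- q) y -> F1 y = F2 y.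
  move=> Cy Dy Dy'; have [y1 y2] := HV' y Dy Dy' Cy.
  have Ez : F1 z = F2 z by rewrite -F2z.
  have zq a : head_part k q != a *: head_part k z.
    by apply/eqP => /(normq z a Cz) [] E; [move: z1|move: z2]; rewrite E eqxx.
  have yq a : head_part k q != a *: head_part k y.
    by apply/eqP => /(normq y a Cy) [] E; [move: y1|move: y2]; rewrite E eqxx.
  (* The stereographic path from z to y stays in the span of their head parts; if
     it may run into the fibre of q or of its antipode, go through a point e off
     the span of z and q. *)
  have [[a [b Eab]]|nspan] := pselect (exists a b, head_part k y = a *: head_part k z + b *: head_part k q).
    have [e [Ce He]] := outside_span k_gt0 (col_mx (head_part k z) (head_part k q)) k2 km.
    have inspan a' b' : ((a' *: head_part k z + b' *: head_part k q)%R <= col_mx (head_part k z) (head_part k q))%MS.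
      have s1 : (head_part k z <= col_mx (head_part k z) (head_part k q))%MS by rewrite -addsmxE addsmxSl.
      have s2 : (head_part k q <= col_mx (head_part k z) (head_part k q))%MS by rewrite -addsmxE addsmxSr.
      exact: (addmx_sub (scalemx_sub a' s1) (scalemx_sub b' s2)).
    have Ne a' b' : head_part k e != a' *: head_part k z + b' *: head_part k q.
      by apply: contra He => /eqP ->.
    have Ee : F1 e = F2 e.
      apply: (along z e Cz Ce _ _ Ez).
        by apply: antipode => a'; have := Ne a' 0; rewrite scale0r addr0.
      move=> a' b'; apply/eqP => E; have [b0|b0] := eqVneq b' 0.
        by have := zq a'; rewrite -E b0 scale0r addr0 eqxx.
      have := Ne (- (b'^-1 * a')) b'^-1; rewrite -E scalerDr !scalerA mulVf // scale1r.
      by rewrite addrA -scalerDl addNr scale0r add0r eqxx.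
    have Ney a' : head_part k y != a' *: head_part k e.
      apply/eqP => E; have [a0|a0] := eqVneq a' 0.
        by have := head_neq0 Cy; rewrite E a0 scale0r eqxx.
      have := Ne (a'^-1 * a) (a'^-1 * b).
      by rewrite -!scalerA -scalerDr -Eab E scalerA mulVf // scale1r eqxx.
    apply: (along e y Ce Cy _ _ Ee); first exact: antipode.
    move=> a' b'; apply/eqP => E; have [a0|a0] := eqVneq a' 0.
      by have := yq b'; rewrite -E a0 scale0r add0r eqxx.
    (* Otherwise e' is a combination of q' and y', hence of z' and q' since y' lies in their span,
       against the choice of e. *)
    have E2 : head_part k e = a'^-1 *: (head_part k q - b' *: head_part k y).
      by rewrite -E addrK scalerA mulVf // scale1r.
    have := Ne (- (a'^-1 * b' * a)) (a'^-1 * (1 - b' * b)); rewrite E2 Eab => /eqP; apply.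
    move: (head_part k z) (head_part k q) => Z Q.
    by apply/rowP => i; rewrite !mxE; ring.
  have nsp a b : head_part k y != a *: head_part k z + b *: head_part k q.
    by apply/eqP => E; apply: nspan; exists a, b.
  apply: (along z y Cz Cy _ _ Ez).
    by apply: antipode => a; have := nsp a 0; rewrite scale0r addr0.
  move=> a b; apply/eqP => E; have [b0|b0] := eqVneq b 0.
    by have := zq a; rewrite -E b0 scale0r addr0 eqxx.
  have := nsp (- (b^-1 * a)) b^-1; rewrite -E scalerDr !scalerA mulVf // scale1r.
  by rewrite addrA -scalerDl addNr scale0r add0r eqxx.
(* The second section is used only on the fibre antipodal to q; agreement on the overlap makes [F]
   continuous there too. *)
pose F y := if pselect (stereo_dom k q y) then F1 y else F2 y.
have FE1 y : stereo_dom k q y -> F y = F1 y by rewrite /F; case: pselect.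
have FE2 y : C y -> stereo_dom k (- q) y -> F y = F2 y.
  by move=> Cy Dy'; rewrite /F; case: pselect => // Dy; exact: agree.
have cover y : C y -> ~ stereo_dom k q y -> stereo_dom k (- q) y.
  move=> Cy /not_stereo_dom E; apply: contrapT => nD; have := not_stereo_dom nD.
  rewrite E head_partN opprK => /eqP; rewrite eq_sym -addr_eq0 -mulr2n => /eqP H.
  have := head_neq0 Cq; move: H; rewrite -scaler_nat => /eqP.
  by rewrite scaler_eq0 pnatr_eq0 /= => ->.
have xF y : C y -> x (F y) = y.
  move=> Cy; have [Dy|nDy] := pselect (stereo_dom k q y); first by rewrite FE1 // X1.
  by have Dy' := cover y Cy nDy; rewrite FE2 // X2.
have cF : relatively_continuous C F.
  have loc V F' y : open V -> V y -> C y -> relatively_continuous (C `&` V) F' ->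
      (forall w, C w -> V w -> F w = F' w) -> forall N, nbhs (F y) N -> nbhs y [set y' | C y' -> N (F y')].
    move=> oV Vy Cy cF' EF N; rewrite EF // => nN.
    apply: (nbhsS2 _ (cF' y (conj Cy Vy) N nN) (open_nbhs_nbhs (conj oV Vy))) => w Hw Vw Cw.
    by rewrite EF //; apply: Hw.
  have E1 w : C w -> stereo_dom k q w -> F w = F1 w by move=> _; exact: FE1.
  have E2 w : C w -> stereo_dom k (- q) w -> F w = F2 w by exact: FE2.
  have o1 : open (stereo_dom k q : set 'rV[R]_m.+1) by exact: stereo_dom_open.
  have o2 : open (stereo_dom k (- q) : set 'rV[R]_m.+1) by exact: stereo_dom_open.
  move=> y Cy; have [Dy|nDy] := pselect (stereo_dom k q y).
    exact: (loc (stereo_dom k q) F1 y o1 Dy Cy c1 E1).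
  exact: (loc (stereo_dom k (- q)) F2 y o2 (cover y Cy nDy) Cy c2 E2).
exists F; first by apply: (section_smooth cylinder_local_section).
have cx := continuous_in_chart Sx.
(* [F \o x] and the identity are two lifts of [x] on the connected Sigma that coincide at [F1 z];
   hence [F] inverts [x]. *)
move=> p _; apply: (@lift_unique _ _ _ x C cylinder_local_section M setT (F \o x) id (F1 z) conM) => //.
- by move=> p' _ N nN; have := cx p' _ (cF _ (xC p') N nN); apply: nbhsS => p'' /= H; apply: H; exact: xC.
- by move=> p' _; exact: cvg_id.
- by move=> p' _; rewrite /= xF //; exact: xC.
- by rewrite /= xF1z FE1.
Qed.

End CylinderCase.

Lemma cylinderE (R : realType) (m k : nat) : (0 < k)%N ->
  cylinder k (Num.sqrt k%:R) = [set y : 'rV[R]_m.+1 | head_sqr k y = k%:R].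
Proof.
move=> k0; have -> : cylinder k (Num.sqrt k%:R) = [set y : 'rV[R]_m.+1 | head_norm k y = Num.sqrt k%:R].
  by case: k k0.
by apply/seteqP; split=> y /=; rewrite head_normE ?sqrtr_ge0 // sqr_sqrtr ?ler0n.
Qed.

Theorem theorem2 (R : realType) (m k : nat) (hk : (k <= m)%N)
    (r : R) (hr : 0 < r)
    (M : manifold R m) (g : riemannian_metric M) (x : M -> 'rV[R]_m.+1)
    (hx : self_shrinker g x) (hg : complete_metric g)
    (hH : forall c u, atlas c -> chart_cod c u ->
       enorm (mean_curvature g x c u) <= Num.sqrt k%:R)
    (D : set 'rV[R]_m.+1) (hD : cylinder_domain k r D)
    (hxD : range x `<=` D)
    (htouch : range x `&` cylinder k r !=set0) :
  [/\ (0 < k)%N -> r = Num.sqrt k%:R,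
      riemannian_covering g x (cylinder k (Num.sqrt k%:R)) &
      (2 <= k)%N -> riemannian_isometry g x (cylinder k (Num.sqrt k%:R))].
Proof.
have [rE xC] := shrinker_in_cylinder hx hk hr hH hD hxD htouch.
(* The contact point also shows that Sigma is nonempty, which surjectivity of [x] requires. *)
have [_ [[p0 _ _] _]] := htouch.
case: (posnP k) => [k0|k0].
  by subst k; split=> //; exact: (hyperplane_covering hx hg xC p0).
have xC' p : [set y | head_sqr k y = k%:R] (x p) by rewrite -cylinderE.
rewrite cylinderE //; split; first by move=> _; exact: rE.
  exact: (cylinder_covering hx hg k0 hk xC' p0).
exact: (cylinder_isometry hx hg k0 hk xC' p0).
Qed.
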